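(* Let $|\mathrm{Re}\,\nu|<\frac14$. Then, for any $p\in\mathbb Z$ and non-zero $u\in\mathbb C$, $$\mathcal K_{\nu,p}(u)=(-1)^p\frac2\pi\int_0^\infty y^{2\nu-1}\left(\frac{ye^{i\vartheta}+(ye^{i\vartheta})^{-1}}{|ye^{i\vartheta}+(ye^{i\vartheta})^{-1}|}\right)^{2p}J_{2p}\left(|u|\,|ye^{i\vartheta}+(ye^{i\vartheta})^{-1}|\right)dy,$$ where $u=|u|e^{i\vartheta}$.
   Context: $J_{2p}$ is the Bessel function of the first kind. $J^*_\nu(x)$ is the entire function of $x$ equal to $J_\nu(x)(x/2)^{-\nu}$ for $x>0$. For $\nu\in\mathbb C$, $p\in\mathbb Z$, $u\in\mathbb C\setminus\{0\}$, $$\mathcal J_{\nu,p}(u)=|u/2|^{2\nu}(u/|u|)^{-2p}J^*_{\nu-p}(u)J^*_{\nu+p}(\bar u),\qquad \mathcal K_{\nu,p}(u)=\frac1{\sin\pi\nu}\{\mathcal J_{-\nu,-p}(u)-\mathcal J_{\nu,p}(u)\},$$ extended by continuity to integral $\nu$. *)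

(* Defs.v *)
From HB Require Import structures.
From mathcomp Require Import all_boot all_order all_algebra complex.
From mathcomp Require Import all_classical all_reals all_analysis.
From mathcomp Require Import ring.
Import Order.TTheory GRing.Theory Num.Theory numFieldNormedType.Exports.

Set Implicit Arguments.
Unset Strict Implicit.
Unset Printing Implicit Defensive.

Local Open Scope classical_set_scope.
Local Open Scope ring_scope.
Local Open Scope complex_scope.

(* Limits of complex sequences and functions are taken in R[i]^o, the normed
   module of R[i] over itself: R[i] alone is not recognized as a topological
   type. *)

Section ComplexFunctions.
Context {R : realType}.
Implicit Types (z s nu u : R[i]) (x : R) (p : int).

(* The norm `|z| of R[i] is an element of R[i]; this is the same number in R. *)
Definition cabs z : R := complex.Re `|z|.

Definition cexp z : R[i] :=
  (expR (complex.Re z))%:C * (cos (complex.Im z) +i* sin (complex.Im z)).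

Definition csin z : R[i] := (cexp ('i%C * z) - cexp (- ('i%C * z))) / (2 * 'i%C).

(* x ^ s for x >= 0, with the principal value for x > 0 and the same convention
   as powR at x = 0. *)
Definition cpow x s : R[i] :=
  if x == 0 then (s == 0)%:R else cexp (s * (ln x)%:C).

(* The entire function 1 / Gamma, by Gauss's product
   1 / Gamma(z) = lim_n z (z + 1) ... (z + n) / (n! n^z). *)
Definition rGamma z : R[i] :=
  limn (fun n : nat =>
    (\prod_(0 <= k < n.+1) (z + k%:R)) / (n`!%:R * cpow n%:R z) : R[i]^o).

(* J^*_nu(z) = sum_k (-1)^k (z/2)^(2k) / (k! Gamma(nu + k + 1)). *)
Definition besselJstar nu z : R[i] :=
  limn (series (fun k : nat =>
    (-1) ^+ k * (z / 2) ^+ (2 * k) / k`!%:R * rGamma (nu + k%:R + 1) : R[i]^o)).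

(* The Bessel function of the first kind on x > 0.  If nu is an integer, the
   convention for 0 ^ s makes the value at x = 0 the right one too, also for
   nu < 0. *)
Definition besselJ nu x : R[i] := cpow (x / 2) nu * besselJstar nu x%:C.

Definition calJ nu p u : R[i] :=
  cpow (cabs (u / 2)) (2 * nu) * (u / `|u|) ^ (- (2 * p))
  * besselJstar (nu - p%:~R) u * besselJstar (nu + p%:~R) u^*%C.

Definition calK_generic nu p u : R[i] :=
  (csin (pi%:C * nu))^-1 * (calJ (- nu) (- p) u - calJ nu p u).

Definition calK nu p u : R[i] :=
  if `[< exists n : int, nu = n%:~R >] then
    lim ((calK_generic mu p u : R[i]^o) @[mu --> (nu : R[i]^o)^'])
  else calK_generic nu p u.

Lemma cexpD z s : cexp (z + s) = cexp z * cexp s.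
Proof.
case: z s => [a b] [c d]; rewrite /cexp /= expRD cosD sinD.
by apply/eqP; rewrite eq_complex /=; apply/andP; split; apply/eqP; ring.
Qed.

Lemma besselJstarE nu x : 0 < x ->
  besselJstar nu x%:C = besselJ nu x * cpow (x / 2) (- nu).
Proof.
move=> x0; have /negbTE x20 : x / 2 != 0 by rewrite mulf_neq0// gt_eqF.
rewrite /besselJ /cpow x20 mulrAC -cexpD mulNr subrr.
by rewrite /cexp /= expR0 cos0 sin0 !mul1r.
Qed.

End ComplexFunctions.

Section ComplexIntegral.
Context {d : measure_display} {T : measurableType d} {R : realType}.
Context (mu : {measure set T -> \bar R}) (D : set T) (f : T -> R[i]).

Definition cintegrable : Prop :=
  mu.-integrable D (fun x => (complex.Re (f x))%:E)
  /\ mu.-integrable D (fun x => (complex.Im (f x))%:E).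

Definition cintegral : R[i] :=
  (\int[mu]_(x in D) complex.Re (f x)) +i* (\int[mu]_(x in D) complex.Im (f x)).

End ComplexIntegral.

(* The integrand, where w = y e^(i theta) + (y e^(i theta))^-1.  If w = 0, which
   happens only for y = 1 and cos theta = 0, the quotient w / |w| is 0 here:
   one point, which does not affect the integral. *)
Definition integrand {R : realType} (nu : R[i]) (p : int) (u : R[i]) (theta y : R)
    : R[i] :=
  let z := y%:C * cexp ('i%C * theta%:C) in
  let w := z + z^-1 in
  cpow y (2 * nu - 1) * (w / `|w|) ^ (2 * p)
  * besselJ (2 * p)%:~R (cabs u * cabs w).

(* Main.v *)
Require Import Defs.
From HB Require Import structures.
From mathcomp Require Import all_boot all_order all_algebra complex.
From mathcomp Require Import all_classical all_reals all_analysis.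
From mathcomp Require Import measurable_realfun ring lra zify.
Import Order.TTheory GRing.Theory Num.Theory numFieldNormedType.Exports.
Set Implicit Arguments.
Unset Strict Implicit.
Unset Printing Implicit Defensive.
Local Open Scope classical_set_scope.
Local Open Scope ring_scope.
Local Open Scope complex_scope.

(* Write u = r e^(i theta) and let r vary.  A continuous function of r > 0 is
   determined by its integrals against r^(2p+1) e^(-s r^2), s = 2, 3, 4, ...
   (Lerch), so it suffices to compute these for both sides, with p >= 0; the
   case p < 0 follows by conjugating u, and nu = 0 by continuity.  Let
   x = 1/(4s), q = e^(2 i theta).  On the integral side, Fubini's theorem and
   Weber's integral of J_(2p) against the Gaussian give a multiple of
     e^(-2 x cos(2 theta)) sum_l C(2p, l) q^(l-p) K_(nu+l-p)(x),
   where K_m(x) is the integral of y^(2m-1) e^(-x (y^2 + y^-2)) over y > 0.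
   Comparing Wronskians, 2 sin(pi m) K_m = pi (I_(-m) - I_m) with
   I_m(x) = sum_k x^(m+2k) / (k! Gamma(m+k+1)).  On the other side, the product
   of two Bessel series is integrated term by term; the inner series is a Kummer
   series e^(-xq) times a polynomial, the outer one a binomial transform, and
   the outcome is the same sum with I_(nu+l-p) in place of K_(nu+l-p). *)

(** * Complex numbers *)

Section Complex.
Context {R : realType}.
Implicit Types (z w s : R[i]) (x y : R).

(** Gamma is given only by Gauss's product, K by an integral and I by a series, all at complex
    order, so every link between them is derived: Gauss's product is compared with Euler's integral,
    the reflection formula supplies the constant of one Wronskian, and K is recovered algebraically
    from Wronskians, without a theory of differential equations. The weight r^(2p+1) is dictated by
    Weber's integral, which is elementary when the power of r exceeds the order 2p of J by one; on
    the series side the same power produces Gamma(nu+p+1+k+j), which cancels one reciprocal Gamma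
    factor and leaves a Pochhammer symbol. The transform is taken for s >= 2 only, because the
    bounds for the two Bessel series grow like e^(r^2/2) each and some Gaussian decay must remain.
    The condition on Re nu gives absolute convergence of the integral, J decaying like z^(-1/2); the
    same decay, in a bound that separates r and y, justifies Fubini. Of the integer orders only 0
    lies in the strip, so one estimate near nu = 0 settles the extension by continuity. *)

Lemma normcE z : `|z| = (cabs z)%:C.
Proof. by rewrite /cabs normc_def. Qed.

Lemma cabsE z : cabs z = Num.sqrt (complex.Re z ^+ 2 + complex.Im z ^+ 2).
Proof. by rewrite /cabs normc_def. Qed.

Lemma cabs_ge0 z : 0 <= cabs z.
Proof. by rewrite cabsE sqrtr_ge0. Qed.

Lemma cabsM z w : cabs (z * w) = cabs z * cabs w.
Proof. by apply/complexI; rewrite rmorphM/= -!normcE normrM. Qed.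

Lemma cabs_triangle z w : cabs (z + w) <= cabs z + cabs w.
Proof. by rewrite -lecR rmorphD/= -!normcE ler_normD. Qed.

Lemma cabsN z : cabs (- z) = cabs z.
Proof. by rewrite /cabs normrN. Qed.

Lemma cabs_real x : cabs x%:C = `|x|.
Proof. by rewrite cabsE /= expr0n addr0 sqrtr_sqr. Qed.

Lemma cabs_nat n : cabs (n%:R : R[i]) = n%:R.
Proof. by rewrite /cabs normr_nat -(rmorph_nat (real_complex R)). Qed.

Lemma cabs0 : cabs (0 : R[i]) = 0.
Proof. exact: (cabs_nat 0). Qed.

Lemma cabs1 : cabs (1 : R[i]) = 1.
Proof. exact: (cabs_nat 1). Qed.

Lemma cabsX z n : cabs (z ^+ n) = cabs z ^+ n.
Proof. by elim: n => [|n IH]; rewrite ?expr0 ?cabs1// !exprS cabsM IH. Qed.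

Lemma cabsV z : cabs z^-1 = (cabs z)^-1.
Proof. by apply/complexI; rewrite fmorphV/= -!normcE normfV. Qed.

Lemma cabs_eq0 z : (cabs z == 0) = (z == 0).
Proof. by rewrite -[RHS]normr_eq0 normcE -(inj_eq (@complexI R)). Qed.

Lemma cabs_gt0 z : (0 < cabs z) = (z != 0).
Proof. by rewrite lt_def cabs_ge0 cabs_eq0 andbT. Qed.

Lemma cabs_Re z : `|complex.Re z| <= cabs z.
Proof. by rewrite cabsE -sqrtr_sqr ler_wsqrtr// lerDl sqr_ge0. Qed.

Lemma cabs_Im z : `|complex.Im z| <= cabs z.
Proof. by rewrite cabsE -sqrtr_sqr ler_wsqrtr// lerDr sqr_ge0. Qed.

Lemma cabs_le_ReIm z : cabs z <= `|complex.Re z| + `|complex.Im z|.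
Proof.
rewrite cabsE -[leRHS]ger0_norm ?addr_ge0// -sqrtr_sqr ler_wsqrtr//.
rewrite sqrrD !real_normK ?num_real// lerD2r lerDl.
by rewrite mulrn_wge0// mulr_ge0.
Qed.

Lemma cabs_sum (I : Type) (r : seq I) (P : pred I) (F : I -> R[i]) :
  cabs (\sum_(i <- r | P i) F i) <= \sum_(i <- r | P i) cabs (F i).
Proof.
elim/big_rec2: _ => [|i a b _ ab]; first by rewrite cabs0.
by apply: le_trans (cabs_triangle _ _) _; rewrite lerD2l.
Qed.

Lemma cabs_conj z : cabs z^* = cabs z.
Proof. by rewrite /cabs normcJ. Qed.

Lemma cReD z w : complex.Re (z + w) = complex.Re z + complex.Re w.
Proof. by case: z w => [a b] [c d]. Qed.
Lemma cImD z w : complex.Im (z + w) = complex.Im z + complex.Im w.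
Proof. by case: z w => [a b] [c d]. Qed.
Lemma cReN z : complex.Re (- z) = - complex.Re z.
Proof. by case: z. Qed.
Lemma cImN z : complex.Im (- z) = - complex.Im z.
Proof. by case: z. Qed.
Lemma cReM z w : complex.Re (z * w) =
  complex.Re z * complex.Re w - complex.Im z * complex.Im w.
Proof. by case: z w => [a b] [c d]. Qed.
Lemma cImM z w : complex.Im (z * w) =
  complex.Re z * complex.Im w + complex.Im z * complex.Re w.
Proof. by case: z w => [a b] [c d]. Qed.
Lemma cReB z w : complex.Re (z - w) = complex.Re z - complex.Re w.
Proof. by rewrite cReD cReN. Qed.
Lemma cImB z w : complex.Im (z - w) = complex.Im z - complex.Im w.
Proof. by rewrite cImD cImN. Qed.
Lemma cReZ x z : complex.Re (x%:C * z) = x * complex.Re z.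
Proof. by rewrite cReM /= mul0r subr0. Qed.
Lemma cImZ x z : complex.Im (x%:C * z) = x * complex.Im z.
Proof. by rewrite cImM /= mul0r addr0. Qed.
Lemma cReZr x z : complex.Re (z * x%:C) = complex.Re z * x.
Proof. by rewrite mulrC cReZ mulrC. Qed.
Lemma cImZr x z : complex.Im (z * x%:C) = complex.Im z * x.
Proof. by rewrite mulrC cImZ mulrC. Qed.
Lemma cRe_nat n : complex.Re (n%:R : R[i]) = n%:R.
Proof. by rewrite -(rmorph_nat (real_complex R)). Qed.
Lemma cIm_nat n : complex.Im (n%:R : R[i]) = 0.
Proof. by rewrite -(rmorph_nat (real_complex R)). Qed.
Lemma natC n : (n%:R : R)%:C = n%:R.
Proof. exact: rmorph_nat. Qed.

Lemma complex_ext z w :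
  complex.Re z = complex.Re w -> complex.Im z = complex.Im w -> z = w.
Proof. by case: z w => [a b] [c d] /= -> ->. Qed.

Lemma cexp_real x : cexp x%:C = (expR x)%:C.
Proof. by rewrite /cexp /= cos0 sin0 mulr1. Qed.

Lemma cexp0 : cexp (0 : R[i]) = 1.
Proof. by rewrite (cexp_real 0) expR0. Qed.

Lemma cabs_cexp z : cabs (cexp z) = expR (complex.Re z).
Proof.
rewrite /cexp cabsM cabs_real cabsE /= cos2Dsin2 sqrtr1 mulr1.
by rewrite ger0_norm// expR_ge0.
Qed.

Lemma cexp_neq0 z : cexp z != 0.
Proof. by rewrite -cabs_eq0 cabs_cexp gt_eqF// expR_gt0. Qed.

Lemma cexpN z : cexp (- z) = (cexp z)^-1.
Proof.
apply: (mulfI (cexp_neq0 z)); rewrite -cexpD subrr cexp0 divff//.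
exact: cexp_neq0.
Qed.

Lemma cexpMn z n : cexp (n%:R * z) = cexp z ^+ n.
Proof.
by elim: n => [|n IH]; rewrite ?mul0r ?cexp0// -natr1 mulrDl mul1r cexpD IH exprSr.
Qed.

Lemma cpowE x s : 0 < x -> cpow x s = cexp (s * (ln x)%:C).
Proof. by move=> x0; rewrite /cpow gt_eqF. Qed.

Lemma cpowD x s z : 0 < x -> cpow x (s + z) = cpow x s * cpow x z.
Proof. by move=> x0; rewrite !cpowE// mulrDl cexpD. Qed.

Lemma cpowN x s : 0 < x -> cpow x (- s) = (cpow x s)^-1.
Proof. by move=> x0; rewrite !cpowE// mulNr cexpN. Qed.

Lemma cpow_neq0 x s : 0 < x -> cpow x s != 0.
Proof. by move=> x0; rewrite cpowE// cexp_neq0. Qed.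

Lemma cpow0 x : 0 < x -> cpow x 0 = 1.
Proof. by move=> x0; rewrite cpowE// mul0r cexp0. Qed.

Lemma cpowM x y s : 0 < x -> 0 < y -> cpow (x * y) s = cpow x s * cpow y s.
Proof.
by move=> x0 y0; rewrite !cpowE ?mulr_gt0// lnM// rmorphD mulrDr cexpD.
Qed.

Lemma cpowV x s : 0 < x -> cpow x^-1 s = cpow x (- s).
Proof. by move=> x0; rewrite !cpowE ?invr_gt0// lnV// rmorphN mulrN mulNr. Qed.

Lemma cabs_cpow x s : 0 < x -> cabs (cpow x s) = x `^ complex.Re s.
Proof. by move=> x0; rewrite cpowE// cabs_cexp cReZr /powR gt_eqF. Qed.

Lemma cpowMn x n s : 0 < x -> cpow x (n%:R * s) = cpow x s ^+ n.
Proof. by move=> x0; rewrite !cpowE// -mulrA cexpMn. Qed.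

Lemma cpow_real x y : 0 < x -> cpow x y%:C = (x `^ y)%:C.
Proof. by move=> x0; rewrite cpowE// -rmorphM cexp_real /powR gt_eqF. Qed.

Lemma cpow1 x : 0 < x -> cpow x 1 = x%:C.
Proof. by move=> x0; rewrite (cpow_real 1)// powRr1// ltW. Qed.

Lemma cpow_nat x n : 0 < x -> cpow x n%:R = x%:C ^+ n.
Proof. by move=> x0; rewrite -(mulr1 n%:R) cpowMn// cpow1. Qed.

Lemma cpow_exp x n s : 0 < x -> cpow (x ^+ n) s = cpow x (n%:R * s).
Proof.
move=> x0; rewrite !cpowE ?exprn_gt0// lnXn//.
by rewrite -[ln x *+ n]mulr_natl rmorphM/= natC mulrA (mulrC s).
Qed.

Lemma cpow1s s : cpow 1 s = 1.
Proof. by rewrite cpowE// ln1 mulr0 cexp0. Qed.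

(** A positive element of [R[i]] is a positive real, so the epsilons of both notions of limit range
    over the same numbers. *)
Lemma ccvgP (T : Type) (F : set_system T) {FF : Filter F} (f : T -> R[i]) l :
  ((f x : R[i]^o) @[x --> F] --> (l : R[i]^o)) <->
  (cabs (f x - l) @[x --> F] --> (0 : R)).
Proof.
split.
  move=> /cvgrPdist_lt H; apply/cvgr0Pnorm_lt => e e0.
  have := H (e%:C); rewrite ltcR => /(_ e0).
  apply: filterS => x; rewrite distrC normcE ltcR => fx.
  by rewrite ger0_norm ?cabs_ge0.
move=> /cvgr0Pnorm_lt H; apply/cvgrPdist_lt => -[e e'].
rewrite ltcE /= => /andP[/eqP -> e0].
apply: filterS (H _ e0) => x; rewrite ger0_norm ?cabs_ge0// => fx.
by rewrite distrC normcE ltcR.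
Qed.

Lemma ccvg_ReIm (T : Type) (F : set_system T) {FF : Filter F} (f : T -> R[i]) l :
  ((f x : R[i]^o) @[x --> F] --> (l : R[i]^o)) <->
  (complex.Re (f x) @[x --> F] --> complex.Re l /\
   complex.Im (f x) @[x --> F] --> complex.Im l).
Proof.
rewrite ccvgP; split.
  move=> H; split; apply/cvgrPdist_lt => e e0;
    move/cvgr0Pnorm_lt : H => /(_ e e0); apply: filterS => x;
    rewrite ger0_norm ?cabs_ge0// => fx; rewrite distrC -?cReB -?cImB.
    exact: le_lt_trans (cabs_Re _) _.
  exact: le_lt_trans (cabs_Im _) _.
move=> [H1 H2].
have H : (`|complex.Re (f x) - complex.Re l| + `|complex.Im (f x) - complex.Im l|)
    @[x --> F] --> (0 : R).
  have H0 (g : T -> R) m : g x @[x --> F] --> m ->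
      `|g x - m| @[x --> F] --> (0 : R).
    move=> gm; rewrite -(normr0 R) -(subrr m).
    by apply: cvg_norm; apply: cvgB => //; exact: cvg_cst.
  by rewrite -(addr0 0); apply: cvgD; exact: H0.
apply: (squeeze_cvgr _ (cvg_cst 0) H); near=> x.
by rewrite cabs_ge0 -cReB -cImB cabs_le_ReIm.
Unshelve. all: by end_near. Qed.

Lemma ccvg_cabs (T : Type) (F : set_system T) {FF : Filter F} (f : T -> R[i]) l :
  ((f x : R[i]^o) @[x --> F] --> (l : R[i]^o)) -> cabs (f x) @[x --> F] --> cabs l.
Proof.
move=> /cvg_norm fl.
have /ccvg_ReIm[] : ((cabs (f x))%:C : R[i]^o) @[x --> F] --> ((cabs l)%:C : R[i]^o).
  by rewrite -normcE; apply: cvg_trans fl; apply: near_eq_cvg; apply: nearW => x;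
    rewrite /= normcE.
by [].
Qed.

Lemma climE (T : Type) (F : set_system T) {FF : ProperFilter F} (f : T -> R[i]) l :
  ((f x : R[i]^o) @[x --> F] --> (l : R[i]^o)) ->
  lim ((f x : R[i]^o) @[x --> F]) = l.
Proof. by move=> H; apply: (cvg_lim (@norm_hausdorff _ _)). Qed.

End Complex.

(** * Complex integrals and sums *)

Section ComplexMeasurable.
Context {d : measure_display} {T : measurableType d} {R : realType}.
Implicit Types (D : set T) (f g : T -> R[i]).

Definition cmeas D f : Prop :=
  measurable_fun D (fun x => complex.Re (f x)) /\
  measurable_fun D (fun x => complex.Im (f x)).

Lemma cmeasM D f g : cmeas D f -> cmeas D g -> cmeas D (fun x => f x * g x).
Proof.
move=> [f1 f2] [g1 g2]; split.
  by under eq_fun do rewrite cReM; apply: measurable_funB; exact: measurable_funM.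
by under eq_fun do rewrite cImM; apply: measurable_funD; exact: measurable_funM.
Qed.

Lemma cmeas_cst D c : cmeas D (fun=> c).
Proof. by split; exact: measurable_cst. Qed.

Lemma cmeas_real D (f : T -> R) : measurable_fun D f -> cmeas D (fun x => (f x)%:C).
Proof. by move=> mf; split => //=; exact: measurable_cst. Qed.

Lemma cmeasX D f n : cmeas D f -> cmeas D (fun x => f x ^+ n).
Proof.
move=> mf; elim: n => [|n IH]; first exact: cmeas_cst.
by under eq_fun do rewrite exprS; exact: cmeasM.
Qed.

Lemma cmeas_cabs D f : cmeas D f -> measurable_fun D (fun x => cabs (f x)).
Proof.
move=> [f1 f2]; under eq_fun do rewrite cabsE.
apply: measurableT_comp; first exact: (continuous_measurable_fun (@sqrt_continuous R)).
by apply: measurable_funD; exact: measurable_funX.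
Qed.

End ComplexMeasurable.

Section ComplexIntegral.
Context {d : measure_display} {T : measurableType d} {R : realType}.
Context {mu : {measure set T -> \bar R}} {D : set T} (mD : measurable D).
Implicit Types (f g : T -> R[i]) (h : T -> R) (c : R[i]).

Lemma cintegrable_cmeas f : cintegrable mu D f -> cmeas D f.
Proof.
by move=> [/integrableP[f1 _] /integrableP[f2 _]]; split; exact/measurable_EFinP.
Qed.

Lemma integrable_le h h' : measurable_fun D h -> mu.-integrable D (EFin \o h') ->
  (forall x, D x -> `|h x| <= h' x) -> mu.-integrable D (EFin \o h).
Proof.
move=> mh ih' hh; apply: (le_integrable mD _ _ ih').
  exact/measurable_EFinP.
move=> x Dx /=; rewrite lee_fin (le_trans (hh x Dx))//.
by rewrite ler_norm.
Qed.

Lemma cintegrable_le f h : cmeas D f -> mu.-integrable D (EFin \o h) ->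
  (forall x, D x -> cabs (f x) <= h x) -> cintegrable mu D f.
Proof.
move=> [f1 f2] ih fh; split; apply: (integrable_le _ ih) => // x Dx.
  exact: le_trans (cabs_Re _) (fh x Dx).
exact: le_trans (cabs_Im _) (fh x Dx).
Qed.

Lemma eq_cintegrable f g : {in D, f =1 g} -> cintegrable mu D f -> cintegrable mu D g.
Proof.
by move=> fg [f1 f2]; split; [apply: eq_integrable f1|apply: eq_integrable f2] => //;
  move=> x xD; rewrite fg.
Qed.

Lemma cintegrable_cabs f : cintegrable mu D f ->
  mu.-integrable D (EFin \o (fun x => cabs (f x))).
Proof.
move=> cf; have [m1 m2] := cintegrable_cmeas cf; case: cf => f1 f2.
have := integrableD mD (integrable_norm f1) (integrable_norm f2).
move=> /integrable_le; apply.
  exact: cmeas_cabs.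
by move=> x Dx; rewrite ger0_norm ?cabs_ge0// cabs_le_ReIm.
Qed.

Lemma eq_cint f g : {in D, f =1 g} -> cintegral mu D f = cintegral mu D g.
Proof.
by move=> fg; rewrite /cintegral; congr (_ +i* _); apply: eq_Rintegral => x xD;
  rewrite fg.
Qed.

Lemma cintegrableD f g : cintegrable mu D f -> cintegrable mu D g ->
  cintegrable mu D (fun x => f x + g x).
Proof.
move=> [f1 f2] [g1 g2]; split.
  by apply: eq_integrable (integrableD mD f1 g1) => // x _; rewrite /= cReD EFinD.
by apply: eq_integrable (integrableD mD f2 g2) => // x _; rewrite /= cImD EFinD.
Qed.

Lemma cintegrable0 : cintegrable mu D (fun=> 0 : R[i]).
Proof. by split; exact: integrable0. Qed.

Lemma cintegrableZ c f : cintegrable mu D f -> cintegrable mu D (fun x => c * f x).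
Proof.
move=> cf; have cf' := cintegrable_cabs cf.
apply: (cintegrable_le _ (integrableZl mD (cabs c) cf')).
  by apply: cmeasM; [exact: cmeas_cst|exact: cintegrable_cmeas].
by move=> x _; rewrite cabsM.
Qed.

Lemma cintegrableN f : cintegrable mu D f -> cintegrable mu D (fun x => - f x).
Proof.
move=> /(cintegrableZ (-1)); apply: eq_cintegrable => x _.
by rewrite mulN1r.
Qed.

Lemma cintD f g : cintegrable mu D f -> cintegrable mu D g ->
  cintegral mu D (fun x => f x + g x) = cintegral mu D f + cintegral mu D g.
Proof.
move=> [f1 f2] [g1 g2]; rewrite /cintegral.
rewrite [RHS]/GRing.add /=; congr (_ +i* _).
  by under eq_Rintegral do rewrite cReD; rewrite RintegralD.
by under eq_Rintegral do rewrite cImD; rewrite RintegralD.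
Qed.

Lemma cintZ c f : cintegrable mu D f ->
  cintegral mu D (fun x => c * f x) = c * cintegral mu D f.
Proof.
case: c => a b [f1 f2]; rewrite /cintegral.
have ZR k (h : T -> R) : mu.-integrable D (EFin \o h) ->
    mu.-integrable D (EFin \o (fun x => k * h x)).
  by move=> ih; apply: eq_integrable (integrableZl mD k ih).
apply: complex_ext => /=.
  under eq_Rintegral do rewrite cReM.
  by rewrite RintegralB ?RintegralZl//=; exact: ZR.
under eq_Rintegral do rewrite cImM.
by rewrite RintegralD ?RintegralZl//=; exact: ZR.
Qed.

Lemma cintN f : cintegrable mu D f ->
  cintegral mu D (fun x => - f x) = - cintegral mu D f.
Proof.
move=> cf; rewrite -mulN1r -cintZ//.
by apply: eq_cint => x _; rewrite mulN1r.
Qed.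

Lemma cintB f g : cintegrable mu D f -> cintegrable mu D g ->
  cintegral mu D (fun x => f x - g x) = cintegral mu D f - cintegral mu D g.
Proof. by move=> cf cg; rewrite cintD ?cintN//; exact: cintegrableN. Qed.

Lemma cint_sum (I : Type) (s : seq I) (F : I -> T -> R[i]) :
  (forall i, cintegrable mu D (F i)) ->
  cintegrable mu D (fun x => \sum_(i <- s) F i x) /\
  cintegral mu D (fun x => \sum_(i <- s) F i x) = \sum_(i <- s) cintegral mu D (F i).
Proof.
move=> cF; elim: s => [|i s [IH1 IH2]].
  have E : {in D, (fun=> 0 : R[i]) =1 (fun x => \sum_(i <- [::]) F i x)}.
    by move=> x _; rewrite big_nil.
  split; first by apply: eq_cintegrable E _; exact: cintegrable0.
  rewrite -(eq_cint E) big_nil.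
  transitivity (0 * cintegral mu D (fun=> 0 : R[i])); last by rewrite mul0r.
  rewrite -cintZ; last exact: cintegrable0.
  by apply: eq_cint => x _; rewrite mul0r.
have E : {in D, (fun x => F i x + \sum_(j <- s) F j x) =1
                (fun x => \sum_(j <- i :: s) F j x)}.
  by move=> x _; rewrite big_cons.
split; first by apply: eq_cintegrable E _; exact: cintegrableD.
by rewrite -(eq_cint E) big_cons cintD// IH2.
Qed.

Lemma cint_real h : mu.-integrable D (EFin \o h) ->
  cintegral mu D (fun x => (h x)%:C) = (\int[mu]_(x in D) h x)%:C.
Proof.
move=> ih; rewrite /cintegral /=; congr (_ +i* _).
by rewrite /Rintegral integral0.
Qed.

(* The constant 2 avoids having to rotate the value of the integral. *)
Lemma cabs_cint_le f h : cintegrable mu D f -> mu.-integrable D (EFin \o h) ->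
  (forall x, D x -> cabs (f x) <= h x) ->
  cabs (cintegral mu D f) <= 2 * \int[mu]_(x in D) h x.
Proof.
move=> [f1 f2] ih fh; apply: le_trans (cabs_le_ReIm _) _.
rewrite mulr_natl mulr2n; apply: lerD => /=.
  apply: le_trans (le_normr_Rintegral mD f1) _.
  apply: le_Rintegral => //; first exact: (integrable_norm f1).
  by move=> x Dx; exact: le_trans (cabs_Re _) (fh x Dx).
apply: le_trans (le_normr_Rintegral mD f2) _.
apply: le_Rintegral => //; first exact: (integrable_norm f2).
by move=> x Dx; exact: le_trans (cabs_Im _) (fh x Dx).
Qed.

Lemma Rint_dominated (f_ : nat -> T -> R) (f h : T -> R) :
  (forall n, measurable_fun D (f_ n)) -> measurable_fun D f ->
  (forall x, D x -> f_ n x @[n --> \oo] --> f x) ->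
  mu.-integrable D (EFin \o h) ->
  (forall n x, D x -> `|f_ n x| <= h x) ->
  \int[mu]_(x in D) f_ n x @[n --> \oo] --> \int[mu]_(x in D) f x.
Proof.
move=> mf_ mf f_f ih fh.
have [] := @dominated_convergence _ _ _ mu D mD
  (fun n => EFin \o f_ n) (EFin \o f) (EFin \o h) _ _ _ ih _.
- by move=> n; exact/measurable_EFinP.
- exact/measurable_EFinP.
- by apply: aeW => x Dx; apply: cvg_EFin; [exact: nearW|exact: f_f].
- by apply: aeW => x n Dx; rewrite /= lee_fin fh.
move=> if_ _ H.
have Ifin : (\int[mu]_(x in D) (EFin \o f) x)%E \is a fin_num.
  exact: integrable_fin_num.
apply: fine_cvg; rewrite fineK//.
Qed.

Lemma cint_dominated (f_ : nat -> T -> R[i]) f h :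
  (forall n, cmeas D (f_ n)) -> cmeas D f ->
  (forall x, D x -> (f_ n x : R[i]^o) @[n --> \oo] --> (f x : R[i]^o)) ->
  mu.-integrable D (EFin \o h) ->
  (forall n x, D x -> cabs (f_ n x) <= h x) ->
  (cintegral mu D (f_ n) : R[i]^o) @[n --> \oo] --> (cintegral mu D f : R[i]^o).
Proof.
move=> mf_ [mf mf'] f_f ih fh; apply/ccvg_ReIm; split => /=.
  apply: (Rint_dominated _ mf _ ih) => [n|x Dx|n x Dx].
  - by case: (mf_ n).
  - by have /ccvg_ReIm[] := f_f x Dx.
  - exact: le_trans (cabs_Re _) (fh n x Dx).
apply: (Rint_dominated _ mf' _ ih) => [n|x Dx|n x Dx].
- by case: (mf_ n).
- by have /ccvg_ReIm[] := f_f x Dx.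
- exact: le_trans (cabs_Im _) (fh n x Dx).
Qed.

End ComplexIntegral.

(** * Absolutely convergent sums as integrals for the counting measure *)

Section Sums.
Context {R : realType}.
Implicit Types (f g : nat -> R[i]) (a b : nat -> R).

(** A limit of partial sums of the same shape as [besselJstar], so that the Bessel series is a
    [csum] by conversion. *)
Definition csum f : R[i] := limn (series (f : nat -> R[i]^o)).

Definition abssum f : Prop := cvgn (series (fun n => cabs (f n))).

Lemma abssum_le f a : (forall n, cabs (f n) <= a n) -> cvgn (series a) -> abssum f.
Proof.
move=> fa; apply: series_le_cvg => // n; first exact: cabs_ge0.
exact: le_trans (cabs_ge0 _) (fa n).
Qed.

Lemma summable_counting a : cvgn (series (fun n => `|a n|)) ->
  summable [set: nat] (EFin \o a).
Proof.
move=> ca; rewrite /summable -nneseries_esumT//.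
rewrite (_ : limn _ = limn (EFin \o series (fun n => `|a n|))); last first.
  by congr (limn _); apply/funext => n /=; rewrite /series /= -sumEFin.
by rewrite EFin_lim// ltry.
Qed.

Lemma integrable_counting a : cvgn (series (fun n => `|a n|)) ->
  (@counting nat R).-integrable setT (EFin \o a).
Proof.
move=> ca; apply/integrableP; split => //.
rewrite integral_count.
  have := summable_counting ca; rewrite /summable -nneseries_esumT//.
have := @summable_counting (fun n => `|a n|).
have -> : (fun n => `| `|a n| |) = (fun n => `|a n|).
  by apply/funext => n; rewrite normr_id.
exact.
Qed.

Lemma Rint_counting a : cvgn (series (fun n => `|a n|)) ->
  series a @ \oo --> \int[@counting nat R]_n a n.
Proof.
move=> ca; have cva : cvgn (series a) by exact: normed_cvg.
rewrite /Rintegral integral_count; last exact: summable_counting.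
rewrite (_ : limn _ = limn (EFin \o series a)); last first.
  by congr (limn _); apply/funext => n /=; rewrite /series /= -sumEFin.
by rewrite EFin_lim.
Qed.

Lemma Re_sum (I : Type) (s : seq I) (P : pred I) (F : I -> R[i]) :
  complex.Re (\sum_(i <- s | P i) F i) = \sum_(i <- s | P i) complex.Re (F i).
Proof. exact: (big_morph _ cReD). Qed.

Lemma Im_sum (I : Type) (s : seq I) (P : pred I) (F : I -> R[i]) :
  complex.Im (\sum_(i <- s | P i) F i) = \sum_(i <- s | P i) complex.Im (F i).
Proof. exact: (big_morph _ cImD). Qed.

Lemma abssum_ReIm f : abssum f -> cvgn (series (fun n => `|complex.Re (f n)|)) /\
  cvgn (series (fun n => `|complex.Im (f n)|)).
Proof.
move=> sf; split; apply: series_le_cvg sf => n //; do ?exact: cabs_ge0.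
  exact: cabs_Re.
exact: cabs_Im.
Qed.

Lemma cintegrable_counting f : abssum f -> cintegrable (@counting nat R) setT f.
Proof. by move=> /abssum_ReIm[f1 f2]; split; exact: integrable_counting. Qed.

Lemma cvg_cint_counting f : abssum f ->
  series (f : nat -> R[i]^o) @ \oo --> (cintegral (@counting nat R) setT f : R[i]^o).
Proof.
move=> /abssum_ReIm[f1 f2]; apply/ccvg_ReIm; split => /=.
  under eq_fun do rewrite /series /= Re_sum.
  exact: Rint_counting.
under eq_fun do rewrite /series /= Im_sum.
exact: Rint_counting.
Qed.

(** Once a sum is an integral for the counting measure, linearity, interchange of sums, termwise
    integration and termwise differentiation are inherited from integrals. *)
Lemma csumE f : abssum f -> csum f = cintegral (@counting nat R) setT f.
Proof. by move=> sf; apply: climE; exact: cvg_cint_counting. Qed.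

Lemma cvg_csum f : abssum f -> series (f : nat -> R[i]^o) @ \oo --> (csum f : R[i]^o).
Proof. by move=> sf; rewrite csumE//; exact: cvg_cint_counting. Qed.

Lemma eq_csum f g : f =1 g -> csum f = csum g.
Proof. by move=> /funext ->. Qed.

Lemma eq_abssum f g : f =1 g -> abssum f -> abssum g.
Proof. by move=> /funext ->. Qed.

Lemma abssumZ c f : abssum f -> abssum (fun n => c * f n).
Proof.
move=> sf; rewrite /abssum.
under [X in series X]eq_fun do rewrite cabsM.
exact: is_cvg_seriesZ.
Qed.

Lemma abssumD f g : abssum f -> abssum g -> abssum (fun n => f n + g n).
Proof.
move=> sf sg; apply: (@abssum_le _ (fun n => cabs (f n) + cabs (g n))).
  by move=> n; exact: cabs_triangle.
exact: (is_cvg_seriesD sf sg).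
Qed.

Lemma csumZ c f : abssum f -> csum (fun n => c * f n) = c * csum f.
Proof.
move=> sf; rewrite !csumE//; last exact: abssumZ.
by rewrite cintZ//; exact: cintegrable_counting.
Qed.

Lemma csumD f g : abssum f -> abssum g ->
  csum (fun n => f n + g n) = csum f + csum g.
Proof.
move=> sf sg; rewrite !csumE//; last exact: abssumD.
by rewrite cintD//; exact: cintegrable_counting.
Qed.

Lemma cabs_csum f a : (forall n, cabs (f n) <= a n) -> cvgn (series a) ->
  cabs (csum f) <= limn (series a).
Proof.
move=> fa ca; have sf := abssum_le fa ca.
have H : (cabs (series (f : nat -> R[i]^o) n)) @[n --> \oo] --> cabs (csum f).
  by apply: ccvg_cabs; exact: cvg_csum.
apply: (ler_cvg_to H ca); apply: nearW => n.
apply: le_trans (cabs_sum _ _ _) _.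
by apply: ler_sum => i _; exact: fa.
Qed.

Lemma csum_recl f : abssum f -> csum f = f 0 + csum (fun n => f n.+1).
Proof.
move=> sf; apply: climE; have sf' : abssum (fun n => f n.+1).
  apply/cvg_ex; exists (limn (series (fun n => cabs (f n))) - cabs (f 0)).
  rewrite (_ : series _ = fun n => series (fun n => cabs (f n)) n.+1 - cabs (f 0)).
    by apply: cvgB; [rewrite cvg_shiftS|exact: cvg_cst].
  by apply/funext => n; rewrite /series /= big_nat_recl//= addrC addKr.
rewrite -(cvg_shiftS (series (f : nat -> R[i]^o))).
have -> : (fun n => series (f : nat -> R[i]^o) n.+1) =
    (fun n => f 0 + series ((fun n => f n.+1) : nat -> R[i]^o) n).
  by apply/funext => n; rewrite /series /= big_nat_recl.
by apply: cvgD; [exact: cvg_cst|exact: cvg_csum].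
Qed.

End Sums.

(** * Fubini's theorem under a bound that is a product *)

Section Fubini.
Context {d1 d2 : measure_display} {T1 : measurableType d1} {T2 : measurableType d2}.
Context {R : realType}.

Section FubiniT.
Context {m1 : {sigma_finite_measure set T1 -> \bar R}}.
Context {m2 : {sigma_finite_measure set T2 -> \bar R}}.
Context {f : T1 * T2 -> R} {g1 : T1 -> R} {g2 : T2 -> R}.
Hypothesis mf : measurable_fun setT f.
Hypothesis ig1 : m1.-integrable setT (EFin \o g1).
Hypothesis ig2 : m2.-integrable setT (EFin \o g2).
Hypothesis fg : forall x y, `|f (x, y)| <= g1 x * g2 y.

Let isec2 x : m2.-integrable setT (EFin \o (fun y => f (x, y))).
Proof.
have := integrableZl measurableT (g1 x) ig2.
move=> /(@integrable_le _ _ _ m2 setT measurableT (fun y => f (x, y))); apply => //.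
exact: (measurableT_comp mf (pair1_measurable x)).
Qed.

Let isec1 y : m1.-integrable setT (EFin \o (fun x => f (x, y))).
Proof.
have := integrableZl measurableT (g2 y) ig1.
move=> /(@integrable_le _ _ _ m1 setT measurableT (fun x => f (x, y))); apply.
  exact: (measurableT_comp mf (pair2_measurable y)).
by move=> x _; rewrite mulrC.
Qed.

Let iprod : (m1 \x m2)%E.-integrable setT (EFin \o f).
Proof.
apply/integrable12ltyP; first exact/measurable_EFinP.
have ig1' := integrable_norm ig1; have ig2' := integrable_norm ig2.
pose C := fine (\int[m2]_y (`|g2 y|)%:E)%E.
have CE : (\int[m2]_y (`|g2 y|)%:E)%E = C%:E.
  by rewrite fineK//; exact: integrable_fin_num.
have mabs : measurable_fun setT (fun z => `|(f z)%:E|%E).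
  by apply: measurableT_comp => //; exact/measurable_EFinP.
apply: (@le_lt_trans _ _ (\int[m1]_x (C%:E * (`|g1 x|)%:E))%E); last first.
  have := integrable_fin_num measurableT (integrableZl measurableT C ig1').
  by rewrite ge0_fin_numE//; apply: integral_ge0 => x _;
    rewrite /= mule_ge0// lee_fin fine_ge0// integral_ge0// => y _; rewrite lee_fin.
apply: ge0_le_integral => //.
- by move=> x _; exact: integral_ge0.
- exact: (measurable_fun_fubini_tonelli_F (fun z => `|(f z)%:E|%E)).
- by apply: (measurable_int m1); exact: integrableZl.
move=> x _; rewrite -CE muleC -ge0_integralZl//; last first.
- by apply: (measurable_int m2).
apply: ge0_le_integral => //.
- by apply: measurableT_comp => //; apply: (measurable_int m2); exact: isec2.
- by apply: (measurable_int m2); exact: integrableZl.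
move=> y _; rewrite -EFinM lee_fin -normrM.
by apply: le_trans (fg x y) _; exact: ler_norm.
Qed.

(** The bound by a product makes every section integrable, not merely almost every one, so the inner
    extended-real integrals are finite throughout and can be replaced by real ones. *)
Lemma rfubiniT :
  m1.-integrable setT (EFin \o (fun x => \int[m2]_y f (x, y))) /\
  \int[m1]_x \int[m2]_y f (x, y) = \int[m2]_y \int[m1]_x f (x, y).
Proof.
have E2 x : (\int[m2]_y (f (x, y))%:E)%E = (\int[m2]_y f (x, y))%:E.
  by rewrite fineK//; exact: integrable_fin_num (isec2 x).
have E1 y : (\int[m1]_x (f (x, y))%:E)%E = (\int[m1]_x f (x, y))%:E.
  by rewrite fineK//; exact: integrable_fin_num (isec1 y).
split.
  have := integrable_fubini_F iprod; apply: eq_integrable => // x _.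
  by rewrite /fubini_F /= E2.
rewrite /Rintegral; congr fine.
transitivity (\int[m1]_x \int[m2]_y (EFin \o f) (x, y))%E.
  by apply: eq_integral => x _; rewrite /= E2.
rewrite (Fubini iprod).
by apply: eq_integral => y _; rewrite /= E1.
Qed.

End FubiniT.
End Fubini.

Section FubiniDomain.
Context {d1 d2 : measure_display} {T1 : measurableType d1} {T2 : measurableType d2}.
Context {R : realType}.
Context {m1 : {sigma_finite_measure set T1 -> \bar R}}.
Context {m2 : {sigma_finite_measure set T2 -> \bar R}}.
Context {D1 : set T1} {D2 : set T2} (mD1 : measurable D1) (mD2 : measurable D2).
Context {g1 : T1 -> R} {g2 : T2 -> R}.
Hypothesis ig1 : m1.-integrable D1 (EFin \o g1).
Hypothesis ig2 : m2.-integrable D2 (EFin \o g2).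

Lemma rfubini (f : T1 -> T2 -> R) :
  measurable_fun (D1 `*` D2) (fun z => f z.1 z.2) ->
  (forall x y, D1 x -> D2 y -> `|f x y| <= g1 x * g2 y) ->
  [/\ m1.-integrable D1 (EFin \o (fun x => \int[m2]_(y in D2) f x y)),
      m2.-integrable D2 (EFin \o (fun y => \int[m1]_(x in D1) f x y)) &
      \int[m1]_(x in D1) \int[m2]_(y in D2) f x y =
      \int[m2]_(y in D2) \int[m1]_(x in D1) f x y].
Proof.
(* Extension by zero off the rectangle. The product bound survives because [g1] and [g2] are
   extended by zero as well. *)
move=> mf fg; pose h z := ((fun z => f z.1 z.2) \_ (D1 `*` D2)) z.
have mh : measurable_fun setT h.
  by apply/(measurable_restrictT _ (measurableX mD1 mD2)).
have ih1 : m1.-integrable setT (EFin \o (g1 \_ D1)).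
  by rewrite -restrict_EFin; apply/(integrable_mkcond _ mD1).
have ih2 : m2.-integrable setT (EFin \o (g2 \_ D2)).
  by rewrite -restrict_EFin; apply/(integrable_mkcond _ mD2).
have hE x y : h (x, y) = if (x \in D1) && (y \in D2) then f x y else 0.
  rewrite /h patchE; case: ifPn => /= [|H].
    by rewrite inE => -[/= /mem_set -> /mem_set ->].
  case: ifPn => // /andP[/set_mem x1 /set_mem y2].
  by move: H; rewrite notin_setE; case.
have bh x y : `|h (x, y)| <= (g1 \_ D1) x * (g2 \_ D2) y.
  rewrite hE !patchE; case: ifPn => [/andP[x1 y2]|].
    by rewrite x1 y2; apply: fg; exact/set_mem.
  by case: ifPn => _; case: ifPn => _ //=; rewrite normr0 ?mul0r ?mulr0.
have h2 x : \int[m2]_y h (x, y) = ((fun x => \int[m2]_(y in D2) f x y) \_ D1) x.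
  rewrite patchE; case: ifPn => xD.
    rewrite [RHS]Rintegral_mkcond; apply: eq_Rintegral => y _.
    by rewrite hE xD patchE.
  rewrite /Rintegral (eq_integral (fun=> 0%E)) ?integral0// => y _.
  by rewrite hE (negbTE xD).
have h1 y : \int[m1]_x h (x, y) = ((fun y => \int[m1]_(x in D1) f x y) \_ D2) y.
  rewrite patchE; case: ifPn => yD.
    rewrite [RHS]Rintegral_mkcond; apply: eq_Rintegral => x _.
    by rewrite hE yD andbT patchE.
  rewrite /Rintegral (eq_integral (fun=> 0%E)) ?integral0// => x _.
  by rewrite hE (negbTE yD) andbF.
have [i1 E] := rfubiniT mh ih1 ih2 bh.
have [i2 _] := rfubiniT (f := h \o (fun z => (z.2, z.1))) (measurableT_comp mh (measurable_fun_pair measurable_snd measurable_fst))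
  ih2 ih1 (fun y x => eq_ind _ (fun t => `|h (x, y)| <= t) (bh x y) _ (mulrC _ _)).
split.
- apply/(integrable_mkcond _ mD1); rewrite restrict_EFin.
  by apply: eq_integrable i1 => // x _; rewrite /= h2.
- apply/(integrable_mkcond _ mD2); rewrite restrict_EFin.
  by apply: eq_integrable i2 => // x _; rewrite /= h1.
rewrite [LHS]Rintegral_mkcond [RHS]Rintegral_mkcond.
transitivity (\int[m1]_x \int[m2]_y h (x, y)).
  by apply: eq_Rintegral => x _; rewrite h2.
by rewrite E; apply: eq_Rintegral => y _; rewrite h1.
Qed.

Lemma cfubini (f : T1 -> T2 -> R[i]) :
  cmeas (D1 `*` D2) (fun z => f z.1 z.2) ->
  (forall x y, D1 x -> D2 y -> cabs (f x y) <= g1 x * g2 y) ->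
  [/\ cintegrable m1 D1 (fun x => cintegral m2 D2 (f x)),
      cintegrable m2 D2 (fun y => cintegral m1 D1 (fun x => f x y)) &
      cintegral m1 D1 (fun x => cintegral m2 D2 (f x)) =
      cintegral m2 D2 (fun y => cintegral m1 D1 (fun x => f x y))].
Proof.
move=> [mf1 mf2] fg.
have [|i1 j1 e1] := @rfubini (fun x y => complex.Re (f x y)) mf1.
  by move=> x y x1 y1; exact: le_trans (cabs_Re _) (fg x y x1 y1).
have [|i2 j2 e2] := @rfubini (fun x y => complex.Im (f x y)) mf2.
  by move=> x y x1 y1; exact: le_trans (cabs_Im _) (fg x y x1 y1).
by split=> //; rewrite /cintegral /= e1 e2.
Qed.

End FubiniDomain.

(** Fubini's theorem asks for sigma-finite measures and is used below with a sum as one of the two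
    integrals. *)
HB.instance Definition _ (R : realType) :=
  @Measure_isSigmaFinite.Build _ _ _ (@counting nat R) (sigma_finite_counting R).

Section CountingProduct.
Context {d : measure_display} {T : measurableType d} {R : realType}.

Lemma measurable_fun_nat_prod (f : nat -> T -> R) (D : set T) : measurable D ->
  (forall n, measurable_fun D (f n)) ->
  measurable_fun ([set: nat] `*` D) (fun z => f z.1 z.2).
Proof.
move=> mD mf _ Y mY.
rewrite (_ : _ `&` _ = \bigcup_n ([set n] `*` (D `&` f n @^-1` Y))).
  by apply: bigcupT_measurable => n; apply: measurableX => //; exact: mf.
apply/seteqP; split => [[n x] [[_ /= Dx] Yx]|[n x] [k _ [/= -> [Dx Yx]]]] //.
by exists n.
Qed.

Lemma cmeas_nat_prod (f : nat -> T -> R[i]) (D : set T) : measurable D ->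
  (forall n, cmeas D (f n)) -> cmeas ([set: nat] `*` D) (fun z => f z.1 z.2).
Proof.
move=> mD mf; split.
  by apply: (@measurable_fun_nat_prod (fun n x => complex.Re (f n x))) => // n;
    case: (mf n).
by apply: (@measurable_fun_nat_prod (fun n x => complex.Im (f n x))) => // n;
  case: (mf n).
Qed.

Context {mu : {sigma_finite_measure set T -> \bar R}} {D : set T} (mD : measurable D).

(* Termwise integration, as Fubini's theorem for the counting measure. *)
Lemma cint_csum (f : nat -> T -> R[i]) (a : nat -> R) (g : T -> R) :
  (forall n, cmeas D (f n)) ->
  (forall n, 0 <= a n) -> cvgn (series a) ->
  (forall x, D x -> 0 <= g x) -> mu.-integrable D (EFin \o g) ->
  (forall n x, D x -> cabs (f n x) <= a n * g x) ->
  [/\ abssum (fun n => cintegral mu D (f n)),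
      cintegrable mu D (fun x => csum (f^~ x)) &
      cintegral mu D (fun x => csum (f^~ x)) = csum (fun n => cintegral mu D (f n))].
Proof.
move=> mf a0 ca g0 ig fag.
have iga c : mu.-integrable D (EFin \o (fun x => c * g x)).
  by apply: eq_integrable (integrableZl mD c ig).
have s1 : abssum (fun n => cintegral mu D (f n)).
  have cI n : cintegrable mu D (f n).
    by apply: (cintegrable_le mD (mf n) (iga (a n))) => x Dx; exact: fag.
  apply: (@abssum_le _ _ (fun n => (2 * \int[mu]_(x in D) g x) * a n)).
    move=> n; rewrite -mulrA (mulrC _ (a n)) -RintegralZl//.
    by apply: cabs_cint_le => // x Dx; exact: fag.
  exact: is_cvg_seriesZ.
have ia : (@counting nat R).-integrable setT (EFin \o a).
  apply: integrable_counting; rewrite (_ : (fun n => _) = a)//.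
  by apply/funext => n; rewrite ger0_norm.
pose cm : {sigma_finite_measure set nat -> \bar R} := @counting nat R.
have [|_ ci E] := @cfubini _ _ _ _ R cm mu _ _ measurableT mD a g ia ig f (cmeas_nat_prod mD mf).
  by move=> n x _ Dx; exact: fag.
have sx x : D x -> abssum (f^~ x).
  move=> Dx; apply: (@abssum_le _ _ (fun n => g x * a n)).
    by move=> n; rewrite mulrC; exact: fag.
  exact: is_cvg_seriesZ.
split => //.
  apply: (eq_cintegrable mD _ ci) => x /set_mem Dx /=.
  by rewrite csumE//; exact: sx.
rewrite csumE// E; apply: eq_cint => x /set_mem Dx.
by rewrite csumE//; exact: sx.
Qed.

End CountingProduct.

(** * Calculus on the half line *)

Section HalfLine.
Context {R : realType}.
Notation mu := (@lebesgue_measure R).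
Notation D := (`]0%R, +oo[%classic : set R).
Implicit Types (f F : R -> R) (x y a b : R).

Lemma half_lineP x : D x <-> 0 < x.
Proof. by rewrite /= in_itv /= andbT. Qed.

Lemma half_line_measurable : measurable (D : set (measurableTypeR R)).
Proof. exact: measurable_itv. Qed.

Lemma measurable_half_line f : (forall x, 0 < x -> {for x, continuous f}) ->
  measurable_fun D f.
Proof.
move=> cf; apply: open_continuous_measurable_fun; first exact: interval_open.
by move=> x /set_mem /half_lineP; exact: cf.
Qed.

Lemma sub_half_line a b : 0 < a -> `[a, b] `<=` D.
Proof.
move=> a0 x /=; rewrite in_itv /= => /andP[ax _]; apply/half_lineP.
exact: lt_le_trans ax.
Qed.

(** A compact exhaustion of the half line: on its members the fundamental theorem and substitution
    apply, and the half line is reached in the limit. *)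
Definition exh (n : nat) : set R := `[n.+1%:R^-1, n.+1%:R].

Lemma exh_sub n : exh n `<=` D.
Proof. by apply: sub_half_line; rewrite invr_gt0. Qed.

Lemma bigcup_exh : \bigcup_n exh n = D.
Proof.
apply/seteqP; split => [x [n _ /exh_sub]//|x /half_lineP x0].
have [n nx] : exists n, x + x^-1 <= n.+1%:R.
  exists (Num.bound (x + x^-1)); rewrite ltW//.
  apply: (lt_trans (archi_boundP _)); last by rewrite ltr_nat.
  by rewrite addr_ge0// ?invr_ge0 ltW.
have xV0 : 0 < x^-1 by rewrite invr_gt0.
exists n => //; rewrite /exh /= in_itv /=; apply/andP; split.
  rewrite invf_ple ?posrE//; apply: le_trans nx.
  by rewrite lerDr ltW.
by apply: le_trans nx; rewrite lerDl ltW.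
Qed.

Lemma exh_homo : {homo exh : n m / (n <= m)%N >-> (n <= m)%O}.
Proof.
move=> n m nm; apply/subsetPset => x; rewrite /exh /= !in_itv /= => /andP[h1 h2].
apply/andP; split; last by apply: le_trans h2 _; rewrite ler_nat.
by apply: le_trans h1; rewrite lef_pV2 ?posrE// ler_nat.
Qed.

Lemma integrable_exhaust f (M : R) : measurable_fun D f ->
  (forall x, 0 < x -> 0 <= f x) ->
  (forall n, (\int[mu]_(x in exh n) (f x)%:E <= M%:E)%E) ->
  mu.-integrable D (EFin \o f).
Proof.
move=> mf f0 fM; apply/integrableP; split; first exact/measurable_EFinP.
have H : (\int[mu]_(x in exh i) (f x)%:E)%E @[i --> \oo] -->
    (\int[mu]_(x in \bigcup_i exh i) (f x)%:E)%E.
  apply: ge0_nondecreasing_set_cvg_integral.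
  - exact: exh_homo.
  - by move=> n; exact: measurable_itv.
  - move=> n; apply/measurable_EFinP; apply: measurable_funS mf => //.
    exact: exh_sub.
  - by move=> n x /exh_sub /half_lineP x0; rewrite lee_fin f0.
apply: (@le_lt_trans _ _ M%:E); last by rewrite ltry.
have -> : (\int[mu]_(x in D) `|(EFin \o f) x| = \int[mu]_(x in D) (f x)%:E)%E.
  by apply: eq_integral => x /set_mem /half_lineP x0; rewrite /= ger0_norm// f0.
rewrite -bigcup_exh -(cvg_lim _ H)//; apply: lime_le.
  by apply/cvg_ex; eexists; exact: H.
by apply: nearW => n; exact: fM.
Qed.

Lemma Rint_exhaust f (a b : nat -> R) : (forall n, 0 < a n) ->
  a @ \oo --> 0 -> b @ \oo --> +oo -> mu.-integrable D (EFin \o f) ->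
  \int[mu]_(x in `[a n, b n]) f x @[n --> \oo] --> \int[mu]_(x in D) f x.
Proof.
move=> a0 a_0 b_oo fi.
have mf : measurable_fun D f by case/integrableP : fi => /measurable_EFinP.
rewrite (_ : (fun n => _) = fun n => \int[mu]_(x in D) (f \_ `[a n, b n]) x); last first.
  apply/funext => n; rewrite -Rintegral_mkcondr setIidr//.
  exact: sub_half_line.
apply: (@Rint_dominated _ _ R mu D half_line_measurable (fun n => f \_ `[a n, b n]) f (fun x => `|f x|) _ _ _ _ _).
- move=> n; apply/(measurable_restrict f (measurable_itv _) half_line_measurable).
  rewrite setIidr; last exact: sub_half_line.
  by apply: measurable_funS mf; [exact: half_line_measurable|exact: sub_half_line].
- by [].
- move=> x /half_lineP x0; apply: cvg_near_cst; near=> n.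
  rewrite patchE ifT// inE /= in_itv /=; apply/andP; split.
    by near: n; apply: (cvgr_le _ a_0).
  by near: n; move/cvgryPge : b_oo; apply.
- exact: (integrable_norm fi).
- move=> n x _; rewrite patchE; case: ifPn => // _; by rewrite normr0.
Unshelve. all: by end_near. Qed.

Lemma within_continuous_itv f a b : (forall x, a <= x <= b -> {for x, continuous f}) ->
  {within `[a, b], continuous f}.
Proof.
by move=> cf; apply: continuous_in_subspaceT => x /set_mem /=; rewrite in_itv; exact: cf.
Qed.

Lemma integrable_continuous_itv f a b :
  (forall x, a <= x <= b -> {for x, continuous f}) -> mu.-integrable `[a, b] (EFin \o f).
Proof.
move=> cf; apply: continuous_compact_integrable; first exact: segment_compact.
exact: within_continuous_itv.
Qed.

Lemma Rint_FTC F f a b : a < b -> (forall x, a <= x <= b -> {for x, continuous f}) ->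
  (forall x, a <= x <= b -> is_derive x 1 F (f x)) ->
  \int[mu]_(x in `[a, b]) f x = F b - F a.
Proof.
move=> ab cf dF; rewrite /Rintegral (@continuous_FTC2 _ f F a b)//.
- exact: within_continuous_itv.
- have cF x : a <= x <= b -> F y @[y --> x] --> F x.
    by move=> /dF [dFx _]; apply: differentiable_continuous; exact/derivable1_diffP.
  split.
  + by move=> x; rewrite in_itv /= => /andP[ax xb]; case: (dF x) => //; rewrite !ltW.
  + by apply: cvg_at_right_filter; apply: cF; rewrite lexx ltW.
  + by apply: cvg_at_left_filter; apply: cF; rewrite lexx ltW.
- move=> x; rewrite in_itv /= => /andP[ax xb]; rewrite derive1E.
  by case: (dF x) => [|_ ->//]; rewrite !ltW.
Qed.

(** The integrals over the exhausting intervals are differences of values of [F], hence at most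
    [M + M]. *)
Lemma integrable_FTC F f (M : R) : (forall x, 0 < x -> {for x, continuous f}) ->
  (forall x, 0 < x -> is_derive x 1 F (f x)) ->
  (forall x, 0 < x -> 0 <= f x) -> (forall x, 0 < x -> `|F x| <= M) ->
  mu.-integrable D (EFin \o f).
Proof.
move=> cf dF f0 FM; apply: (@integrable_exhaust _ (M + M)) => //.
  exact: measurable_half_line.
move=> n; have n0 : (0 : R) < n.+1%:R by [].
have nV : (0 : R) < n.+1%:R^-1 by rewrite invr_gt0.
have pos x : n.+1%:R^-1 <= x <= n.+1%:R -> 0 < x.
  by move=> /andP[h _]; exact: lt_le_trans h.
have ci : mu.-integrable (exh n) (EFin \o f).
  by apply: integrable_continuous_itv => x /pos; exact: cf.
have fin : (\int[mu]_(x in exh n) (f x)%:E)%E \is a fin_num.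
  by apply: integrable_fin_num => //; exact: measurable_itv.
rewrite -(fineK fin).
rewrite lee_fin -[fine _]/(\int[mu]_(x in exh n) f x).
have [n1|n1] := ltP (n.+1%:R^-1) (n.+1%:R : R).
  rewrite (Rint_FTC (F := F) n1 (fun x hx => cf x (pos x hx))
    (fun x hx => dF x (pos x hx))).
  apply: le_trans (ler_norm _) _; apply: le_trans (ler_normB _ _) _.
  by apply: lerD; exact: FM.
(* Only [n = 0] is left, where the interval shrinks to the point 1 and the fundamental theorem,
   stated for [a < b], does not apply. *)
have -> : exh n = [set n.+1%:R].
  have e : (n.+1%:R : R)^-1 = n.+1%:R.
    apply/eqP; rewrite eq_le n1 andbT.
    apply: (@le_trans _ _ 1); last by rewrite ler1n.
    by rewrite invf_le1// ler1n.
  by rewrite /exh e set_itv1.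
by rewrite Rintegral_set1 addr_ge0//; apply: le_trans (FM 1 _).
Qed.

End HalfLine.

(** * Complex functions of a real variable: continuity, derivatives, primitives *)

Section ComplexCalculus.
Context {R : realType}.
Implicit Types (f g F : R -> R[i]) (x y a b : R) (l m s : R[i]).

Definition ccont f x : Prop := (f y : R[i]^o) @[y --> x] --> (f x : R[i]^o).

(** The variable is real, so the derivative is encoded through real and imaginary parts and real
    differentiation rules can be reused. *)
Definition cderiv f x l : Prop :=
  is_derive x 1 (fun y => complex.Re (f y)) (complex.Re l) /\
  is_derive x 1 (fun y => complex.Im (f y)) (complex.Im l).

Lemma is_derive_continuous (h : R -> R) x (l : R) : is_derive x 1 h l -> {for x, continuous h}.
Proof.
by move=> [dh _]; apply: differentiable_continuous; exact/derivable1_diffP.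
Qed.

Lemma cderiv_ccont f x l : cderiv f x l -> ccont f x.
Proof.
by move=> [d1 d2]; apply/ccvg_ReIm; split;
  [exact: (is_derive_continuous d1)|exact: (is_derive_continuous d2)].
Qed.

Lemma ccont_cst l x : ccont (fun=> l) x.
Proof. exact: cvg_cst. Qed.

Lemma ccontD f g x : ccont f x -> ccont g x -> ccont (fun y => f y + g y) x.
Proof. exact: cvgD. Qed.

Lemma ccontM f g x : ccont f x -> ccont g x -> ccont (fun y => f y * g y) x.
Proof. exact: cvgM. Qed.

Lemma ccont_real (h : R -> R) x : {for x, continuous h} -> ccont (fun y => (h y)%:C) x.
Proof. by move=> ch; apply/ccvg_ReIm; split => //=; exact: cvg_cst. Qed.

Lemma cderiv_cst l x : cderiv (fun=> l) x 0.
Proof. by split => /=; exact: is_derive_cst. Qed.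

Lemma cderiv_real (h : R -> R) x (l : R) : is_derive x 1 h l ->
  cderiv (fun y => (h y)%:C) x l%:C.
Proof. by move=> dh; split => //=; exact: is_derive_cst. Qed.

Lemma is_derive_mul (h k : R -> R) x (dh dk : R) :
  is_derive x 1 h dh -> is_derive x 1 k dk ->
  is_derive x 1 (fun y => h y * k y) (h x * dk + k x * dh).
Proof. exact: is_deriveM. Qed.

Lemma cderivD f g x l m : cderiv f x l -> cderiv g x m ->
  cderiv (fun y => f y + g y) x (l + m).
Proof.
move=> [f1 f2] [g1 g2]; split.
  by rewrite cReD; under eq_fun do rewrite cReD; exact: is_deriveD.
by rewrite cImD; under eq_fun do rewrite cImD; exact: is_deriveD.
Qed.

Lemma cderivM f g x l m : cderiv f x l -> cderiv g x m ->
  cderiv (fun y => f y * g y) x (f x * m + g x * l).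
Proof.
move=> [f1 f2] [g1 g2]; split.
  under eq_fun do rewrite cReM.
  apply: is_derive_eq (is_deriveB (is_derive_mul f1 g1) (is_derive_mul f2 g2)) _.
  by rewrite cReD !cReM; ring.
under eq_fun do rewrite cImM.
apply: is_derive_eq (is_deriveD (is_derive_mul f1 g2) (is_derive_mul f2 g1)) _.
by rewrite cImD !cImM; ring.
Qed.

Lemma cderivZ l f x m : cderiv f x m -> cderiv (fun y => l * f y) x (l * m).
Proof.
by move=> df; have := cderivM (cderiv_cst l x) df; rewrite mulr0 addr0.
Qed.

Lemma cderiv_cexp f x l : cderiv f x l -> cderiv (fun y => cexp (f y)) x (l * cexp (f x)).
Proof.
move=> [f1 f2].
have d1 : is_derive x 1 (fun y => expR (complex.Re (f y)))
    (expR (complex.Re (f x)) * complex.Re l).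
  exact: (is_derive1_comp (is_derive_expR _) f1).
have d2 : is_derive x 1 (fun y => cos (complex.Im (f y)))
    (- sin (complex.Im (f x)) * complex.Im l).
  exact: (is_derive1_comp (is_derive_cos _) f2).
have d3 : is_derive x 1 (fun y => sin (complex.Im (f y)))
    (cos (complex.Im (f x)) * complex.Im l).
  exact: (is_derive1_comp (is_derive_sin _) f2).
split; rewrite /cexp.
  under eq_fun do rewrite cReZ /=.
  apply: is_derive_eq (is_derive_mul d1 d2) _.
  by rewrite cReM cReZ cImZ /=; ring.
under eq_fun do rewrite cImZ /=.
apply: is_derive_eq (is_derive_mul d1 d3) _.
by rewrite cImM cReZ cImZ /=; ring.
Qed.

Lemma near_is_derive (h k : R -> R) x (l : R) :
  (\near x, h x = k x) -> is_derive x 1 h l -> is_derive x 1 k l.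
Proof.
by move=> hk dh; apply: (@near_eq_is_derive _ _ _ h k) => //; exact: oner_neq0.
Qed.

Lemma cderiv_cpow s x : 0 < x -> cderiv (fun y => cpow y s) x (s * cpow x (s - 1)).
Proof.
move=> x0.
have [d1 d2] : cderiv (fun y => cexp (s * (ln y)%:C)) x (s * cpow x (s - 1)).
  have := cderiv_cexp (cderivZ s (cderiv_real (is_derive1_ln x0))).
  rewrite -cpowE// cpowD// cpowN// cpow1// -fmorphV mulrAC mulrA.
  by rewrite -mulrA.
have E : \near x, cexp (s * (ln x)%:C) = cpow x s.
  by near=> y; rewrite cpowE//; near: y; exact: lt_nbhsr.
split.
  apply: near_is_derive d1; apply: filterS E => y ->//.
apply: near_is_derive d2; apply: filterS E => y ->//.
Unshelve. all: by end_near. Qed.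

Lemma ccont_cpow s x : 0 < x -> ccont (fun y => cpow y s) x.
Proof. by move=> x0; exact: cderiv_ccont (cderiv_cpow s x0). Qed.

Notation mu := (@lebesgue_measure R).
Notation D := (`]0%R, +oo[%classic : set R).

Lemma cmeas_half_line f : (forall x, 0 < x -> ccont f x) -> cmeas D f.
Proof.
by move=> cf; split; apply: measurable_half_line => x /cf /ccvg_ReIm[].
Qed.

Lemma cintegrable_ccont f a b : (forall x, a <= x <= b -> ccont f x) ->
  cintegrable mu `[a, b] f.
Proof.
by move=> cf; split; apply: integrable_continuous_itv => x /cf /ccvg_ReIm[].
Qed.

Lemma cint_FTC F f a b : a < b -> (forall x, a <= x <= b -> ccont f x) ->
  (forall x, a <= x <= b -> cderiv F x (f x)) ->
  cintegral mu `[a, b] f = F b - F a.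
Proof.
move=> ab cf dF; apply: complex_ext => /=.
  rewrite (Rint_FTC (F := fun y => complex.Re (F y)) ab
    (fun x h => (iffLR (ccvg_ReIm _ _) (cf x h)).1) (fun x h => (dF x h).1)).
  by rewrite cReB.
rewrite (Rint_FTC (F := fun y => complex.Im (F y)) ab
  (fun x h => (iffLR (ccvg_ReIm _ _) (cf x h)).2) (fun x h => (dF x h).2)).
by rewrite cImB.
Qed.

Lemma cint_exhaust f (a b : nat -> R) : (forall n, 0 < a n) ->
  a @ \oo --> 0 -> b @ \oo --> +oo -> cintegrable mu D f ->
  (cintegral mu `[a n, b n] f : R[i]^o) @[n --> \oo] --> (cintegral mu D f : R[i]^o).
Proof.
by move=> a0 a_0 b_oo [f1 f2]; apply/ccvg_ReIm; split; exact: Rint_exhaust.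
Qed.

Lemma cvg_exh_left : (fun n => (n.+1%:R^-1 : R)) @ \oo --> (0 : R).
Proof. exact: cvg_harmonic. Qed.

Lemma cvg_exh_right : (fun n => (n.+1%:R : R)) @ \oo --> +oo.
Proof.
apply/cvgryPge => A; near=> n; apply: (@le_trans _ _ n%:R); last by rewrite ler_nat.
by near: n; apply: nbhs_infty_ger.
Unshelve. all: by end_near. Qed.

(** The boundary values [l] and [m] are needed only along the endpoints of the exhausting
    intervals. *)
Lemma cint_FTC_half_line F f l m : (forall x, 0 < x -> ccont f x) ->
  (forall x, 0 < x -> cderiv F x (f x)) -> cintegrable mu D f ->
  (F n.+1%:R^-1 : R[i]^o) @[n --> \oo] --> (l : R[i]^o) ->
  (F n.+1%:R : R[i]^o) @[n --> \oo] --> (m : R[i]^o) ->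
  cintegral mu D f = m - l.
Proof.
move=> cf dF fi Fl Fm.
have H : (cintegral mu `[n.+1%:R^-1, n.+1%:R] f : R[i]^o) @[n --> \oo] -->
    (cintegral mu D f : R[i]^o).
  by apply: cint_exhaust fi; [move=> n; rewrite invr_gt0|exact: cvg_exh_left|
    exact: cvg_exh_right].
have H2 : (F n.+1%:R - F n.+1%:R^-1 : R[i]^o) @[n --> \oo] --> (m - l : R[i]^o).
  exact: (@cvgB _ _ _ _ _ _ _ (m : R[i]^o) (l : R[i]^o) Fm Fl).
suff H3 : (cintegral mu `[n.+1%:R^-1, n.+1%:R] f : R[i]^o) @[n --> \oo] -->
    (m - l : R[i]^o) by exact: (cvg_unique (@norm_hausdorff _ _) H H3).
apply: cvg_trans H2; apply: near_eq_cvg; near=> n.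
have n0 : (0 < n)%N by near: n; exact: nbhs_infty_gt.
have n1 : (n.+1%:R^-1 < n.+1%:R :> R).
  apply: (@lt_le_trans _ _ 1); last by rewrite ler1n.
  by rewrite invf_lt1// ltr1n ltnS.
have pos (x : R) : n.+1%:R^-1 <= x <= n.+1%:R -> 0 < x.
  by move=> /andP[h _]; apply: lt_le_trans h; rewrite invr_gt0.
by rewrite /= (cint_FTC n1 (fun x h => cf x (pos x h)) (fun x h => dF x (pos x h))).
Unshelve. all: by end_near. Qed.

End ComplexCalculus.

(** * Integrability from power bounds at 0 and at infinity *)

Section PowerBounds.
Context {R : realType}.
Notation mu := (@lebesgue_measure R).
Notation D := (`]0%R, +oo[%classic : set R).
Implicit Types (h : R -> R) (x y a b c : R) (z s : R[i]).

Lemma powR_continuous c y : 0 < y -> {for y, continuous (fun t : R => t `^ c)}.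
Proof. by move=> y0; exact: is_derive_continuous (is_derive1_powR c y0). Qed.

(** The model majorant: it behaves like y^(c-1) at 0 and like y^(-c-1) at infinity, and it has the
    bounded primitive -1/(c (1 + y^c)). *)
Let q c y := y `^ (c - 1) * ((1 + y `^ c)^-1 * (1 + y `^ c)^-1).

Let q_pos c y : 0 < 1 + y `^ c.
Proof. by rewrite ltr_pwDl// powR_ge0. Qed.

Let q_integrable c : 0 < c -> mu.-integrable D (EFin \o q c).
Proof.
move=> c0.
have dinv x : 0 < x -> is_derive x 1 (fun y => (1 + y `^ c)^-1)
    (- (c * x `^ (c - 1)) * ((1 + x `^ c)^-1 * (1 + x `^ c)^-1)).
  move=> x0; have d1 : is_derive x 1 (fun y => 1 + y `^ c) (c * x `^ (c - 1)).
    apply: is_derive_eq (is_deriveD (is_derive_cst (1 : R) x 1) (is_derive1_powR c x0)) _.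
    by rewrite add0r.
  have n0 : 1 + x `^ c != 0 by rewrite gt_eqF.
  apply: is_derive_eq (@is_deriveV _ (fun y => 1 + y `^ c) x _ 1 n0 d1) _.
  by rewrite /GRing.scale /= -exprVn expr2; ring.
apply: (@integrable_FTC _ (fun y => - c^-1 * (1 + y `^ c)^-1) _ c^-1).
- move=> x x0; have cV : {for x, continuous (fun y => (1 + y `^ c)^-1)}.
    exact: is_derive_continuous (dinv x x0).
  apply: continuousM; first exact: powR_continuous.
  exact: continuousM.
- move=> x x0; apply: is_derive_eq.
    exact: (is_derive_mul (is_derive_cst (- c^-1 : R) x 1) (dinv x x0)).
  rewrite mulr0 addr0 /q mulNr mulNr mulrN opprK -mulrA mulKf//.
  by rewrite gt_eqF.
- by move=> x x0; rewrite /q !mulr_ge0 ?powR_ge0 ?invr_ge0// ltW.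
- move=> x x0; have cV : 0 <= c^-1 by rewrite invr_ge0 ltW.
  have qV : 0 <= (1 + x `^ c)^-1 by rewrite invr_ge0 ltW.
  rewrite normrM normrN !ger0_norm//.
  by rewrite ler_piMr// invf_le1// lerDl powR_ge0.
Qed.

Lemma integrable_pow h a b C : measurable_fun D h -> 0 < a -> 0 < b ->
  (forall y, 0 < y <= 1 -> `|h y| <= C * y `^ (a - 1)) ->
  (forall y, 1 <= y -> `|h y| <= C * y `^ (- b - 1)) ->
  mu.-integrable D (EFin \o h).
Proof.
move=> mh a0 b0 h1 h2; pose c := Num.min a b.
have c0 : 0 < c by rewrite lt_min a0.
have C0 : 0 <= C.
  by have := h2 1 (lexx _); rewrite powR1 mulr1; exact: le_trans.
(* With [c] the smaller exponent, [q c] serves at both ends: the square of 1 + x^c is at most 4 for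
   x <= 1 and at most 4 x^(2c) for x >= 1, whence the factor 4. *)
have ig := integrableZl half_line_measurable (4 * C) (q_integrable c0).
apply: (integrable_le half_line_measurable mh ig) => x /half_lineP x0 /=.
rewrite /q -invfM; have [x1|x1] := leP x 1.
  apply: le_trans (h1 _ _) _; first by rewrite x0.
  rewrite (mulrC 4) -mulrA ler_wpM2l//.
  apply: (@le_trans _ _ (x `^ (c - 1))).
    by apply: ger_powR; rewrite ?x0// lerD2r ge_min lexx.
  rewrite mulrCA ler_peMr ?powR_ge0// ler_pdivlMr ?mulr_gt0// mul1r.
  have : x `^ c <= 1.
    by rewrite -[leRHS](powRr0 x); apply: ger_powR; [rewrite x0 x1|exact: ltW].
  have := powR_ge0 x c; nra.
apply: le_trans (h2 _ (ltW x1)) _.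
rewrite (mulrC 4) -mulrA ler_wpM2l//.
apply: (@le_trans _ _ (x `^ (- c - 1))).
  by apply: ler_powR; rewrite ?(ltW x1)// lerD2r lerN2 ge_min lexx orbT.
have -> : x `^ (- c - 1) = x `^ (c - 1) * (x `^ c * x `^ c)^-1.
  have xD u v : x `^ (u + v) = x `^ u * x `^ v by rewrite powRD// (gt_eqF x0) implybT.
  by rewrite -xD -powRN -xD; congr powR; ring.
rewrite mulrCA ler_wpM2l ?powR_ge0//.
have p1 : 1 <= x `^ c by rewrite -[leLHS](powRr0 x); apply: ler_powR; apply: ltW.
have p0 : 0 < x `^ c by apply: lt_le_trans p1.
rewrite ler_pdivlMr ?mulr_gt0// mulrC ler_pdivrMr ?mulr_gt0//; nra.
Qed.

Lemma expR_ge_exprn x n : 0 <= x -> x ^+ n / n`!%:R <= expR x.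
Proof.
move=> x0; case: n => [|n]; last first.
  by apply: le_trans (expR_ge1Dxn n x0); rewrite lerDr.
by rewrite expr0 divr1 -expR0 ler_expR.
Qed.

Lemma expRN_exprn x n : 0 <= x -> x ^+ n * expR (- x) <= n`!%:R.
Proof.
move=> x0; rewrite expRN ler_pdivrMr ?expR_gt0//.
have := expR_ge_exprn n x0; rewrite ler_pdivrMr ?ltr0n ?fact_gt0//.
by rewrite mulrC.
Qed.

Lemma powR_expRN c : exists C, forall x, 1 <= x -> x `^ c * expR (- x) <= C.
Proof.
pose n := Num.bound `|c|; exists n`!%:R => x x1.
apply: le_trans (expRN_exprn n (le_trans ler01 x1)).
rewrite ler_wpM2r ?expR_ge0// -powR_mulrn ?(le_trans ler01)//.
apply: ler_powR => //; apply: le_trans (ler_norm c) _; apply: ltW.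
exact: archi_boundP.
Qed.

(** The exponent [- 1 - 1] and the bound [1 <= M] are what [integrable_pow] wants with [b = 1] and a
    single constant for both ranges. Where k y^2 >= 1 the exponential wins over the power; elsewhere
    the power itself is bounded. *)
Lemma gauss_decay c k : 0 < c -> 0 < k ->
  exists M, 1 <= M /\ forall y, 1 <= y ->
    y `^ (c - 1) * expR (- (k * y ^+ 2)) <= M * y `^ (- 1 - 1).
Proof.
move=> c0 k0.
have [C CE] := powR_expRN (c + 1).
pose M := Num.max 1 (Num.max (C * (k `^ (- (c + 1)))) (k `^ (- (c + 1)))).
have M1 : 1 <= M by rewrite le_max lexx.
exists M; split => // y y1; have y0 : 0 < y by apply: lt_le_trans y1.
have -> : y `^ (c - 1) = y `^ (- 1 - 1) * y `^ (c + 1).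
  by rewrite -powRD ?(gt_eqF y0) ?implybT//; congr powR; ring.
rewrite -mulrA mulrC ler_wpM2r ?powR_ge0//.
have k1 : 0 < k `^ (c + 1) by rewrite powR_gt0.
have yy : y `^ (c + 1) <= (y ^+ 2) `^ (c + 1).
  rewrite -powR_mulrn ?(ltW y0)// -powRrM; apply: ler_powR => //.
  by rewrite mulr_natl mulr2n lerDl addr_ge0// ltW.
have [ky|ky] := leP 1 (k * y ^+ 2).
  rewrite !le_max; apply/orP; right; apply/orP; left.
  rewrite powRN ler_pdivlMr// mulrAC; apply: le_trans (CE _ ky).
  rewrite ler_wpM2r ?expR_ge0// powRM ?(ltW k0) ?sqr_ge0// mulrC.
  by rewrite ler_wpM2l// ltW.
rewrite !le_max; apply/orP; right; apply/orP; right.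
apply: (@le_trans _ _ (y `^ (c + 1))).
  rewrite ler_piMr ?powR_ge0// -expR0 ler_expR oppr_le0.
  by rewrite mulr_ge0 ?sqr_ge0// ltW.
rewrite powRN -[leRHS]mul1r ler_pdivlMr//; apply: le_trans (_ : (k * y ^+ 2) `^ (c + 1) <= _).
  by rewrite powRM ?(ltW k0) ?sqr_ge0// mulrC ler_wpM2l// ltW.
rewrite -[leRHS](powRr0 (k * y ^+ 2)); apply: ger_powR.
  by rewrite mulr_gt0 ?exprn_gt0//= ltW.
by rewrite addr_ge0// ltW.
Qed.

Lemma integrable_gauss c k : 0 < c -> 0 < k ->
  mu.-integrable D (EFin \o (fun r => r `^ (c - 1) * expR (- (k * r ^+ 2)))).
Proof.
move=> c0 k0; have [M [M1 HM]] := gauss_decay c0 k0.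
have mf : measurable_fun D (fun r => r `^ (c - 1) * expR (- (k * r ^+ 2))).
  apply: measurable_half_line => x x0; apply: continuousM.
    exact: powR_continuous.
  apply: continuous_comp; last exact: continuous_expR.
  apply: continuousN; apply: continuousM; first exact: cvg_cst.
  exact: exprn_continuous.
have e1 y : expR (- (k * y ^+ 2)) <= 1.
  by rewrite -expR0 ler_expR oppr_le0 mulr_ge0 ?sqr_ge0// ltW.
apply: (@integrable_pow _ c 1 M) => //.
  move=> y /andP[y0 y1]; rewrite ger0_norm ?mulr_ge0 ?powR_ge0 ?expR_ge0//.
  rewrite mulrC ler_wpM2r ?powR_ge0//; exact: le_trans (e1 y) M1.
move=> y y1; rewrite ger0_norm ?mulr_ge0 ?powR_ge0 ?expR_ge0//.
exact: HM.
Qed.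

End PowerBounds.

(** * Scaling and inversion on the half line *)

Section Substitution.
Context {R : realType}.
Notation mu := (@lebesgue_measure R).
Notation D := (`]0%R, +oo[%classic : set R).
Implicit Types (f g : R -> R) (x y a b c : R).

Lemma Rint_scale_itv f c a b : 0 < c -> 0 < a -> a <= b ->
  (forall x, 0 < x -> {for x, continuous f}) ->
  \int[mu]_(x in `[c * a, c * b]) f x = c * \int[mu]_(x in `[a, b]) f (c * x).
Proof.
move=> c0 a0 ab cf.
have dF x : is_derive x (1 : R) ( *%R c) c.
  have := is_derive_mul (is_derive_cst c x 1) (is_derive_id x (1 : R)).
  by rewrite mulr1 mulr0 addr0.
have F' : ( *%R c)^`()%classic = cst c.
  by apply/funext => x; rewrite derive1E; case: (dF x).
have cc x : {for x, continuous ( *%R c)} by exact: is_derive_continuous (dF x).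
have pos x : a <= x <= b -> 0 < x by move=> /andP[h _]; exact: lt_le_trans h.
have ci : mu.-integrable `[a, b] (EFin \o (fun x => f (c * x))).
  apply: integrable_continuous_itv => x /pos x0.
  by apply: continuous_comp; [exact: cc|apply: cf; rewrite mulr_gt0].
rewrite -RintegralZl//.
rewrite {1}/Rintegral.
rewrite (@integration_by_substitution_increasing R ( *%R c) f a b ab).
- by rewrite F'; congr fine; apply: eq_integral => x _ /=; rewrite mulrC.
- by move=> x y _ _ xy; rewrite ltr_pM2l.
- by move=> x _; rewrite F'; exact: cvg_cst.
- by rewrite F'; exact: is_cvg_cst.
- by rewrite F'; exact: is_cvg_cst.
- split; [by move=> x _; case: (dF x)| |].
    by apply: cvg_at_right_filter; exact: cc.
  by apply: cvg_at_left_filter; exact: cc.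
- apply: within_continuous_itv => x /andP[h _]; apply: cf.
  by apply: lt_le_trans h; rewrite mulr_gt0.
Qed.

Lemma Rint_inv_itv f a b : 0 < a -> a <= b ->
  (forall x, 0 < x -> {for x, continuous f}) ->
  \int[mu]_(x in `[b^-1, a^-1]) f x =
  \int[mu]_(x in `[a, b]) (f x^-1 * (x^-1 * x^-1)).
Proof.
move=> a0 ab cf; have b0 : 0 < b by exact: lt_le_trans ab.
have dF x : 0 < x -> is_derive x (1 : R) GRing.inv (- (x^-1 * x^-1)).
  move=> x0; have x0' : x != 0 by rewrite gt_eqF.
  apply: is_derive_eq (@is_deriveV _ id x _ 1 x0' (is_derive_id x (1 : R))) _.
  by rewrite /GRing.scale /= mulr1 -exprVn expr2.
have F' x : 0 < x -> (@GRing.inv R)^`()%classic x = - (x^-1 * x^-1).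
  by move=> x0; rewrite derive1E; case: (dF x x0).
have cV x : 0 < x -> {for x, continuous (@GRing.inv R)}.
  by move=> x0; exact: is_derive_continuous (dF x x0).
have cF x : 0 < x -> {for x, continuous (@GRing.inv R)^`()%classic}.
  move=> x0; have H : {for x, continuous (fun y : R => - (y^-1 * y^-1))}.
    by apply: continuousN; apply: continuousM; exact: cV.
  rewrite /prop_for /continuous_at F'//; apply: cvg_trans H; apply: near_eq_cvg.
  by near=> y; rewrite F'//; near: y; exact: lt_nbhsr.
have pos x : a <= x <= b -> 0 < x by move=> /andP[h _]; exact: lt_le_trans h.
rewrite {1}/Rintegral.
rewrite (@integration_by_substitution_decreasing R GRing.inv f a b ab).
- congr fine; apply: eq_integral => x /set_mem; rewrite /= in_itv /= => /pos x0.
  by rewrite !fctE F'// opprK.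
- move=> x y; rewrite !in_itv /= => /pos x0 /pos y0 xy.
  by rewrite ltf_pV2.
- by move=> x; rewrite in_itv /= => /andP[h _]; apply: cF; exact: lt_trans h.
- by apply/cvg_ex; eexists; apply: cvg_at_right_filter; exact: cF.
- by apply/cvg_ex; eexists; apply: cvg_at_left_filter; exact: cF.
- split; [|by apply: cvg_at_right_filter; exact: cV|
    by apply: cvg_at_left_filter; exact: cV].
  move=> x; rewrite in_itv /= => /andP[h _].
  by have [] := dF x (lt_trans a0 h).
- apply: within_continuous_itv => x /andP[h _]; apply: cf.
  by apply: lt_le_trans h; rewrite invr_gt0.
Unshelve. all: by end_near. Qed.

Lemma exh_le n : (n.+1%:R^-1 : R) <= n.+1%:R.
Proof.
apply: (@le_trans _ _ 1); last by rewrite ler1n.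
by rewrite invf_le1 ?ler1n// ltr0n.
Qed.

Lemma Rint_scale f c : 0 < c -> (forall x, 0 < x -> {for x, continuous f}) ->
  mu.-integrable D (EFin \o f) -> mu.-integrable D (EFin \o (fun x => f (c * x))) ->
  \int[mu]_(x in D) f x = c * \int[mu]_(x in D) f (c * x).
Proof.
move=> c0 cf fi fci.
have H1 : \int[mu]_(x in `[c * n.+1%:R^-1, c * n.+1%:R]) f x @[n --> \oo] -->
    \int[mu]_(x in D) f x.
  apply: Rint_exhaust fi; first by move=> n; rewrite mulr_gt0// invr_gt0.
    by rewrite -(mulr0 c); apply: cvgM; [exact: cvg_cst|exact: cvg_exh_left].
  have := @cvg_exh_right R => /cvgryPge H; apply/cvgryPge => A.
  apply: filterS (H (c^-1 * A)) => n.
  by rewrite mulrC ler_pdivrMr// mulrC.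
have H2 : c * \int[mu]_(x in `[n.+1%:R^-1, n.+1%:R]) f (c * x) @[n --> \oo] -->
    c * \int[mu]_(x in D) f (c * x).
  apply: cvgM; first exact: cvg_cst.
  by apply: Rint_exhaust fci; [move=> n; rewrite invr_gt0|exact: cvg_exh_left|
    exact: cvg_exh_right].
apply: (cvg_unique (@norm_hausdorff _ _) H1).
apply: cvg_trans H2; apply: near_eq_cvg; apply: nearW => n.
by rewrite Rint_scale_itv// ?invr_gt0//; exact: exh_le.
Qed.

Lemma Rint_inv f : (forall x, 0 < x -> {for x, continuous f}) ->
  mu.-integrable D (EFin \o f) ->
  mu.-integrable D (EFin \o (fun x => f x^-1 * (x^-1 * x^-1))) ->
  \int[mu]_(x in D) f x = \int[mu]_(x in D) (f x^-1 * (x^-1 * x^-1)).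
Proof.
move=> cf fi fci.
have H (g : R -> R) : mu.-integrable D (EFin \o g) ->
    \int[mu]_(x in `[n.+1%:R^-1, n.+1%:R]) g x @[n --> \oo] --> \int[mu]_(x in D) g x.
  move=> gi; by apply: Rint_exhaust gi; [move=> n; rewrite invr_gt0|
    exact: cvg_exh_left|exact: cvg_exh_right].
have H1 := H _ fi; have H2 := H _ fci.
apply: (cvg_unique (@norm_hausdorff _ _) H1).
apply: cvg_trans H2; apply: near_eq_cvg; apply: nearW => n.
by rewrite -Rint_inv_itv ?invr_gt0// ?invrK//; exact: exh_le.
Qed.

Implicit Types (F : R -> R[i]).

Lemma cint_scale F c : 0 < c -> (forall x, 0 < x -> ccont F x) ->
  cintegrable mu D F -> cintegrable mu D (fun x => F (c * x)) ->
  cintegral mu D F = c%:C * cintegral mu D (fun x => F (c * x)).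
Proof.
move=> c0 cF [f1 f2] [g1 g2]; apply: complex_ext; rewrite ?cReZ ?cImZ /=.
  by apply: Rint_scale => // x /cF /ccvg_ReIm[].
by apply: (@Rint_scale (fun x => complex.Im (F x))) => // x /cF /ccvg_ReIm[].
Qed.

Lemma cint_inv F : (forall x, 0 < x -> ccont F x) ->
  cintegrable mu D F -> cintegrable mu D (fun x => F x^-1 * (x^-1 * x^-1)%:C) ->
  cintegral mu D F = cintegral mu D (fun x => F x^-1 * (x^-1 * x^-1)%:C).
Proof.
move=> cF [f1 f2] [g1 g2]; rewrite /cintegral; congr (_ +i* _).
  rewrite (@Rint_inv (fun x => complex.Re (F x)))//.
  - by apply: eq_Rintegral => x _; rewrite cReZr.
  - by move=> x /cF /ccvg_ReIm[].
  - by apply: eq_integrable g1 => // x _; rewrite /= cReZr.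
rewrite (@Rint_inv (fun x => complex.Im (F x)))//.
- by apply: eq_Rintegral => x _; rewrite cImZr.
- by move=> x /cF /ccvg_ReIm[].
- by apply: eq_integrable g2 => // x _; rewrite /= cImZr.
Qed.

End Substitution.

(** * The reciprocal Gamma function *)

Section GammaProduct.
Context {R : realType}.
Notation mu := (@lebesgue_measure R).
Implicit Types (w z s : R[i]) (x y : R).

Lemma cderiv_cexp_line w x : cderiv (fun t : R => cexp (t%:C * w)) x (w * cexp (x%:C * w)).
Proof.
apply: cderiv_cexp; have := cderivZ w (cderiv_real (is_derive_id x (1 : R))).
by rewrite mulr1; under eq_fun do rewrite mulrC.
Qed.

Lemma Rint01_cst (c : R) : \int[mu]_(t in `[0%R, 1%R]) c = c.
Proof.
rewrite Rintegral_cst//= lebesgue_measure_itv/= lte_fin ltr01.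
by rewrite oppr0 adde0 mulr1.
Qed.

Lemma ccont_cexp_line w x : ccont (fun t : R => cexp (t%:C * w)) x.
Proof. exact: cderiv_ccont (cderiv_cexp_line w x). Qed.

Lemma expR_line_le w (t : R) : 0 <= t <= 1 -> expR (complex.Re (t%:C * w)) <= expR (cabs w).
Proof.
move=> /andP[t0 t1]; rewrite cReZ ler_expR; apply: le_trans (ler_norm _) _.
rewrite normrM (ger0_norm t0); apply: le_trans (cabs_Re w).
by rewrite ler_piMl.
Qed.

(** The difference is the integral of w e^(tw) over t in [0, 1]; the factor 2 is that of
    [cabs_cint_le]. *)
Lemma cabs_cexp_sub1 w : cabs (cexp w - 1) <= 2 * (cabs w * expR (cabs w)).
Proof.
have c1 x : 0 <= x <= 1 -> ccont (fun t : R => w * cexp (t%:C * w)) x.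
  by move=> _; apply: ccontM; [exact: ccont_cst|exact: ccont_cexp_line].
rewrite -{1}(mul1r w) -[X in _ - X](cexp0) -(mul0r w).
rewrite -(cint_FTC (F := fun t : R => cexp (t%:C * w)) ltr01 c1); last first.
  by move=> x _; exact: cderiv_cexp_line.
rewrite -[X in _ <= 2 * X]Rint01_cst; apply: cabs_cint_le => //.
- exact: cintegrable_ccont.
- by apply: integrable_continuous_itv => x _; exact: cvg_cst.
move=> t /=; rewrite in_itv /= => t01.
by rewrite cabsM cabs_cexp ler_wpM2l ?cabs_ge0// expR_line_le.
Qed.

(** The difference is the integral of w (e^(tw) - 1) over t in [0, 1], to which [cabs_cexp_sub1]
    applies; each of the two integrations costs a factor 2. *)
Lemma cabs_cexp_sub1D w : cabs (cexp w - 1 - w) <= 4 * (cabs w ^+ 2 * expR (cabs w)).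
Proof.
have c1 x : 0 <= x <= 1 -> ccont (fun t : R => w * cexp (t%:C * w) + - w) x.
  move=> _; apply: ccontD; last exact: ccont_cst.
  by apply: ccontM; [exact: ccont_cst|exact: ccont_cexp_line].
have dF x : 0 <= x <= 1 -> cderiv (fun t : R => cexp (t%:C * w) + (- w) * t%:C) x
    (w * cexp (x%:C * w) + - w).
  move=> _; apply: cderivD; first exact: cderiv_cexp_line.
  by have := cderivZ (- w) (cderiv_real (is_derive_id x (1 : R))); rewrite mulr1.
have := cint_FTC ltr01 c1 dF.
rewrite !mulr0 !mulr1 !mul1r !mul0r cexp0 addr0 addrAC => <-.
rewrite -[leRHS](_ : 2 * (cabs w * (2 * (cabs w * expR (cabs w)))) = _); last by ring.
rewrite -[X in _ <= 2 * X]Rint01_cst; apply: cabs_cint_le => //.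
- exact: cintegrable_ccont.
- by apply: integrable_continuous_itv => x _; exact: cvg_cst.
move=> t /=; rewrite in_itv /= => /andP[t0 t1].
rewrite -[X in _ + X]mulr1 mulNr -mulrBr cabsM ler_wpM2l ?cabs_ge0//.
apply: le_trans (cabs_cexp_sub1 _) _; rewrite cabsM cabs_real (ger0_norm t0).
rewrite ler_wpM2l//; apply: ler_pM; rewrite ?mulr_ge0 ?cabs_ge0 ?expR_ge0//.
  by rewrite ler_piMl// cabs_ge0.
by rewrite ler_expR ler_piMl// cabs_ge0.
Qed.

Lemma series_telescope_cvg : cvgn (series (fun n => (n.+1%:R * n.+2%:R)^-1 : R)).
Proof.
have E n : series (fun n => (n.+1%:R * n.+2%:R)^-1 : R) n = 1 - n.+1%:R^-1.
  rewrite /series /=; elim: n => [|n IH]; first by rewrite big_nil invr1 subrr.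
  rewrite big_nat_recr//= IH; field.
  by rewrite !nat1r ?natr1 ?pnatr_eq0 //=; rewrite -!natrD ?pnatr_eq0.
apply/cvg_ex; exists 1; rewrite (funext E) -[X in _ --> X]subr0.
by apply: cvgB; [exact: cvg_cst|exact: cvg_exh_left].
Qed.

(** By induction |P n| is at most |P 0| times the exponential of the partial sum of [a], so the
    increments are absolutely summable. No logarithm of a factor is taken, so products that vanish
    are covered. *)
Lemma cvg_infinite_product (P : nat -> R[i]) (a : nat -> R) :
  (forall n, 0 <= a n) -> cvgn (series a) ->
  (forall n, cabs (P n.+1 - P n) <= cabs (P n) * a n) ->
  exists l, (P n : R[i]^o) @[n --> \oo] --> (l : R[i]^o).
Proof.
move=> a0 ca Pa; pose M := cabs (P 0) * expR (limn (series a)).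
have Pn n : cabs (P n) <= cabs (P 0) * expR (series a n).
  elim: n => [|n IH]; first by rewrite /series /= big_geq// expR0 mulr1.
  have -> : P n.+1 = P n + (P n.+1 - P n) by rewrite addrC subrK.
  apply: le_trans (cabs_triangle _ _) _.
  apply: (@le_trans _ _ (cabs (P n) * (1 + a n))).
    by rewrite mulrDr mulr1 lerD2l.
  rewrite seriesSr expRD mulrA; apply: ler_pM; rewrite ?cabs_ge0 ?addr_ge0//.
  exact: expR_ge1Dx.
have PM n : cabs (P n) <= M.
  apply: le_trans (Pn n) _; rewrite ler_wpM2l ?cabs_ge0// ler_expR.
  apply: nondecreasing_cvgn_le => //.
  by apply/nondecreasing_seqP => k; rewrite seriesSr lerDl.
have sd : abssum (fun n => P n.+1 - P n).
  apply: (@abssum_le _ _ (fun n => M * a n)); last exact: is_cvg_seriesZ.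
  by move=> n; apply: le_trans (Pa n) _; rewrite ler_wpM2r.
exists (P 0 + csum (fun n => P n.+1 - P n)).
rewrite (_ : (fun n => _) =
    (fun n => P 0 + series ((fun n => P n.+1 - P n) : nat -> R[i]^o) n)); last first.
  apply/funext => n; rewrite /series /= telescope_sumr//.
  by rewrite addrC subrK.
by apply: cvgD; [exact: cvg_cst|exact: cvg_csum].
Qed.

(** The sequence whose limit is [rGamma]. Its term of index 0 is degenerate because of the
    convention for [cpow 0], so ratios are formed from index 1 on. *)
Definition gauss_prod z (n : nat) : R[i] :=
  (\prod_(0 <= k < n.+1) (z + k%:R)) / (n`!%:R * cpow n%:R z).

Lemma gauss_prodS z n : gauss_prod z n.+2 =
  gauss_prod z n.+1 * ((1 + z / n.+2%:R) * cexp (z * (ln (n.+1%:R / n.+2%:R))%:C)).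
Proof.
rewrite /gauss_prod big_nat_recr//= factS natrM.
have n1 : (0 : R) < n.+1%:R by [].
have n2 : (0 : R) < n.+2%:R by [].
rewrite !cpowE// ln_div ?posrE// rmorphB/= mulrBr cexpD cexpN.
have e1 := cexp_neq0 (z * (ln n.+1%:R)%:C).
have e2 := cexp_neq0 (z * (ln n.+2%:R)%:C).
set e := cexp _ in e1 *; set e' := cexp _ in e2 *.
have f0 : (n.+1`!)%:R != 0 :> R[i] by rewrite pnatr_eq0 -lt0n fact_gt0.
have m0 : n.+2%:R != 0 :> R[i] by rewrite pnatr_eq0.
set Q := \prod_(_ <= _ < _) _; set m := n.+2%:R in m0 *; set f := _`!%:R in f0 *.
clearbody e e' m f Q; by field; rewrite e1 e2 f0 m0.
Qed.

Lemma ln_sub_bound (t : R) : 0 <= t <= 2^-1 -> `|ln (1 - t) + t| <= 2 * t ^+ 2.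
Proof.
move=> /andP[t0 t1].
have t2 : 0 < 1 - t by lra.
have t3 : -1 < - t by lra.
have u1 : ln (1 - t) <= - t by exact (le_ln1Dx t3).
have u2 : - ln (1 - t) <= t / (1 - t).
  rewrite -lnV ?posrE//.
  rewrite [X in ln X](_ : _ = 1 + t / (1 - t)); last by field; rewrite gt_eqF.
  have t4 : -1 < t / (1 - t).
    by apply: (@lt_le_trans _ _ 0); rewrite ?ltrN10// divr_ge0// ltW.
  exact (le_ln1Dx t4).
have u3 : t / (1 - t) <= t + 2 * t ^+ 2.
  by rewrite ler_pdivrMr// expr2; nra.
rewrite ler_norml; apply/andP; split; nra.
Qed.

(** At t = 1/(n+2) this is the ratio of consecutive terms of Gauss's product, (1 + zt)(1 - t)^z. The
    terms of first order in t cancel, which leaves the summable order t^2. *)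
Lemma gauss_factor_bound z : exists C : R, 0 <= C /\ forall t : R, 0 <= t <= 2^-1 ->
  cabs ((1 + z * t%:C) * cexp (z * (ln (1 - t))%:C) - 1) <= C * t ^+ 2.
Proof.
set a := cabs z; have a0 : 0 <= a by exact: cabs_ge0.
(* The three summands bound, in this order, z (ln(1-t) + t), z t w and (1 + zt)(e^w - 1 - w), where
   w = z ln(1-t). *)
exists (2 * a + a * a * 2 + (1 + a) * (4 * (a ^+ 2 * 4 * expR (a * 2)))).
split.
  by rewrite !addr_ge0 ?mulr_ge0 ?addr_ge0 ?expR_ge0 ?sqr_ge0.
move=> t t01; have lb := ln_sub_bound t01; case/andP : t01 => t0 t1.
set w := z * (ln (1 - t))%:C.
have lt2 : `|ln (1 - t)| <= 2 * t.
  have -> : ln (1 - t) = (ln (1 - t) + t) + - t by rewrite addrK.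
  apply: le_trans (ler_normD _ _) _; rewrite normrN (ger0_norm t0).
  have : 2 * t ^+ 2 <= t by rewrite expr2; nra.
  by move: lb; lra.
have wt : cabs w <= a * (2 * t) by rewrite cabsM cabs_real ler_wpM2l.
have -> : (1 + z * t%:C) * cexp w - 1 =
    (z * t%:C + w) + z * t%:C * w + (1 + z * t%:C) * (cexp w - 1 - w) by ring.
apply: le_trans (cabs_triangle _ _) _; rewrite [leRHS]mulrDl; apply: lerD.
  apply: le_trans (cabs_triangle _ _) _; rewrite [leRHS]mulrDl; apply: lerD.
    have -> : z * t%:C + w = z * (ln (1 - t) + t)%:C by rewrite /w rmorphD/=; ring.
    have -> : 2 * a * t ^+ 2 = a * (2 * t ^+ 2) by ring.
    by rewrite cabsM cabs_real ler_wpM2l.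
  rewrite (cabsM (z * _)) (cabsM z) cabs_real (ger0_norm t0).
  have -> : a * a * 2 * t ^+ 2 = (a * t) * (a * (2 * t)) by ring.
  by rewrite ler_wpM2l ?mulr_ge0.
rewrite cabsM -mulrA; apply: ler_pM; rewrite ?cabs_ge0//.
  apply: le_trans (cabs_triangle _ _) _; rewrite cabs1 lerD2l cabsM cabs_real.
  by rewrite (ger0_norm t0) ler_piMr//; lra.
apply: le_trans (cabs_cexp_sub1D _) _.
have -> : 4 * (a ^+ 2 * 4 * expR (a * 2)) * t ^+ 2 =
  4 * ((a * (2 * t)) ^+ 2 * expR (a * 2)) by ring.
rewrite ler_wpM2l//; apply: ler_pM; rewrite ?sqr_ge0 ?expR_ge0//.
  by rewrite ler_sqr ?nnegrE ?cabs_ge0 ?mulr_ge0.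
by rewrite ler_expR; apply: le_trans wt _; rewrite ler_wpM2l//; lra.
Qed.

Lemma rGamma_cvg z : (gauss_prod z n : R[i]^o) @[n --> \oo] --> (rGamma z : R[i]^o).
Proof.
suff [l Hl] : exists l, (gauss_prod z n : R[i]^o) @[n --> \oo] --> (l : R[i]^o).
  by have -> : rGamma z = l by exact: climE.
have [C [C0 HC]] := gauss_factor_bound z.
have [l Hl] : exists l, (gauss_prod z n.+1 : R[i]^o) @[n --> \oo] --> (l : R[i]^o).
  apply: (@cvg_infinite_product _ (fun n => C * (n.+1%:R * n.+2%:R)^-1)).
  - by move=> n; rewrite mulr_ge0// invr_ge0 mulr_ge0.
  - by apply: is_cvg_seriesZ; exact: series_telescope_cvg.
  move=> n; rewrite gauss_prodS -{2}(mulr1 (gauss_prod z n.+1)) -mulrBr cabsM.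
  rewrite ler_wpM2l ?cabs_ge0//.
  have t01 : 0 <= (n.+2%:R^-1 : R) <= 2^-1.
    by rewrite invr_ge0 ler0n /= lef_pV2 ?posrE// ler_nat.
  have := HC _ t01.
  have -> : 1 - n.+2%:R^-1 = n.+1%:R / n.+2%:R :> R.
    have m0 : (n.+2%:R : R) != 0 by rewrite pnatr_eq0.
    by apply: (mulIf m0); rewrite mulrBl mulVf// divfK// mul1r -natr1 addrK.
  have -> : (n.+2%:R^-1 : R)%:C = n.+2%:R^-1 by rewrite fmorphV/= natC.
  move=> /le_trans; apply; rewrite ler_wpM2l// exprVn lef_pV2 ?posrE ?exprn_gt0 ?mulr_gt0//.
  by rewrite expr2 ler_wpM2r// ler_nat.
by exists l; rewrite -(cvg_shiftS (fun n => gauss_prod z n : R[i]^o)).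
Qed.

(** For n > 0 the two products are related exactly: z times the product at z + 1 is the product at z
    times 1 + (z + 1)/n. *)
Lemma rGammaS z : rGamma z = z * rGamma (z + 1).
Proof.
have H1 : (z * gauss_prod (z + 1) n : R[i]^o) @[n --> \oo] --> (z * rGamma (z + 1) : R[i]^o).
  by apply: cvgM; [exact: cvg_cst|exact: rGamma_cvg].
have H2 : (gauss_prod z n * (1 + (z + 1) * (n%:R^-1 : R)%:C) : R[i]^o) @[n --> \oo] -->
    (rGamma z : R[i]^o).
  rewrite -[X in _ --> X]mulr1; apply: cvgM; first exact: rGamma_cvg.
  rewrite -[X in _ --> X]addr0; apply: cvgD; first exact: cvg_cst.
  rewrite -[X in _ --> X](mulr0 (z + 1)); apply: cvgM; first exact: cvg_cst.
  apply/ccvg_ReIm; split => /=; last exact: cvg_cst.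
  by rewrite -(cvg_shiftS (fun n => (n%:R^-1 : R))); exact: cvg_exh_left.
apply: (cvg_unique (@norm_hausdorff _ _) H2); apply: cvg_trans H1.
apply: near_eq_cvg; near=> n.
have n0 : (0 < n)%N by near: n; exact: nbhs_infty_gt.
rewrite /gauss_prod; have nR : (0 : R) < n%:R by rewrite ltr0n.
rewrite cpowD// cpow1// natC fmorphV/= natC.
have -> : z * ((\prod_(0 <= k < n.+1) (z + 1 + k%:R)) / (n`!%:R * (cpow n%:R z * n%:R))) =
  (\prod_(0 <= k < n.+1) (z + k%:R)) * (z + n.+1%:R) / (n`!%:R * (cpow n%:R z * n%:R)).
  rewrite mulrA; congr (_ / _).
  rewrite -(big_nat_recr n.+1 0 (fun k => z + k%:R))//= [RHS]big_nat_recl//=.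
  rewrite addr0; congr (_ * _); apply: eq_big_nat => k _.
  by rewrite -addrA nat1r.
have n0' : n%:R != 0 :> R[i] by rewrite pnatr_eq0 -lt0n.
have f0 : (n`!)%:R != 0 :> R[i] by rewrite pnatr_eq0 -lt0n fact_gt0.
have c0 := cpow_neq0 z nR.
rewrite -natr1; set Q := \prod_(_ <= _ < _) _.
by field; rewrite n0' f0 c0.
Unshelve. all: by end_near. Qed.

Lemma rGamma_subnat n : rGamma (- n%:R : R[i]) = 0.
Proof.
elim: n => [|n IH]; first by rewrite oppr0 rGammaS mul0r.
by rewrite rGammaS -natr1 opprD subrK IH mulr0.
Qed.

(** By the functional equation the modulus cannot grow with k once |z + k| >= 1, so finitely many
    values decide. Every Bessel-type series below is majorised through this bound. *)
Lemma rGamma_bound z : exists C : R, forall k : nat, cabs (rGamma (z + k%:R)) <= C.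
Proof.
pose K := Num.bound (cabs z + 1).
have dec k : (K <= k)%N -> cabs (rGamma (z + k.+1%:R)) <= cabs (rGamma (z + k%:R)).
  move=> Kk; rewrite [in leRHS]rGammaS cabsM -addrA natr1 ler_peMl ?cabs_ge0//.
  have h : cabs z + 1 <= k%:R.
    apply: ltW; apply: (lt_le_trans (archi_boundP _)); rewrite ?ler_nat//.
    by rewrite addr_ge0 ?cabs_ge0.
  have := cabs_triangle (z + k%:R) (- z); rewrite addrAC subrr add0r cabs_nat cabsN; lra.
exists (\sum_(j < K.+1) cabs (rGamma (z + j%:R))) => k.
have small j : (j <= K)%N ->
    cabs (rGamma (z + j%:R)) <= \sum_(j < K.+1) cabs (rGamma (z + j%:R)).
  move=> jK; rewrite -ltnS in jK.
  rewrite (bigD1 (Ordinal jK))//= lerDl; apply: sumr_ge0 => i _; exact: cabs_ge0.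
have [/small//|/ltnW] := leqP k K; elim: k => [|k IH].
  by rewrite leqn0 => /eqP K0; apply: small; rewrite K0.
rewrite leq_eqVlt => /orP[/eqP <-|]; first exact: small.
by rewrite ltnS => Kk; apply: le_trans (dec _ Kk) (IH Kk).
Qed.

End GammaProduct.

(** * Euler's integral for Gamma *)

Section GammaIntegral.
Context {R : realType}.
Notation mu := (@lebesgue_measure R).
Notation D := (`]0%R, +oo[%classic : set R).
Implicit Types (w z s : R[i]) (x y k : R).

(** Euler's integral after the substitution t = r^2, equal to Gamma(z) / (2 k^z): the form in which
    Gaussian weights produce it. Accordingly [gam] is Gamma on Re z > 0. *)
Definition gint z k : R[i] :=
  cintegral mu D (fun r => cpow r (2 * z - 1) * (expR (- (k * r ^+ 2)))%:C).

Definition gam z : R[i] := 2 * gint z 1.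

Lemma Re_2B1 z : complex.Re (2 * z - 1) = 2 * complex.Re z - 1.
Proof. by rewrite cReB cReM (cRe_nat 2) (cIm_nat 2) mul0r subr0. Qed.

Lemma expRN_sqr_continuous k x : {for x, continuous (fun r : R => expR (- (k * r ^+ 2)))}.
Proof.
apply: continuous_comp; last exact: continuous_expR.
apply: continuousN; apply: continuousM; first exact: cvg_cst.
exact: exprn_continuous.
Qed.

Lemma gint_ccont z k x : 0 < x ->
  ccont (fun r => cpow r z * (expR (- (k * r ^+ 2)))%:C) x.
Proof.
move=> x0; apply: ccontM; first exact: ccont_cpow.
by apply: ccont_real; exact: expRN_sqr_continuous.
Qed.

Lemma gint_integrable z k : 0 < complex.Re z -> 0 < k ->
  cintegrable mu D (fun r => cpow r (2 * z - 1) * (expR (- (k * r ^+ 2)))%:C).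
Proof.
move=> z0 k0; have z2 : 0 < 2 * complex.Re z by rewrite mulr_gt0.
apply: (cintegrable_le half_line_measurable _ (integrable_gauss z2 k0)).
  by apply: cmeas_half_line => x x0; exact: gint_ccont.
move=> x /half_lineP x0.
by rewrite cabsM cabs_cpow// cabs_real Re_2B1 ger0_norm// expR_ge0.
Qed.

Lemma gint_scale z k : 0 < complex.Re z -> 0 < k ->
  gint z k = cpow k (- z) * gint z 1.
Proof.
move=> z0 k0; pose c := Num.sqrt k.
have c0 : 0 < c by rewrite sqrtr_gt0.
have cV0 : 0 < c^-1 by rewrite invr_gt0.
have ck : c ^+ 2 = k by rewrite sqr_sqrtr// ltW.
have E (x : R) : 0 < x -> cpow (c^-1 * x) (2 * z - 1) * (expR (- (k * (c^-1 * x) ^+ 2)))%:C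
    = cpow c^-1 (2 * z - 1) * (cpow x (2 * z - 1) * (expR (- (1 * x ^+ 2)))%:C).
  move=> x0; rewrite cpowM// -mulrA; congr (_ * (_ * _)).
  by rewrite exprMn mulrA exprVn ck divff ?gt_eqF.
have EI : cintegral mu D (fun x => cpow (c^-1 * x) (2 * z - 1) *
      (expR (- (k * (c^-1 * x) ^+ 2)))%:C) = cpow c^-1 (2 * z - 1) * gint z 1.
  rewrite /gint -cintZ; [|exact: half_line_measurable|exact: gint_integrable].
  by apply: eq_cint => x /set_mem /half_lineP x0; rewrite E.
rewrite {1}/gint (cint_scale cV0).
- rewrite EI mulrA; congr (_ * _).
  by rewrite -(cpow1 cV0) -cpowD// -ck cpow_exp// cpowV//; congr cpow; ring.
- by move=> x x0; exact: gint_ccont.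
- exact: gint_integrable.
- have := cintegrableZ half_line_measurable (cpow c^-1 (2 * z - 1)) (gint_integrable z0 ltr01).
  by apply: (eq_cintegrable half_line_measurable) => x /set_mem /half_lineP x0; rewrite E.
Qed.

Lemma is_derive_expRN_sqr k x :
  is_derive x 1 (fun r : R => expR (- (k * r ^+ 2))) (- (2 * k * x) * expR (- (k * x ^+ 2))).
Proof.
have d1 : is_derive x 1 (fun r : R => - (k * r ^+ 2)) (- (2 * k * x)).
  have dd := is_deriveN (is_derive_mul (is_derive_cst k x 1)
    (is_derive_mul (is_derive_id x (1 : R)) (is_derive_id x (1 : R)))).
  apply: is_derive_eq dd _ => /=. by ring.
apply: is_derive_eq (is_derive1_comp (is_derive_expR _) d1) _.
by rewrite mulrC.
Qed.

Lemma cvg_powR_exh_left (c : R) : 0 < c -> (n.+1%:R^-1 : R) `^ c @[n --> \oo] --> (0 : R).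
Proof.
move=> c0; have := powR_cvg0 c0 => H.
apply: (cvg_comp _ _ _ H) => A [e /= e0 HA].
have /cvgrPdist_lt /(_ e e0) := @cvg_exh_left R.
by apply: filterS => n hn; apply: HA.
Qed.

Lemma cvg_gauss_exh_right (c k : R) : 0 < c -> 0 < k ->
  (n.+1%:R : R) `^ c * expR (- (k * n.+1%:R ^+ 2)) @[n --> \oo] --> (0 : R).
Proof.
move=> c0 k0; have [M [M1 HM]] := gauss_decay c0 k0.
apply: (@squeeze_cvgr _ _ _ _ (fun=> 0) (fun n => M * n.+1%:R^-1)); first 1 last.
- exact: cvg_cst.
- by rewrite -(mulr0 M); apply: cvgM; [exact: cvg_cst|exact: cvg_exh_left].
apply: nearW => n; rewrite mulr_ge0 ?powR_ge0 ?expR_ge0//=.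
have n1 : (1 : R) <= n.+1%:R by rewrite ler1n.
have n0 : (0 : R) < n.+1%:R by [].
have := HM _ n1.
have pB (u : R) : (n.+1%:R : R) `^ (u - 1) = n.+1%:R `^ u / n.+1%:R.
  by rewrite powRB ?(gt_eqF n0) ?implybT// powRr1.
by rewrite !pB powR_inv1// (mulrAC _ _ (expR _)) (mulrA M) ler_pM2r ?invr_gt0.
Qed.

Lemma cvg_cabs0 (u : nat -> R[i]) (a : nat -> R) : (forall n, cabs (u n) <= a n) ->
  a @ \oo --> 0 -> (u n : R[i]^o) @[n --> \oo] --> (0 : R[i]^o).
Proof.
move=> ua a0; apply/ccvgP.
apply: (@squeeze_cvgr _ _ _ _ (fun=> 0) a); [|exact: cvg_cst|exact: a0].
by apply: nearW => n; rewrite subr0 cabs_ge0 ua.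
Qed.

(** Integration of the derivative of r^(2z) e^(-r^2), which vanishes at both ends when Re z > 0. *)
Lemma gamS z : 0 < complex.Re z -> gam (z + 1) = z * gam z.
Proof.
move=> z0; pose g s r := cpow r (2 * s - 1) * (expR (- (1 * r ^+ 2)))%:C.
have z1 : 0 < complex.Re (z + 1) by rewrite cReD addr_gt0// ltr01.
have i1 := gint_integrable z0 ltr01; have i2 := gint_integrable z1 ltr01.
have H : cintegral mu D (fun r => 2 * z * g z r + (- 2) * g (z + 1) r) = 0 - 0.
  apply: (@cint_FTC_half_line _ (fun r => cpow r (2 * z) * (expR (- (1 * r ^+ 2)))%:C)).
  - by move=> x x0; apply: ccontD; apply: ccontM;
      [exact: ccont_cst|exact: gint_ccont|exact: ccont_cst|exact: gint_ccont].
  - move=> x x0.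
    have := cderivM (cderiv_cpow (2 * z) x0) (cderiv_real (is_derive_expRN_sqr 1 x)).
    congr (cderiv _ _ _); rewrite /g.
    have -> : 2 * (z + 1) - 1 = 1 + 2 * z by ring.
    by rewrite (cpowD 1)// cpow1// rmorphM/= rmorphN/= !rmorphM/= (natC 2); ring.
  - by apply: cintegrableD; [exact: half_line_measurable|..];
      apply: cintegrableZ => //; exact: half_line_measurable.
  - have z2 : 0 < 2 * complex.Re z by rewrite mulr_gt0.
    apply: cvg_cabs0 (cvg_powR_exh_left z2) => n.
    rewrite cabsM cabs_cpow ?invr_gt0// cReM (cRe_nat 2) (cIm_nat 2) mul0r subr0.
    rewrite cabs_real ger0_norm ?expR_ge0// ler_piMr ?powR_ge0//.
  - have z2 : 0 < 2 * complex.Re z by rewrite mulr_gt0.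
    apply: cvg_cabs0 (cvg_gauss_exh_right z2 ltr01) => n.
    rewrite cabsM cabs_cpow// cReM (cRe_nat 2) (cIm_nat 2) mul0r subr0.
    by rewrite cabs_real ger0_norm ?expR_ge0.
move: H; rewrite subr0 cintD; last 3 first.
- exact: half_line_measurable.
- by apply: cintegrableZ => //; exact: half_line_measurable.
- by apply: cintegrableZ => //; exact: half_line_measurable.
rewrite !cintZ//; do ?exact: half_line_measurable.
move=> /eqP; rewrite mulNr subr_eq0 => /eqP E.
by rewrite /gam /gint -E; ring.
Qed.

Lemma gam1 : gam 1 = 1.
Proof.
have H : cintegral mu D (fun r => 2 * (cpow r (2 * 1 - 1) * (expR (- (1 * r ^+ 2)))%:C))
    = 0 - (- 1).
  apply: (@cint_FTC_half_line _ (fun r => (- expR (- (1 * r ^+ 2)))%:C)).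
  - by move=> x x0; apply: ccontM; [exact: ccont_cst|exact: gint_ccont].
  - move=> x x0; have := cderiv_real (is_deriveN (is_derive_expRN_sqr 1 x)).
    congr (cderiv _ _ _); rewrite (_ : 2 * 1 - 1 = 1); last by ring.
    by rewrite cpow1// !rmorphN/= !rmorphM/= rmorphN/= !rmorphM/= (natC 2); ring.
  - apply: cintegrableZ; first exact: half_line_measurable.
    by apply: gint_integrable => //=; exact: ltr01.
  - apply/ccvg_ReIm; split => /=; last by rewrite oppr0; exact: cvg_cst.
    apply: cvgN; have := cvg_comp _ _ (@cvg_exh_left R) (@expRN_sqr_continuous 1 0).
    by rewrite expr0n mulr0 oppr0 expR0.
  - have := cvg_gauss_exh_right ltr01 (@ltr01 R) => H.
    apply: cvg_cabs0 H => n; rewrite cabs_real normrN ger0_norm ?expR_ge0//.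
    by rewrite ler_peMl ?expR_ge0// powRr1// ler1n.
rewrite /gam /gint -cintZ; first by rewrite H sub0r opprK.
- exact: half_line_measurable.
- by apply: gint_integrable => //=; exact: ltr01.
Qed.

Lemma gam_nat n : gam n.+1%:R = n`!%:R.
Proof.
elim: n => [|n IH]; first by rewrite gam1.
by rewrite -natr1 gamS ?cRe_nat ?ltr0n// IH factS natrM.
Qed.

Lemma gamD z n : 0 < complex.Re z ->
  gam (z + n.+1%:R) = (\prod_(0 <= k < n.+1) (z + k%:R)) * gam z.
Proof.
move=> z0; elim: n => [|n IH]; first by rewrite big_nat1 addr0 gamS.
rewrite -natr1 addrA gamS; last by rewrite cReD addr_gt0// cRe_nat ltr0n.
by rewrite IH mulrA; congr (_ * _); rewrite [RHS]big_nat_recr//= mulrC.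
Qed.

End GammaIntegral.

(** * Gauss's product is the reciprocal of Euler's integral *)

Section GammaGauss.
Context {R : realType}.
Notation mu := (@lebesgue_measure R).
Notation D := (`]0%R, +oo[%classic : set R).
Implicit Types (w z s : R[i]) (x y k : R).

Lemma ccont_comp (h : R -> R) (F : R -> R[i]) x : {for x, continuous h} ->
  ccont F (h x) -> ccont (fun r => F (h r)) x.
Proof. by move=> ch cF; exact: (cvg_comp _ _ ch cF). Qed.

(** The difference is the integral of z t^(z-1) between 1 and x. For Re z >= 1 the power is at most
    1 + t^N, so the bound is |x - 1| times a polynomial, whose mean reduces to explicit moments. *)
Lemma cabs_cpow_sub1 z N x : 0 < x -> 1 <= complex.Re z -> complex.Re z - 1 <= N%:R ->
  cabs (cpow x z - 1) <= 2 * (cabs z * `|x - 1| * (2 + x ^+ N)).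
Proof.
move=> x0 z1 zN.
have key a b : 0 < a -> a < b ->
    cabs (cpow b z - cpow a z) <= 2 * (cabs z * (b - a) * (1 + b ^+ N)).
  move=> a0 ab; have b0 : 0 < b by exact: lt_trans ab.
  have pos t : a <= t <= b -> 0 < t by move=> /andP[h _]; exact: lt_le_trans h.
  have ct t : a <= t <= b -> ccont (fun r => z * cpow r (z - 1)) t.
    by move=> /pos t0; apply: ccontM; [exact: ccont_cst|exact: ccont_cpow].
  rewrite -(cint_FTC (F := fun r => cpow r z) ab ct); last first.
    by move=> t /pos t0; exact: cderiv_cpow.
  apply: le_trans (cabs_cint_le (h := fun=> cabs z * (1 + b ^+ N)) _ _ _ _) _.
  - exact: measurable_itv.
  - exact: cintegrable_ccont.
  - by apply: integrable_continuous_itv => t _; exact: cvg_cst.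
  - move=> t /=; rewrite in_itv /= => tab; have t0 := pos _ tab.
    rewrite cabsM ler_wpM2l ?cabs_ge0// cabs_cpow// cReB /=.
    have [t1|t1] := leP t 1.
      apply: (@le_trans _ _ 1); last by rewrite lerDl exprn_ge0// ltW.
      by rewrite -[leRHS](powRr0 t); apply: ger_powR; rewrite ?t0 ?t1// subr_ge0.
    apply: (@le_trans _ _ (t ^+ N)).
      by rewrite -powR_mulrn ?(ltW t0)//; apply: ler_powR => //; exact: ltW.
    apply: (@le_trans _ _ (b ^+ N)); last by rewrite lerDr.
    by case/andP : tab => _ tb; apply: lerXn2r => //; rewrite nnegrE ltW.
  rewrite Rintegral_cst//= lebesgue_measure_itv/= lte_fin ab /=.
  by rewrite ler_wpM2l// mulrAC.
have [x1|x1|->] := ltgtP x 1.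
- have := key _ _ x0 x1; rewrite cpow1s expr1n => H.
  rewrite -cabsN opprB; apply: le_trans H _; rewrite ler_wpM2l// distrC.
  rewrite ger0_norm ?subr_ge0 ?(ltW x1)// ler_wpM2l ?mulr_ge0 ?cabs_ge0 ?subr_ge0 ?(ltW x1)//.
  by rewrite -natr1 lerDl exprn_ge0// ltW.
- have := key _ _ ltr01 x1; rewrite cpow1s ger0_norm ?subr_ge0 ?(ltW x1)// => H.
  apply: le_trans H _; rewrite ler_wpM2l// ler_wpM2l ?mulr_ge0 ?cabs_ge0 ?subr_ge0 ?(ltW x1)//.
  by rewrite lerD2r ler1n.
- by rewrite cpow1s !subrr cabs0 normr0 mulr0 mul0r mulr0.
Qed.

Lemma Rint_sum (I : Type) (s : seq I) (F : I -> R -> R) :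
  (forall i, mu.-integrable D (EFin \o F i)) ->
  mu.-integrable D (EFin \o (fun x => \sum_(i <- s) F i x)) /\
  \int[mu]_(x in D) (\sum_(i <- s) F i x) = \sum_(i <- s) \int[mu]_(x in D) F i x.
Proof.
move=> iF; elim: s => [|i s [IH1 IH2]].
  have E : (fun x : R => \sum_(i <- [::]) F i x) = (fun=> 0).
    by apply/funext => x; rewrite big_nil.
  rewrite E big_nil; split; first exact: integrable0.
  by rewrite /Rintegral integral0.
have E : (fun x : R => \sum_(j <- i :: s) F j x) = (fun x => F i x + \sum_(j <- s) F j x).
  by apply/funext => x; rewrite big_cons.
rewrite E big_cons; split.
  have := integrableD half_line_measurable (iF i) IH1.
  by apply: eq_integrable => //; exact: half_line_measurable.
by rewrite RintegralD// ?IH2//; exact: half_line_measurable.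
Qed.

(** Up to the factor 2/n!, a probability density in r, peaked where r^2 is close to n. The factor
    [1 *] matches [gint _ 1]. *)
Definition gwt (n : nat) (r : R) : R := r ^+ (2 * n).+1 * expR (- (1 * r ^+ 2)).

Lemma gwtE n (r : R) : 0 < r ->
  cpow r (2 * n.+1%:R - 1) * (expR (- (1 * r ^+ 2)))%:C = (gwt n r)%:C.
Proof.
move=> r0; rewrite (_ : 2 * n.+1%:R - 1 = (2 * n).+1%:R :> R[i]); last first.
  by rewrite -(natr1 n) -(natr1 (2 * n)) natrM; ring.
by rewrite cpow_nat// /gwt rmorphM/= rmorphXn.
Qed.

Lemma gwt_integrable n : mu.-integrable D (EFin \o gwt n).
Proof.
have [|H _] := @gint_integrable R n.+1%:R 1 _ ltr01; first by rewrite cRe_nat.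
apply: eq_integrable H => //.
by move=> r /set_mem /half_lineP r0; rewrite /= gwtE.
Qed.

Lemma gwt_int n : 2 * \int[mu]_(r in D) gwt n r = n`!%:R.
Proof.
apply: (@complexI R); rewrite rmorphM/= natC natC -gam_nat /gam; congr (_ * _).
rewrite -cint_real; last exact: gwt_integrable.
by apply: eq_cint => r /set_mem /half_lineP r0; rewrite gwtE.
Qed.

(** The k-th moment of r^2/n for the normalised density [gwt n], that is (n+1)...(n+k)/n^k. *)
Definition gmom (k n : nat) : R := (n + k)`!%:R / (n`!%:R * n%:R ^+ k).

Lemma gmom_cvg (k : nat) : gmom k n.+1 @[n --> \oo] --> (1 : R).
Proof.
elim: k => [|k IH].
  rewrite (_ : (fun n => _) = fun=> 1); first exact: cvg_cst.
  by apply/funext => n; rewrite /gmom addn0 expr0 mulr1 divff// pnatr_eq0 -lt0n fact_gt0.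
have -> : (fun n => gmom k.+1 n.+1) =
    (fun n => gmom k n.+1 * (1 + k.+1%:R * n.+1%:R^-1)).
  apply/funext => n; rewrite /gmom addnS factS natrM exprS.
  have f0 : (n.+1`!)%:R != 0 :> R by rewrite pnatr_eq0 -lt0n fact_gt0.
  have m0 : n.+1%:R != 0 :> R by rewrite pnatr_eq0.
  have mk0 : n.+1%:R ^+ k != 0 :> R by rewrite expf_neq0.
  have -> : ((n.+1 + k).+1)%:R = n.+1%:R + k.+1%:R :> R by rewrite -natrD addnS.
  clear mk0; move: n.+1%:R m0 (n.+1`!)%:R f0 => m m0 f f0.
  by field; rewrite m0 f0 expf_neq0.
rewrite -[X in _ --> X]mulr1; apply: cvgM => //.
rewrite -[X in _ --> X]addr0; apply: cvgD; first exact: cvg_cst.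
rewrite -(mulr0 k.+1%:R); apply: cvgM; first exact: cvg_cst.
exact: cvg_exh_left.
Qed.

Lemma gwt_poly n (p : {poly R}) :
  mu.-integrable D (EFin \o (fun r => gwt n.+1 r * p.[r ^+ 2 / n.+1%:R])) /\
  2 * \int[mu]_(r in D) (gwt n.+1 r * p.[r ^+ 2 / n.+1%:R]) =
  n.+1`!%:R * \sum_(i < size p) p`_i * gmom i n.+1.
Proof.
have m0 : n.+1%:R != 0 :> R by rewrite pnatr_eq0.
have E : (fun r => gwt n.+1 r * p.[r ^+ 2 / n.+1%:R]) =
    (fun r => \sum_(i < size p) (p`_i / n.+1%:R ^+ i) * gwt (n.+1 + i) r).
  apply/funext => r; rewrite horner_coef mulr_sumr; apply: eq_bigr => i _.
  have -> : gwt (n.+1 + i) r = gwt n.+1 r * (r ^+ 2) ^+ i.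
    by rewrite /gwt mulnDr -addSn exprD exprM; ring.
  by rewrite exprMn exprVn; ring.
have iE (i : 'I_(size p)) : mu.-integrable D
    (EFin \o (fun r => (p`_i / n.+1%:R ^+ i) * gwt (n.+1 + i) r)).
  have := integrableZl half_line_measurable (p`_i / n.+1%:R ^+ i) (gwt_integrable (n.+1 + i)).
  by apply: eq_integrable => //; exact: half_line_measurable.
have [i1 i2] := Rint_sum (index_enum 'I_(size p)) iE.
rewrite E; split => //; rewrite i2 !mulr_sumr; apply: eq_bigr => i _.
rewrite RintegralZl//; last exact: gwt_integrable.
rewrite mulrCA gwt_int /gmom.
have f0 : (n.+1`!)%:R != 0 :> R by rewrite pnatr_eq0 -lt0n fact_gt0.
have mk0 : n.+1%:R ^+ i != 0 :> R by rewrite expf_neq0.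
clear mk0; move: n.+1%:R m0 (n.+1`!)%:R f0 ((n.+1 + i)`!)%:R => m m0 f f0 g.
have c0 : m ^+ i != 0 by rewrite expf_neq0.
by move: (m ^+ i) c0 (p`_i) => c c0 q; field; rewrite f0 c0.
Qed.

(* Gauss's product times Gamma(z) is the mean of (r^2/n)^z for the density gwt,
   which concentrates where r^2/n is near 1. *)
Lemma gam_ratio z n : 0 < complex.Re z ->
  gauss_prod z n.+1 * gam z - 1 = 2 / n.+1`!%:R *
   cintegral mu D (fun r => (gwt n.+1 r)%:C * (cpow (r ^+ 2 / n.+1%:R) z - 1)).
Proof.
move=> z0; have m0 : (0 : R) < n.+1%:R by [].
have f0 : (n.+1`!)%:R != 0 :> R[i] by rewrite pnatr_eq0 -lt0n fact_gt0.
have c0 := cpow_neq0 z m0.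
have zn : 0 < complex.Re (z + n.+2%:R) by rewrite cReD addr_gt0// cRe_nat.
have E r : 0 < r -> (gwt n.+1 r)%:C * (cpow (r ^+ 2 / n.+1%:R) z - 1) =
    (cpow n.+1%:R z)^-1 * (cpow r (2 * (z + n.+2%:R) - 1) * (expR (- (1 * r ^+ 2)))%:C)
    + (- 1) * (gwt n.+1 r)%:C.
  move=> r0; rewrite mulrBr mulr1 mulN1r; congr (_ - _).
  rewrite cpowM ?exprn_gt0 ?invr_gt0// cpow_exp// cpowV// cpowN//.
  have -> : 2 * (z + n.+2%:R) - 1 = 2 * z + (2 * n.+2%:R - 1) by ring.
  rewrite (cpowD (2 * z) _ r0) -mulrA (gwtE n.+1 r0).
  by rewrite (mulrC (cpow r _)) mulrCA (mulrC (gwt _ _)%:C).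
have i1 := gint_integrable zn (@ltr01 R).
have i2 : cintegrable mu D (fun r => (gwt n.+1 r)%:C).
  by split; [exact: gwt_integrable|exact: integrable0].
have -> : cintegral mu D (fun r => (gwt n.+1 r)%:C * (cpow (r ^+ 2 / n.+1%:R) z - 1)) =
    (cpow n.+1%:R z)^-1 * gint (z + n.+2%:R) 1 - (n.+1`!)%:R / 2.
  transitivity (cintegral mu D (fun r => (cpow n.+1%:R z)^-1 *
    (cpow r (2 * (z + n.+2%:R) - 1) * (expR (- (1 * r ^+ 2)))%:C)
    + (- 1) * (gwt n.+1 r)%:C)).
    by apply: eq_cint => r /set_mem /half_lineP r0; rewrite E.
  rewrite cintD; do ?[exact: half_line_measurable|
    by apply: cintegrableZ => //; exact: half_line_measurable].
  rewrite !cintZ//; do ?exact: half_line_measurable.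
  rewrite mulN1r; congr (_ - _); rewrite cint_real; last exact: gwt_integrable.
  rewrite -(natC (n.+1)`!) -(natC 2) -fmorphV -rmorphM -gwt_int; congr (_%:C).
  by rewrite mulrAC divff ?mul1r// pnatr_eq0.
have E2 : gauss_prod z n.+1 * gam z = 2 * gint (z + n.+2%:R) 1 /
    ((n.+1)`!%:R * cpow n.+1%:R z).
  by rewrite /gauss_prod mulrAC -gamD.
rewrite E2; move: (gint _ _) (cpow _ _) c0 (n.+1`!)%:R f0 => g c c0 f f0.
by field; rewrite c0 f0.
Qed.

Lemma gam_rGamma_ge1 z : 1 <= complex.Re z -> rGamma z * gam z = 1.
Proof.
move=> z1; have z0 : 0 < complex.Re z by exact: lt_le_trans z1.
pose N := Num.bound (complex.Re z - 1).
have zN : complex.Re z - 1 <= N%:R.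
  by apply: ltW; apply: archi_boundP; rewrite subr_ge0.
(* The inequality |y - 1| <= e + (y - 1)^2 / e replaces the absolute value in [cabs_cpow_sub1] by a
   polynomial. All moments tend to 1, so the mean of [p e] tends to its value at 1, which is 6 |z|
   e. *)
pose p (e : R) : {poly R} := (2 * cabs z)%:P *
  (e%:P + (e^-1)%:P * ('X - 1%:P) ^+ 2) * (2%:P + 'X^N).
have pE e x : (p e).[x] = 2 * cabs z * (e + e^-1 * (x - 1) ^+ 2) * (2 + x ^+ N).
  by rewrite !hornerE.
have bound e n : 0 < e -> cabs (gauss_prod z n.+1 * gam z - 1) <=
    2 * \sum_(i < size (p e)) (p e)`_i * gmom i n.+1.
  move=> e0; rewrite gam_ratio//.
  have f0 : (0 : R) < (n.+1`!)%:R by rewrite ltr0n fact_gt0.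
  have [pi1 pi2] := gwt_poly n (p e).
  have gp x : 0 < x -> 0 <= gwt n.+1 x.
    by move=> x0; rewrite /gwt mulr_ge0 ?expR_ge0// exprn_ge0// ltW.
  have bd x : 0 < x -> cabs ((gwt n.+1 x)%:C * (cpow (x ^+ 2 / n.+1%:R) z - 1)) <=
      gwt n.+1 x * (p e).[x ^+ 2 / n.+1%:R].
    move=> x0; rewrite cabsM cabs_real ger0_norm ?gp// ler_wpM2l ?gp//.
    set y := x ^+ 2 / n.+1%:R; have y0 : 0 < y by rewrite divr_gt0 ?exprn_gt0.
    apply: le_trans (cabs_cpow_sub1 y0 z1 zN) _; rewrite pE 2!(mulrA 2).
    rewrite ler_wpM2r ?addr_ge0 ?exprn_ge0 ?(ltW y0)//.
    rewrite ler_wpM2l ?mulr_ge0 ?cabs_ge0//.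
    have e2 := mulVf (lt0r_neq0 e0); have eV : 0 < e^-1 by rewrite invr_gt0.
    rewrite -[(y - 1) ^+ 2]real_normK ?num_real//.
    move: (`|y - 1|) (normr_ge0 (y - 1)) => t t0.
    have [te|te] := leP t e; first by apply: le_trans te _; rewrite lerDl mulr_ge0 ?sqr_ge0 ?(ltW eV).
    apply: (@le_trans _ _ (e^-1 * t ^+ 2)); last by rewrite lerDr ltW.
    by rewrite expr2 mulrA ler_peMl// mulrC ler_pdivlMr// mul1r ltW.
  rewrite cabsM cabsM (cabs_nat 2) cabsV cabs_nat.
  rewrite -ler_pdivlMl; last by rewrite divr_gt0.
  apply: le_trans (cabs_cint_le half_line_measurable _ pi1 _) _.
  - apply: (cintegrable_le half_line_measurable _ pi1).
      apply: cmeas_half_line => x x0; apply: ccontM.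
        apply: ccont_real; apply: continuousM; first exact: exprn_continuous.
        exact: expRN_sqr_continuous.
      apply: ccontD; last exact: ccont_cst.
      have y0 : 0 < x ^+ 2 / n.+1%:R by rewrite divr_gt0 ?exprn_gt0.
      apply: (@ccont_comp _ (fun r => cpow r z)); last exact: ccont_cpow.
      by apply: cvgM; [exact: exprn_continuous|exact: cvg_cst].
    by move=> x /half_lineP; exact: bd.
  - by move=> x /half_lineP; exact: bd.
  by rewrite pi2 invf_div mulrA divfK ?pnatr_eq0.
have lim_bound e : 0 < e ->
    (2 * \sum_(i < size (p e)) (p e)`_i * gmom i n.+1) @[n --> \oo] --> 2 * (p e).[1].
  move=> e0; apply: cvgM; first exact: cvg_cst.
  rewrite horner_coef; under [X in _ --> X]eq_bigr do rewrite expr1n.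
  apply: cvg_big => [|i _]; first exact: add_continuous.
  apply: cvgM; first exact: cvg_cst.
  exact: gmom_cvg.
have H1 : (gauss_prod z n.+1 * gam z : R[i]^o) @[n --> \oo] --> (1 : R[i]^o).
  apply/ccvgP/cvgr0Pnorm_lt => e e0.
  pose a := cabs z; have a0 : 0 <= a by exact: cabs_ge0.
  (* The limit of the bound is 12 a d for d = e / (24 (a + 1)), hence below e; the [+ 1] covers a =
     0. *)
  have a1 : 0 < 24 * (a + 1) by rewrite mulr_gt0// ltr_wpDl.
  have d0 : 0 < e / (24 * (a + 1)) by rewrite divr_gt0.
  have := lim_bound _ d0; rewrite pE subrr expr0n mulr0 addr0 expr1n => L.
  have Le : 2 * (2 * cabs z * (e / (24 * (a + 1))) * (2 + 1)) < e.
    have -> : 2 * (2 * cabs z * (e / (24 * (a + 1))) * (2 + 1)) =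
      e * (12 * a / (24 * (a + 1))) by rewrite /a; ring.
    rewrite gtr_pMr// ltr_pdivrMr// mul1r; lra.
  apply: filterS (cvgr_lt _ L _ Le) => n Ln.
  by rewrite ger0_norm ?cabs_ge0//; apply: le_lt_trans (bound _ _ d0) Ln.
have H2 : (gauss_prod z n.+1 * gam z : R[i]^o) @[n --> \oo] --> (rGamma z * gam z : R[i]^o).
  apply: cvgM; last exact: cvg_cst.
  by rewrite (cvg_shiftS (fun n => gauss_prod z n : R[i]^o)); exact: rGamma_cvg.
exact: (cvg_unique (@norm_hausdorff _ _) H2 H1).
Qed.

(** One step of the functional equations of both factors leads to the range Re z >= 1. *)
Lemma gam_rGamma z : 0 < complex.Re z -> rGamma z * gam z = 1.
Proof.
move=> z0; rewrite rGammaS mulrAC -gamS// mulrC gam_rGamma_ge1//.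
by rewrite cReD lerDr ltW.
Qed.

End GammaGauss.

(** * The reflection formula *)

Section Reflection.
Context {R : realType}.
Notation mu := (@lebesgue_measure R).
Implicit Types (w z s : R[i]) (x y t : R).

Notation hp := (pi / 2 : R).
Notation seg := (`[- hp, hp]%classic : set R).

(* cosint n w / cosint n 0 obeys a two-step recursion in n, which multiplies the
   factors of the product of sin, and tends to 1: hence the reflection formula. *)
Definition cosint (n : nat) w : R[i] :=
  cintegral mu seg (fun t => ((cos t) ^+ n)%:C * cexp (t%:C * w)).

Let hp0 : 0 < hp. Proof. by rewrite divr_gt0 ?pi_gt0. Qed.
Let hpN : - hp < hp. Proof. by rewrite gtrN. Qed.

Let is_derive_cosX (n : nat) t :
  is_derive t 1 (fun t : R => cos t ^+ n.+1) (- (n.+1%:R * cos t ^+ n * sin t)).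
Proof.
elim: n => [|n IH].
  rewrite expr0 mul1r mul1r; apply: is_derive_eq (is_derive_cos t) _.
  by [].
have := is_derive_mul (is_derive_cos t) IH.
under [X in is_derive _ _ X _ -> _]eq_fun do rewrite -exprS.
by move=> H; apply: is_derive_eq H _; rewrite -(natr1 n.+1) !exprS; ring.
Qed.

Let cosX_continuous n t : {for t, continuous (fun t : R => cos t ^+ n)}.
Proof.
apply: (@continuous_comp _ _ _ (@cos R) (fun x : R => x ^+ n)).
  exact: continuous_cos.
exact: exprn_continuous.
Qed.

Let ccont_cosint n w t : ccont (fun t : R => ((cos t) ^+ n)%:C * cexp (t%:C * w)) t.
Proof.
apply: ccontM; last exact: ccont_cexp_line.
by apply: ccont_real; exact: cosX_continuous.
Qed.

Let cosint_integrable n w : cintegrable mu seg (fun t => ((cos t) ^+ n)%:C * cexp (t%:C * w)).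
Proof. by apply: cintegrable_ccont => t _; exact: ccont_cosint. Qed.

Let mseg : measurable (seg : set (measurableTypeR R)).
Proof. exact: measurable_itv. Qed.

Lemma cosint_rec n w : ((n.+2%:R) ^+ 2 + w ^+ 2) * cosint n.+2 w =
  n.+2%:R * n.+1%:R * cosint n w.
Proof.
(* A primitive of [f], as obtained by integrating twice by parts; each term keeps a factor cos t, so
   [F] vanishes at both ends. *)
pose F t : R[i] := w * ((cos t ^+ n.+2)%:C * cexp (t%:C * w)) +
  n.+2%:R * ((cos t ^+ n.+1 * sin t)%:C * cexp (t%:C * w)).
pose f t : R[i] := ((n.+2%:R) ^+ 2 + w ^+ 2) * ((cos t ^+ n.+2)%:C * cexp (t%:C * w)) +
  - (n.+2%:R * n.+1%:R) * ((cos t ^+ n)%:C * cexp (t%:C * w)).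
have dF t : cderiv F t (f t).
  have d1 := cderivM (cderiv_real (is_derive_cosX n.+1 t)) (cderiv_cexp_line w t).
  have d2 := cderivM (cderiv_real (is_derive_mul (is_derive_cosX n t) (is_derive_sin t)))
     (cderiv_cexp_line w t).
  have := cderivD (cderivZ w d1) (cderivZ n.+2%:R d2).
  congr (cderiv _ _ _); rewrite /f.
  have sc : ((sin t)%:C : R[i]) ^+ 2 = 1 - (cos t)%:C ^+ 2.
    by rewrite -!rmorphXn/= sin2cos2 rmorphB/=.
  rewrite !(rmorphD, rmorphN, rmorphM, rmorphXn)/= !natC.
  move: (cexp _) (sin t)%:C (cos t)%:C sc => e S C sc.
  rewrite !exprS -(natr1 n.+1).
  have -> : S * - (n.+1%:R * C ^+ n * S) = - (n.+1%:R * C ^+ n * S ^+ 2) by ring.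
  by rewrite sc; ring.
have H := @cint_FTC _ F f _ _ hpN _ (fun t _ => dF t).
have c2 : cos (- hp) = 0 by rewrite cosN cos_pihalf.
have Fb : F hp - F (- hp) = 0.
  by rewrite /F !c2 !cos_pihalf !expr0n /= !mul0r !mulr0 addr0 subrr.
have : cintegral mu seg f = 0.
  rewrite H ?Fb// => t _; apply: ccontD; apply: ccontM; try exact: ccont_cst;
    exact: ccont_cosint.
rewrite /f cintD; try exact: mseg; try by apply: cintegrableZ; [exact: mseg|exact: cosint_integrable].
rewrite !cintZ; try exact: mseg; try exact: cosint_integrable.
by move/eqP; rewrite mulNr subr_eq0 => /eqP.
Qed.

Lemma cosint0 w : w != 0 -> cosint 0 w = (cexp (hp%:C * w) - cexp (- (hp%:C * w))) / w.
Proof.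
move=> w0; have H := @cint_FTC _ (fun t => w^-1 * cexp (t%:C * w)) (fun t => w^-1 * (w * cexp (t%:C * w)))
  _ _ hpN _ (fun t _ => cderivZ w^-1 (cderiv_cexp_line w t)).
transitivity (cintegral mu seg (fun t => w^-1 * (w * cexp (t%:C * w)))).
  by apply: eq_cint => t _; rewrite expr0 mul1r mulKf.
rewrite H; first by rewrite rmorphN mulNr -mulrBr mulrC.
move=> t _; apply: ccontM; first exact: ccont_cst.
by apply: ccontM; [exact: ccont_cst|exact: ccont_cexp_line].
Qed.

(** Wallis's integrals, the values of [cosint] at [w = 0]; they normalise [cosint]. *)
Definition cosm n : R := \int[mu]_(t in seg) (cos t ^+ n).

Let cosm_integrable n : mu.-integrable seg (EFin \o (fun t => cos t ^+ n)).
Proof.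
by apply: integrable_continuous_itv => t _; exact: cosX_continuous.
Qed.

Let cosint_0 n : cosint n 0 = (cosm n)%:C.
Proof.
rewrite -cint_real; last exact: cosm_integrable.
by apply: eq_cint => t _; rewrite mulr0 cexp0 mulr1.
Qed.

Let cosm_rec n : n.+2%:R * cosm n.+2 = n.+1%:R * cosm n.
Proof.
have := cosint_rec n 0; rewrite expr0n addr0 !cosint_0 expr2 -!mulrA.
move/(mulfI _) => H; apply: (@complexI R); rewrite !rmorphM/= !natC.
by apply: H; rewrite pnatr_eq0.
Qed.

Let cosm_gt0 m : 0 < cosm (2 * m).
Proof.
elim: m => [|m IH].
  rewrite /cosm muln0; under eq_Rintegral do rewrite expr0.
  rewrite Rintegral_cst//= lebesgue_measure_itv/= lte_fin hpN /=.
  by rewrite mul1r opprK -splitr pi_gt0.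
have := cosm_rec (2 * m); rewrite mulnS => H.
have : 0 < (2 * m).+2%:R * cosm (2 * m).+2 by rewrite H mulr_gt0.
by rewrite pmulr_rgt0.
Qed.

Let cosm0 : cosm 0 = pi.
Proof.
rewrite /cosm; under eq_Rintegral do rewrite expr0.
rewrite Rintegral_cst//= lebesgue_measure_itv/= lte_fin hpN /=.
by rewrite mul1r opprK -splitr.
Qed.

(** The difference of the two sides has derivative t sin t. *)
Let tcos_sin t : 0 <= t <= hp -> t * cos t <= sin t.
Proof.
move=> /andP[]; rewrite le_eqVlt => /orP[/eqP <-|t0 th]; first by rewrite mul0r sin0.
have dF x : is_derive x 1 (fun y : R => sin y - y * cos y) (x * sin x).
  have dd := is_deriveB (is_derive_sin x) (is_derive_mul (is_derive_id x (1:R)) (is_derive_cos x)).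
  by apply: is_derive_eq dd _ => /=; ring.
have cf x : 0 <= x <= t -> {for x, continuous (fun y : R => y * sin y)}.
  by move=> _; apply: continuousM; [exact: cvg_id|exact: continuous_sin].
have := Rint_FTC t0 cf (fun x _ => dF x).
rewrite sin0 mul0r subr0 subr0 => E.
rewrite -subr_ge0 -E; apply: Rintegral_ge0 => x /=; rewrite in_itv /= => /andP[x0 xt].
rewrite mulr_ge0// sin_ge0_pi// x0 (le_trans xt)// (le_trans th)//.
by rewrite ler_pdivrMr// ler_peMr ?pi_ge0// ler1n.
Qed.

(** Multiplied by cos^(2m), it bounds the second moment of t for the weight cos^(2m+2) by a
    difference of two Wallis integrals. *)
Let tcos_sin2 t : - hp <= t <= hp -> t ^+ 2 * cos t ^+ 2 <= 1 - cos t ^+ 2.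
Proof.
move=> th; rewrite -sin2cos2.
wlog t0 : t th / 0 <= t.
  move=> W; have [t0|t0] := leP 0 t; first exact: W.
  have := W (- t); rewrite cosN sinN !sqrrN; apply.
    by move: th; rewrite lerN2 lerNl => /andP[-> ->].
  by rewrite oppr_ge0 ltW.
rewrite -exprMn; apply: lerXn2r; rewrite ?nnegrE.
- by rewrite mulr_ge0// cos_ge0_pihalf.
- apply: sin_ge0_pi; rewrite t0 /=; case/andP : th => _ /le_trans; apply.
  by rewrite ler_pdivrMr// ler_peMr ?pi_ge0// ler1n.
- by apply: tcos_sin; rewrite t0; case/andP : th.
Qed.

(** The normalised weight cos^(2m) concentrates at 0. The deviation of e^(tw) from 1 is at most C
    |t| <= C (e + t^2/e), and the mean of t^2 is at most 1/(2m+1) by [tcos_sin2] and the recursion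
    of [cosm]. *)
Let cosm_cvg w : ((cosm (2 * m))%:C^-1 * cosint (2 * m) w : R[i]^o) @[m --> \oo] -->
  (1 : R[i]^o).
Proof.
pose C := 2 * (cabs w * expR (2 * cabs w)).
have C0 : 0 <= C by rewrite !mulr_ge0 ?cabs_ge0 ?expR_ge0.
have bound e m : 0 < e -> cabs ((cosm (2 * m.+1))%:C^-1 * cosint (2 * m.+1) w - 1) <=
    2 * (C * (e + e^-1 * (2 * m).+1%:R^-1)).
  move=> e0; have c0 := cosm_gt0 m.+1.
  have c0' : (cosm (2 * m.+1))%:C != 0 :> R[i].
    by rewrite -cabs_eq0 cabs_real normr_eq0 gt_eqF.
  have E : (cosm (2 * m.+1))%:C^-1 * cosint (2 * m.+1) w - 1 =
     (cosm (2 * m.+1))%:C^-1 * cintegral mu seg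
       (fun t => (cos t ^+ (2 * m.+1))%:C * (cexp (t%:C * w) - 1)).
    rewrite -[X in _ - X](mulVf c0') -mulrBr -cosint_0 /cosint -cintB; first last.
    - exact: cosint_integrable.
    - exact: cosint_integrable.
    - exact: mseg.
    by congr (_ * _); apply: eq_cint => t _; rewrite mulr0 cexp0 -mulrBr.
  pose h t := C * e * cos t ^+ (2 * m.+1) +
    C * e^-1 * (cos t ^+ (2 * m) - cos t ^+ (2 * m.+1)).
  have iZ (k : R) g : mu.-integrable seg (EFin \o g) ->
      mu.-integrable seg (EFin \o (fun t => k * g t)).
    by move=> gi; exact: (integrableZl mseg k gi).
  have ihd : mu.-integrable seg (EFin \o (fun t => cos t ^+ (2 * m) - cos t ^+ (2 * m.+1))).
    exact: (integrableB mseg (cosm_integrable _) (cosm_integrable _)).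
  have ih : mu.-integrable seg (EFin \o h).
    exact: (integrableD mseg (iZ _ _ (cosm_integrable _)) (iZ _ _ ihd)).
  have hE : \int[mu]_(t in seg) h t = C * e * cosm (2 * m.+1) +
      C * e^-1 * (cosm (2 * m) - cosm (2 * m.+1)).
    rewrite /h RintegralD//; [|exact: iZ (cosm_integrable _)|exact: iZ ihd].
    rewrite !RintegralZl//; try exact: cosm_integrable.
    by rewrite RintegralB//; exact: cosm_integrable.
  have cd : cosm (2 * m) - cosm (2 * m.+1) = cosm (2 * m.+1) / (2 * m).+1%:R.
    have := cosm_rec (2 * m); rewrite mulnS => H.
    have -> : cosm (2 * m) = ((2 * m).+2%:R * cosm (2 + 2 * m)) / (2 * m).+1%:R.
      by rewrite H mulrAC divff ?mul1r// pnatr_eq0.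
    rewrite -(natr1 (2 * m).+1); field.
    by rewrite -(natrM _ 2 m) nat1r pnatr_eq0.
  rewrite E cabsM cabsV cabs_real gtr0_norm//.
  rewrite mulrC ler_pdivrMr//.
  have -> : 2 * (C * (e + e^-1 * (2 * m).+1%:R^-1)) * cosm (2 * m.+1) =
      2 * \int[mu]_(t in seg) h t.
    by rewrite hE cd; ring.
  apply: (cabs_cint_le mseg) => //.
    apply: cintegrable_ccont => t _; apply: ccontM.
      by apply: ccont_real; exact: cosX_continuous.
    by apply: ccontD; [exact: ccont_cexp_line|exact: ccont_cst].
  move=> t /=; rewrite in_itv /= => th.
  have [_ h2] := andP (@pihalf_02 R).
  have t2 : `|t| <= 2.
    by rewrite ler_norml; case/andP : th => a b; apply/andP; split; lra.
  have x2 : 0 <= cos t ^+ (2 * m) by rewrite exprM exprn_ge0// sqr_ge0.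
  rewrite cabsM cabs_real ger0_norm; last by rewrite exprM exprn_ge0// sqr_ge0.
  have b1 : cabs (cexp (t%:C * w) - 1) <= C * `|t|.
    apply: le_trans (cabs_cexp_sub1 _) _; rewrite cabsM cabs_real /C.
    have -> : 2 * (cabs w * expR (2 * cabs w)) * `|t| =
      2 * (`|t| * cabs w * expR (2 * cabs w)) by ring.
    rewrite ler_wpM2l// ler_wpM2l ?mulr_ge0 ?cabs_ge0// ler_expR.
    by rewrite ler_wpM2r ?cabs_ge0.
  have b2 : `|t| <= e + e^-1 * t ^+ 2.
    have e2 := mulVf (lt0r_neq0 e0); have eV : 0 < e^-1 by rewrite invr_gt0.
    rewrite -[t ^+ 2]real_normK ?num_real//.
    move: (`|t|) (normr_ge0 t) => x x0.
    have [xe|xe] := leP x e.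
      by apply: le_trans xe _; rewrite lerDl mulr_ge0 ?sqr_ge0 ?(ltW eV).
    apply: (@le_trans _ _ (e^-1 * x ^+ 2)); last by rewrite lerDr ltW.
    by rewrite expr2 mulrA ler_peMl// mulrC ler_pdivlMr// mul1r ltW.
  have b3 := tcos_sin2 th.
  rewrite /h mulnS exprD.
  set q := cos t ^+ (2 * m) in x2 *; set c2 := cos t ^+ 2 in b3 *.
  have c20 : 0 <= c2 by rewrite sqr_ge0.
  have qc : 0 <= c2 * q by rewrite mulr_ge0.
  apply: (@le_trans _ _ (c2 * q * (C * (e + e^-1 * t ^+ 2)))).
    rewrite ler_wpM2l//; apply: le_trans b1 _; by rewrite ler_wpM2l.
  have -> : c2 * q * (C * (e + e^-1 * t ^+ 2)) =
      C * e * (c2 * q) + C * e^-1 * (q * (t ^+ 2 * c2)) by ring.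
  rewrite lerD2l; apply: ler_wpM2l; first exact: (divr_ge0 C0 (ltW e0)).
  apply: (@le_trans _ _ (q * (1 - c2))); first by rewrite ler_wpM2l.
  by rewrite mulrBr mulr1 mulrC.
have lim e : (2 * (C * (e + e^-1 * (2 * m).+1%:R^-1))) @[m --> \oo] --> 2 * (C * e).
  apply: cvgM; first exact: cvg_cst.
  apply: cvgM; first exact: cvg_cst.
  rewrite -[X in _ --> X]addr0; apply: cvgD; first exact: cvg_cst.
  rewrite -(mulr0 e^-1); apply: cvgM; first exact: cvg_cst.
  apply: (@squeeze_cvgr _ _ _ _ (fun=> 0) (fun m => m.+1%:R^-1)); first 1 last.
  - exact: cvg_cst.
  - exact: cvg_exh_left.
  apply: nearW => m; rewrite invr_ge0 ler0n /= lef_pV2 ?posrE// ler_nat ltnS.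
  by rewrite leq_pmull.
rewrite -(cvg_shiftS (fun m => (cosm (2 * m))%:C^-1 * cosint (2 * m) w : R[i]^o)).
apply/ccvgP/cvgr0Pnorm_lt => e e0.
have C1 : 0 < 4 * (C + 1) by rewrite mulr_gt0// ltr_wpDl.
have d0 : 0 < e / (4 * (C + 1)) by rewrite divr_gt0.
have Le : 2 * (C * (e / (4 * (C + 1)))) < e.
  have -> : 2 * (C * (e / (4 * (C + 1)))) = e * (2 * C / (4 * (C + 1))) by ring.
  by rewrite gtr_pMr// ltr_pdivrMr// mul1r; lra.
apply: filterS (cvgr_lt _ (lim _) _ Le) => m Lm.
by rewrite ger0_norm ?cabs_ge0//; apply: le_lt_trans (bound _ _ d0) Lm.
Qed.

(** Pairing the factors j + z and j - z gives a partial product of the sine; the last pair is left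
    over and tends to 1. *)
Lemma gauss_prod_reflection z n : gauss_prod (1 + z) n.+1 * gauss_prod (1 - z) n.+1 =
  (\prod_(1 <= j < n.+2) (1 - z ^+ 2 / j%:R ^+ 2)) *
    (((n.+2%:R ^+ 2) - z ^+ 2) / n.+1%:R ^+ 2).
Proof.
have m0 : (0 : R) < n.+1%:R by [].
have m0' : n.+1%:R != 0 :> R[i] by rewrite pnatr_eq0.
have f0 : (n.+1`!)%:R != 0 :> R[i] by rewrite pnatr_eq0 -lt0n fact_gt0.
have P (k : nat) : \prod_(0 <= j < k) ((1 + z + j%:R) * (1 - z + j%:R)) =
    (k`!)%:R ^+ 2 * \prod_(1 <= j < k.+1) (1 - z ^+ 2 / j%:R ^+ 2).
  elim: k => [|k IH]; first by rewrite !big_geq// fact0 expr1n mulr1.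
  rewrite big_nat_recr//= IH [in RHS]big_nat_recr//= factS natrM.
  have k0 : k.+1%:R != 0 :> R[i] by rewrite pnatr_eq0.
  rewrite (addrAC 1 z) (addrAC 1 (- z)) nat1r; move: (\prod_(_ <= _ < _) _) (k`!)%:R k.+1%:R k0 => Q f k1 k0.
  by field.
rewrite /gauss_prod mulrACA -big_split/= P big_nat_recr//=.
rewrite factS natrM -invfM !cpowD// cpow1// natC cpowN//.
have c0 := cpow_neq0 z m0.
have m1 : n.+2%:R != 0 :> R[i] by rewrite pnatr_eq0.
rewrite big_nat_recr//=.
move: (\prod_(_ <= _ < _) _) (cpow _ _) c0 (n.+1`!)%:R f0 => Q c c0 f f0.
move: n.+1%:R m0' n.+2%:R m1 => a a0 b b0.
by field; rewrite a0 b0 c0 f0.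
Qed.

Lemma cvg_succ (u : nat -> R[i]) l : (u n : R[i]^o) @[n --> \oo] --> (l : R[i]^o) ->
  (u n.+1 : R[i]^o) @[n --> \oo] --> (l : R[i]^o).
Proof. by move=> ul; rewrite (cvg_shiftS (fun n => u n : R[i]^o)). Qed.

Lemma rGamma_reflection z : z != 0 ->
  rGamma (1 + z) * rGamma (1 - z) = csin (pi%:C * z) / (pi%:C * z).
Proof.
(* With w = 2iz the ends of the interval give e^(i pi z) and its inverse, and (2m+2)^2 + w^2 is 4
   ((m+1)^2 - z^2), a factor of the sine product. *)
move=> z0; pose w : R[i] := 2 * 'i%C * z.
have i0 : 'i%C != 0 :> R[i] by rewrite eq_complex /= oner_eq0 andbF.
have w0 : w != 0 by rewrite !mulf_neq0 ?pnatr_eq0.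
have pi0 : pi%:C != 0 :> R[i] by rewrite -cabs_eq0 cabs_real normr_eq0 gt_eqF ?pi_gt0.
have wE : w ^+ 2 = - 4 * z ^+ 2.
  have i2 : 'i%C ^+ 2 = -1 :> R[i] by exact: sqr_i.
  by rewrite /w !exprMn i2; ring.
have c0 m : (cosm (2 * m))%:C != 0 :> R[i].
  by rewrite -cabs_eq0 cabs_real normr_eq0 gt_eqF.
pose rho m := (cosm (2 * m))%:C^-1 * cosint (2 * m) w.
have S0 : rho 0 = csin (pi%:C * z) / (pi%:C * z).
  rewrite /rho muln0 cosm0 cosint0// /csin.
  have -> : hp%:C * w = 'i%C * (pi%:C * z).
    by rewrite /w rmorphM/= fmorphV/= natC; move: pi%:C 'i%C => p i; field.
  rewrite /w; move: pi%:C pi0 'i%C i0 (cexp _) (cexp _) => p p0 i i1 A B.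
  by field; rewrite i1 z0 p0.
have rho_prod m : rho 0 = (\prod_(1 <= j < m.+1) (1 - z ^+ 2 / j%:R ^+ 2)) * rho m.
  elim: m => [|m IH]; first by rewrite big_geq// mul1r.
  rewrite IH [in RHS]big_nat_recr//= -[RHS]mulrA; congr (_ * _); rewrite /rho.
  have H1 := cosint_rec (2 * m) w; have H2 := cosm_rec (2 * m).
  rewrite mulnS.
  have d0 := c0 m; have d1 := c0 m.+1; rewrite mulnS in d1.
  have n1 : (2 * m).+1%:R != 0 :> R[i] by rewrite pnatr_eq0.
  have n2 : (2 * m).+2%:R = 2 * m.+1%:R :> R[i] by rewrite -natrM mulnS.
  have k0 : m.+1%:R != 0 :> R[i] by rewrite pnatr_eq0.
  have {}H2 : (2 * m.+1%:R) * (cosm (2 * m).+2)%:C = (2 * m).+1%:R * (cosm (2 * m))%:C.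
    by rewrite -n2 -[in LHS]natC -[in RHS]natC -!rmorphM H2.
  rewrite wE n2 in H1.
  move: H1 H2 d0 d1 n1 k0.
  rewrite !add2n.
  move: (cosint _ _) (cosint _ _) (cosm _)%:C (cosm _)%:C (2 * m).+1%:R m.+1%:R.
  move=> B A b a c d H1 H2 d0 d1 n1 k0.
  have E1 : (1 - z ^+ 2 / d ^+ 2) * A = c * B / (2 * d).
    have d4 : 4 * d ^+ 2 != 0 by rewrite mulf_neq0 ?expf_neq0 ?pnatr_eq0.
    apply: (mulfI d4); have -> : 4 * d ^+ 2 * (c * B / (2 * d)) = 2 * d * c * B.
      by field.
    by rewrite -H1; field.
  have E2 : a = c * b / (2 * d).
    by rewrite -H2; field.
  by rewrite mulrCA E1 E2; field; rewrite k0 d0 n1.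
have H1 : (rho m : R[i]^o) @[m --> \oo] --> (1 : R[i]^o) by exact: cosm_cvg.
have V0 : ((n.+1%:R^-1 : R)%:C : R[i]^o) @[n --> \oo] --> (0 : R[i]^o).
  by apply/ccvg_ReIm; split => /=; [exact: cvg_exh_left|exact: cvg_cst].
pose t n : R[i] := (1 + (n.+1%:R^-1 : R)%:C) ^+ 2 - z ^+ 2 * ((n.+1%:R^-1 : R)%:C ^+ 2).
have H2 : (t n : R[i]^o) @[n --> \oo] --> (1 : R[i]^o).
  have -> : (1 : R[i]) = (1 + 0) * (1 + 0) - z ^+ 2 * (0 * 0).
    by rewrite mulr0 mulr0 subr0 addr0 mulr1.
  apply: cvgB; apply: cvgM; try exact: cvg_cst.
  - by apply: cvgD; [exact: cvg_cst|exact: V0].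
  - by apply: cvgD; [exact: cvg_cst|exact: V0].
  - by apply: cvgM; exact: V0.
have H3 : (rho 0 * t n : R[i]^o) @[n --> \oo] --> (rho 0 : R[i]^o).
  by rewrite -[X in _ --> X]mulr1; apply: cvgM; [exact: cvg_cst|exact: H2].
have G s : (gauss_prod s n.+1 : R[i]^o) @[n --> \oo] --> (rGamma s : R[i]^o).
  by rewrite (cvg_shiftS (fun n => gauss_prod s n : R[i]^o)); exact: rGamma_cvg.
have H4 : (gauss_prod (1 + z) n.+1 * gauss_prod (1 - z) n.+1 * rho n.+1 : R[i]^o)
    @[n --> \oo] --> (rGamma (1 + z) * rGamma (1 - z) : R[i]^o).
  rewrite -[X in _ --> X]mulr1; apply: cvgM; first by apply: cvgM; exact: G.
  exact: (@cvg_succ rho 1 H1).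
rewrite -S0; apply: (cvg_unique (@norm_hausdorff _ _) H4).
apply: cvg_trans H3; apply: near_eq_cvg; apply: nearW => n.
rewrite (rho_prod n.+1) gauss_prod_reflection /t.
have -> : (n.+1%:R^-1 : R)%:C = n.+1%:R^-1 by rewrite fmorphV/= natC.
have m0 : n.+1%:R != 0 :> R[i] by rewrite pnatr_eq0.
rewrite -(natr1 n.+1); move: (\prod_(_ <= _ < _) _) (rho _) n.+1%:R m0 => Q r m m0.
by field.
Qed.

End Reflection.

(** * Bessel functions of integer order *)

Section RealBessel.
Context {R : realType}.
Implicit Types (x y z t : R) (m n k : nat).

Definition bcoef m k : R := (-1) ^+ k / (k`!%:R * (k + m)`!%:R).

(** The Bessel-Clifford function at -x: J_m(z) is (z/2)^m times its value at x = z^2/4, and in this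
    variable differentiation only raises the order and changes the sign. *)
Definition bser m x : R := limn (pseries (bcoef m) x).

Definition Jn m z : R := (z / 2) ^+ m * bser m (z ^+ 2 / 4).

Lemma fact_ge1 n : (1 : R) <= n`!%:R.
Proof. by rewrite ler1n fact_gt0. Qed.

Lemma bcoef_le m k : `|bcoef m k| <= (k`!%:R)^-1.
Proof.
rewrite /bcoef normrM normrX normrN1 expr1n mul1r invfM normrM.
rewrite !ger0_norm ?invr_ge0//.
by rewrite ler_piMr ?invr_ge0// invf_le1 ?fact_ge1// (lt_le_trans ltr01) ?fact_ge1.
Qed.

Lemma bcoef_term_le m x k : `|bcoef m k * x ^+ k| <= exp_coeff `|x| k.
Proof.
by rewrite normrM normrX /exp_coeff /= mulrC ler_wpM2l// bcoef_le.
Qed.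

Lemma bser_cvg m x : cvgn (pseries (bcoef m) x).
Proof.
apply: normed_cvg; apply: (series_le_cvg _ _ (bcoef_term_le m x)) => //=.
- by move=> n; exact: exp_coeff_ge0.
- exact: is_cvg_series_exp_coeff.
Qed.

Lemma bser_le m x : `|bser m x| <= expR `|x|.
Proof.
have ca : cvgn (series (fun k => `|bcoef m k * x ^+ k|)).
  apply: (series_le_cvg _ _ (bcoef_term_le m x)) => //=.
  - by move=> n; exact: exp_coeff_ge0.
  - exact: is_cvg_series_exp_coeff.
apply: le_trans (lim_series_norm ca) _; apply: lim_series_le => //.
  exact: is_cvg_series_exp_coeff.
by move=> n; exact: bcoef_term_le.
Qed.

Lemma bcoef_diffs m : pseries_diffs (bcoef m) = - bcoef m.+1.
Proof.
apply/funext => k; rewrite /pseries_diffs /bcoef !fctE factS natrM exprS addSnnS.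
have f0 : (k`!)%:R != 0 :> R by rewrite pnatr_eq0 -lt0n fact_gt0.
have f1 : ((k + m.+1)`!)%:R != 0 :> R by rewrite pnatr_eq0 -lt0n fact_gt0.
have k0 : k.+1%:R != 0 :> R by rewrite pnatr_eq0.
move: (k`!)%:R f0 ((k + m.+1)`!)%:R f1 k.+1%:R k0 ((-1) ^+ k) => a a0 b b0 c c0 e.
by field; rewrite a0 b0 c0.
Qed.

Lemma pseriesN (f : nat -> R) x : pseries (- f) x = - pseries f x.
Proof.
apply/funext => n; transitivity (- \sum_(0 <= i < n) f i * x ^+ i); last by [].
by rewrite -sumrN; apply: eq_bigr => i _; exact: mulNr.
Qed.

Lemma pseries_lim_diffs m x : limn (pseries (pseries_diffs (bcoef m)) x) = - bser m.+1 x.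
Proof. by rewrite bcoef_diffs pseriesN; apply/cvg_lim => //; apply: cvgN; exact: bser_cvg. Qed.

Lemma bser_diffs_cvg m x : cvgn (pseries (pseries_diffs (bcoef m)) x).
Proof. by rewrite bcoef_diffs pseriesN; apply: is_cvgN; exact: bser_cvg. Qed.

Lemma is_derive_bser m x : is_derive x 1 (bser m) (- bser m.+1 x).
Proof.
rewrite -pseries_lim_diffs; apply: (@pseries_snd_diffs R (bcoef m) (`|x| + 1)).
- exact: bser_cvg.
- exact: bser_diffs_cvg.
- rewrite bcoef_diffs pseries_diffsN pseriesN; apply: is_cvgN.
  exact: bser_diffs_cvg.
- by rewrite [ltRHS]ger0_norm ?addr_ge0// ltrDl.
Qed.

Lemma bser_rec m x : bser m x = m.+1%:R * bser m.+1 x - x * bser m.+2 x.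
Proof.
have H := @pseries_diffs_equiv R (bcoef m.+1) x (@bser_diffs_cvg m.+1 x).
rewrite pseries_lim_diffs in H.
have H2 : (fun n => m.+1%:R * pseries (bcoef m.+1) x n +
     x * series (fun i => i%:R * bcoef m.+1 i * x ^+ i.-1) n) @ \oo -->
     m.+1%:R * bser m.+1 x + x * (- bser m.+2 x).
  apply: cvgD; apply: cvgM; try exact: cvg_cst; last exact: H.
  exact: bser_cvg.
rewrite mulrN in H2; rewrite -(cvg_lim _ H2)//; congr (limn _).
apply/funext => n; rewrite /pseries /series /= !mulr_sumr -big_split/=.
apply: eq_bigr => k _.
have -> : bcoef m k = (k + m.+1)%:R * bcoef m.+1 k.
  rewrite /bcoef addnS factS natrM.
  have f0 : (k`!)%:R != 0 :> R by rewrite pnatr_eq0 -lt0n fact_gt0.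
  have f1 : ((k + m)`!)%:R != 0 :> R by rewrite pnatr_eq0 -lt0n fact_gt0.
  have k0 : (k + m).+1%:R != 0 :> R by rewrite pnatr_eq0.
  move: (k`!)%:R f0 ((k + m)`!)%:R f1 (k + m).+1%:R k0 ((-1) ^+ k) => a a0 b b0 c c0 e.
  by field; rewrite a0 b0 c0.
rewrite natrD; case: k => [|k] /=; first by rewrite expr0; ring.
by rewrite exprS; ring.
Qed.

Lemma is_derive_bser_sq m z :
  is_derive z 1 (fun y : R => bser m (y ^+ 2 / 4)) (- (z / 2) * bser m.+1 (z ^+ 2 / 4)).
Proof.
have dq : is_derive z 1 (fun y : R => y ^+ 2 / 4) (z / 2).
  have dd := is_derive_mul (is_derive_mul (is_derive_id z (1 : R)) (is_derive_id z (1 : R)))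
    (is_derive_cst (4^-1 : R) z 1).
  by apply: is_derive_eq dd _ => /=; field.
apply: is_derive_eq (is_derive1_comp (is_derive_bser m _) dq) _.
by rewrite mulrC mulrN mulNr.
Qed.

Lemma is_derive_halfX n z :
  is_derive z 1 (fun y : R => (y / 2) ^+ n.+1) (n.+1%:R / 2 * (z / 2) ^+ n).
Proof.
elim: n => [|n IH].
  have dd := is_derive_mul (is_derive_id z (1 : R)) (is_derive_cst (2^-1 : R) z 1).
  by apply: is_derive_eq dd _ => /=; rewrite expr0; ring.
have dd := is_derive_mul (is_derive_mul (is_derive_id z (1 : R)) (is_derive_cst (2^-1 : R) z 1)) IH.
apply: is_derive_eq dd _ => /=; rewrite -(natr1 n.+1) !exprS; by field.
Qed.

Lemma is_derive_Jn m z : 0 < z -> is_derive z 1 (Jn m) (m%:R / z * Jn m z - Jn m.+1 z).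
Proof.
move=> z0; have z0' : z != 0 by rewrite gt_eqF.
rewrite /Jn; case: m => [|m].
  have dd := is_derive_mul (is_derive_cst (1 : R) z 1) (is_derive_bser_sq 0 z).
  by apply: is_derive_eq dd _ => /=; rewrite expr0 expr1; ring.
have dd := is_derive_mul (is_derive_halfX m z) (is_derive_bser_sq m.+1 z).
apply: is_derive_eq dd _ => /=; rewrite !exprS; field.
exact: z0'.
Qed.

Lemma Jn_rec m z : 0 < z -> Jn m z + Jn m.+2 z = 2 * m.+1%:R / z * Jn m.+1 z.
Proof.
move=> z0; have z0' : z != 0 by rewrite gt_eqF.
rewrite /Jn bser_rec !exprS; field.
exact: z0'.
Qed.

Lemma is_derive_JnS m z : 0 < z ->
  is_derive z 1 (Jn m.+1) (Jn m z - m.+1%:R / z * Jn m.+1 z).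
Proof.
move=> z0; apply: is_derive_eq (is_derive_Jn m.+1 z0) _.
have -> : Jn m z = 2 * m.+1%:R / z * Jn m.+1 z - Jn m.+2 z by rewrite -Jn_rec// addrK.
by field; rewrite gt_eqF.
Qed.

(* The energy z (J_m^2 + J_{m+1}^2) - (2m+1) J_m J_{m+1} has derivative
   (2m+1) J_m J_{m+1} / z, which is O(energy / z^2). *)
Let energy m z := z * (Jn m z ^+ 2 + Jn m.+1 z ^+ 2) - (2 * m).+1%:R * (Jn m z * Jn m.+1 z).

Let is_derive_energy m z : 0 < z ->
  is_derive z 1 (energy m) ((2 * m).+1%:R / z * (Jn m z * Jn m.+1 z)).
Proof.
move=> z0; have dA := is_derive_Jn m z0; have dB := is_derive_JnS m z0.
have dA2 := is_derive_mul dA dA; have dB2 := is_derive_mul dB dB.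
have dd := is_deriveB (is_derive_mul (is_derive_id z (1 : R)) (is_deriveD dA2 dB2))
  (is_derive_mul (is_derive_cst ((2 * m).+1%:R : R) z 1) (is_derive_mul dA dB)).
apply: is_derive_eq dd _ => /=; rewrite !fctE.
rewrite -(natr1 (2 * m)) natrM -(natr1 m).
by field; rewrite gt_eqF.
Qed.

(** Beyond [z0] the energy controls z J_m^2 and, up to a bounded factor, does not increase; below
    [z0] the power series gives a bound. *)
Lemma Jn_decay m : exists C, 0 <= C /\ forall z, 0 <= z ->
  `|Jn m z| <= C /\ Num.sqrt z * `|Jn m z| <= C.
Proof.
pose c : R := (2 * m).+1%:R; have c1 : 1 <= c by rewrite ler1n.
(* From 2c on, the cross term of the energy is small against z (J_m^2 + J_(m+1)^2), so the energy is
   at least half of the latter. *)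
pose z0 : R := 2 * c; have z00 : 0 < z0 by rewrite mulr_gt0// (lt_le_trans ltr01).
(* Since the derivative of the energy is at most c/z^2 times the energy, the integrating factor
   e^(c/z) makes [G] nonincreasing. *)
pose G z := energy m z * expR (c * z^-1).
have dG z : 0 < z -> is_derive z 1 G
    (expR (c * z^-1) * (c / z * (Jn m z * Jn m.+1 z) - c / z ^+ 2 * energy m z)).
  move=> zp; have zn : z != 0 by rewrite gt_eqF.
  have dinv := is_derive_mul (is_derive_cst c z 1)
     (@is_deriveV _ id z _ 1 zn (is_derive_id z (1 : R))).
  have dd := is_derive_mul (is_derive_energy m zp) (is_derive1_comp (is_derive_expR _) dinv).
  by apply: is_derive_eq dd _ => /=; rewrite /GRing.scale /= -/c; field.
have low z : z0 <= z -> z * (Jn m z ^+ 2 + Jn m.+1 z ^+ 2) <= 2 * energy m z /\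
    `|Jn m z * Jn m.+1 z| * z <= energy m z.
  move=> zz0; rewrite /energy -/c; have zc : 2 * c <= z by [].
  set a := Jn m z; set b := Jn m.+1 z.
  have h1 : 2 * `|a * b| <= a ^+ 2 + b ^+ 2.
    rewrite normrM -(real_normK (num_real a)) -(real_normK (num_real b)).
    have := sqr_ge0 (`|a| - `|b|); rewrite sqrrB; lra.
  have h2 : c * (a * b) <= c * `|a * b|.
    by rewrite ler_wpM2l ?ler_norm// (le_trans ler01).
  have h0 : 0 <= `|a * b| by [].
  split; nra.
have Gle z : z0 <= z -> G z <= G z0.
  move=> zz0; apply: (@ler0_derive1_nincry R G z0) => //.
  - move=> x; rewrite in_itv /= andbT => x0.
    by have [] := dG x (lt_trans z00 x0).
  - move=> x; rewrite in_itv /= andbT => x0; have xp := lt_trans z00 x0.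
    rewrite derive1E; have [_ ->] := dG x xp.
    rewrite pmulr_rle0 ?expR_gt0// subr_le0.
    have [_ l2] := low x (ltW x0).
    have -> : c / x * (Jn m x * Jn m.+1 x) = c / x ^+ 2 * (Jn m x * Jn m.+1 x * x).
      by field; rewrite gt_eqF.
    rewrite ler_wpM2l ?divr_ge0 ?sqr_ge0 ?(le_trans ler01)//.
    by apply: le_trans l2; rewrite ler_wpM2r ?ler_norm// ltW.
  - apply: continuous_in_subspaceT => x /set_mem /=; rewrite in_itv /= andbT => x0.
    exact: is_derive_continuous (dG x (lt_le_trans z00 x0)).
pose M := 2 * G z0.
have big z : z0 <= z -> z * Jn m z ^+ 2 <= M.
  move=> zz0; have [l1 _] := low z zz0; have zp := lt_le_trans z00 zz0.
  have e0 : 0 <= energy m z.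
    by have [_] := low z zz0; apply: le_trans; rewrite mulr_ge0// ltW.
  apply: (@le_trans _ _ (2 * energy m z)).
    by apply: le_trans l1; rewrite ler_wpM2l ?(ltW zp)// lerDl sqr_ge0.
  rewrite /M ler_wpM2l//; apply: le_trans (Gle z zz0).
  by rewrite /G ler_peMr// -[leLHS]expR0 ler_expR mulr_ge0 ?invr_ge0 ?(ltW zp)// (le_trans ler01).
pose K := (z0 / 2) ^+ m * expR (z0 ^+ 2 / 4).
have small z : 0 <= z <= z0 -> `|Jn m z| <= K.
  move=> /andP[zp zz]; rewrite /Jn normrM normrX.
  rewrite ger0_norm; last by rewrite divr_ge0.
  apply: ler_pM => //; first by rewrite exprn_ge0// divr_ge0.
    by apply: lerXn2r; rewrite ?nnegrE ?divr_ge0 ?(ltW z00)// ler_pM2r// invr_gt0.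
  apply: le_trans (bser_le _ _) _; rewrite ler_expR ger0_norm ?divr_ge0 ?sqr_ge0//.
  by rewrite ler_pM2r ?invr_gt0// lerXn2r ?nnegrE// ltW.
have K0 : 0 <= K by rewrite mulr_ge0 ?expR_ge0// exprn_ge0// divr_ge0// ltW.
clearbody K M.
exists (K + Num.sqrt z0 * K + Num.sqrt M); split.
  by rewrite !addr_ge0 ?mulr_ge0 ?sqrtr_ge0.
move=> z zp; have [zz|/ltW zz] := leP z z0.
  have s := small z; rewrite zp zz in s; have {}s := s isT; split.
    by apply: le_trans s _; rewrite -addrA lerDl addr_ge0 ?mulr_ge0 ?sqrtr_ge0.
  apply: (@le_trans _ _ (Num.sqrt z0 * K)).
    by apply: ler_pM => //; rewrite ?sqrtr_ge0// ler_wsqrtr.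
  by rewrite addrAC lerDr addr_ge0 ?sqrtr_ge0.
have b := big z zz.
have z1 : 1 <= z by apply: le_trans zz; rewrite /z0; nra.
have sq : Num.sqrt z * `|Jn m z| <= Num.sqrt M.
  by rewrite -sqrtr_sqr -sqrtrM// ler_wsqrtr.
have s1 : 1 <= Num.sqrt z by rewrite -sqrtr1 ler_wsqrtr.
split; apply: (@le_trans _ _ (Num.sqrt M)); rewrite ?lerDr ?addr_ge0 ?mulr_ge0 ?sqrtr_ge0//.
by apply: le_trans sq; rewrite ler_peMl.
Qed.

End RealBessel.

(** * Integer orders and Weber's integral *)

Section IntegerBessel.
Context {R : realType}.
Notation mu := (@lebesgue_measure R).
Notation D := (`]0%R, +oo[%classic : set R).
Implicit Types (x y z t b : R) (m n k : nat).

Lemma rGamma_nat n : rGamma (n.+1%:R : R[i]) = (n`!%:R)^-1.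
Proof.
have := @gam_rGamma R n.+1%:R; rewrite cRe_nat ltr0n => /(_ isT).
have f0 : (n`!)%:R != 0 :> R[i] by rewrite pnatr_eq0 -lt0n fact_gt0.
by rewrite gam_nat => H; apply: (mulIf f0); rewrite H mulVf.
Qed.

Lemma csum_real (a : nat -> R) : cvgn (series a) ->
  csum (fun k => (a k)%:C) = (limn (series a))%:C.
Proof.
move=> ca; apply: climE; apply/ccvg_ReIm; split => /=.
  by under eq_fun do rewrite /series /= Re_sum.
under eq_fun do rewrite /series /= Im_sum big1//.
exact: cvg_cst.
Qed.

Lemma cabs_real_cplx (a : nat -> R) : abssum (fun k => (a k)%:C) <-> cvgn (series (fun k => `|a k|)).
Proof. by rewrite /abssum; under [X in series X]eq_fun do rewrite cabs_real. Qed.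

Definition bstar_term (nu z : R[i]) k : R[i] :=
  (-1) ^+ k * (z / 2) ^+ (2 * k) / k`!%:R * rGamma (nu + k%:R + 1).

Lemma besselJstarE_csum (nu z : R[i]) : besselJstar nu z = csum (bstar_term nu z).
Proof. by []. Qed.

Lemma bstar_term_nat m x k :
  bstar_term m%:R x%:C k = (bcoef m k * (x ^+ 2 / 4) ^+ k)%:C.
Proof.
rewrite /bstar_term.
have -> : m%:R + k%:R + 1 = (k + m).+1%:R :> R[i] by rewrite -natrD natr1 addnC.
rewrite rGamma_nat -(natC 2) -fmorphV -rmorphM/= -rmorphXn/= -!natC.
rewrite -!fmorphV -(rmorphN1 (real_complex R)) -rmorphXn/= -!rmorphM/=; congr (_%:C).
have -> : (x / 2) ^+ (2 * k) = (x ^+ 2 / 4) ^+ k.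
  by rewrite exprM; congr (_ ^+ _); field.
by rewrite /bcoef invfM; ring.
Qed.

Lemma besselJstar_nat m x : besselJstar m%:R x%:C = (bser m (x ^+ 2 / 4))%:C.
Proof.
rewrite besselJstarE_csum (eq_csum (bstar_term_nat m x)) csum_real//.
exact: bser_cvg.
Qed.

Lemma besselJ_nat m x : 0 <= x -> besselJ m%:R x = (Jn m x)%:C.
Proof.
move=> x0; rewrite /besselJ besselJstar_nat /Jn rmorphM/=; congr (_ * _).
move: x0; rewrite le_eqVlt => /orP[/eqP <-|x0]; last first.
  by rewrite cpow_nat ?divr_gt0// rmorphXn.
rewrite mul0r /cpow eqxx rmorphXn/=.
by case: m => [|m]; rewrite ?eqxx ?expr0// expr0n pnatr_eq0.
Qed.

Definition gwts (s : R) n (r : R) : R := r ^+ (2 * n).+1 * expR (- (s * r ^+ 2)).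

Lemma gwtsE (s : R) n (r : R) : 0 < r ->
  cpow r (2 * n.+1%:R - 1) * (expR (- (s * r ^+ 2)))%:C = (gwts s n r)%:C.
Proof.
move=> r0; rewrite (_ : 2 * n.+1%:R - 1 = (2 * n).+1%:R :> R[i]); last first.
  by rewrite -(natr1 n) -(natr1 (2 * n)) natrM; ring.
by rewrite cpow_nat// /gwts rmorphM/= rmorphXn.
Qed.

Lemma gwts_integrable (s : R) n : 0 < s -> mu.-integrable D (EFin \o gwts s n).
Proof.
move=> s0; have [|H _] := @gint_integrable R n.+1%:R s _ s0; first by rewrite cRe_nat.
apply: eq_integrable H => //.
by move=> r /set_mem /half_lineP r0; rewrite /= gwtsE.
Qed.

Lemma gwts_int (s : R) n : 0 < s ->
  \int[mu]_(r in D) gwts s n r = n`!%:R / (2 * s ^+ n.+1).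
Proof.
move=> s0; apply: (@complexI R).
rewrite -cint_real; last exact: gwts_integrable.
transitivity (gint (n.+1%:R : R[i]) s).
  by apply: eq_cint => r /set_mem /half_lineP r0; rewrite gwtsE.
rewrite gint_scale ?cRe_nat// cpowN// cpow_nat//.
have := @gam_nat R n; rewrite /gam => H.
have -> : gint (n.+1%:R : R[i]) 1 = n`!%:R / 2.
  by rewrite -H mulrAC divff ?mul1r// pnatr_eq0.
rewrite -(natC n`!) -(natC 2) -rmorphXn -!fmorphV -!rmorphM; congr (_%:C).
by rewrite invfM mulrC -mulrA.
Qed.

(** One of the two factorials pays for e^t, the other for an exponential series in x/t. With x
    proportional to r^2 and t = eta r^2 the ratio no longer depends on r. *)
Lemma bcoef_sq_le m k x t : 0 <= x -> 0 < t ->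
  `|bcoef m k * x ^+ k| <= exp_coeff (x / t) k * expR t.
Proof.
move=> x0 t0; rewrite normrM [`|x ^+ k|]ger0_norm ?exprn_ge0//.
apply: (@le_trans _ _ ((x / t) ^+ k / k`!%:R * (t ^+ k / k`!%:R))); last first.
  rewrite ler_wpM2l ?divr_ge0 ?exprn_ge0 ?divr_ge0 ?(ltW t0)//.
  by apply: expR_ge_exprn; exact: ltW.
have -> : (x / t) ^+ k / k`!%:R * (t ^+ k / k`!%:R) = (k`!%:R * k`!%:R)^-1 * x ^+ k.
  rewrite exprMn exprVn; have tk : t ^+ k != 0 by rewrite expf_neq0// gt_eqF.
  have f0 : (k`!)%:R != 0 :> R by rewrite pnatr_eq0 -lt0n fact_gt0.
  by move: (t ^+ k) tk (k`!)%:R f0 (x ^+ k) => a a0 f f0 c; field; rewrite f0 a0.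
rewrite ler_wpM2r ?exprn_ge0// /bcoef normrM normrX normrN1 expr1n mul1r.
have kf (i : nat) : (0 : R) < i`!%:R by rewrite ltr0n fact_gt0.
rewrite ger0_norm ?invr_ge0 ?mulr_ge0//.
rewrite lef_pV2 ?posrE ?mulr_gt0// ler_wpM2l// ler_nat.
by elim: m => [|m IH]; rewrite ?addn0// addnS factS (leq_trans IH) ?leq_pmull.
Qed.

(** Weber's integral. Term by term, the Gaussian moment supplies (m + k)!, which cancels against the
    coefficient and leaves an exponential series. *)
Lemma Jn_laplace m s b : 0 < s -> 0 <= b ->
  \int[mu]_(r in D) (r ^+ m.+1 * expR (- (s * r ^+ 2)) * Jn m (r * b)) =
  2^-1 * (b / 2) ^+ m / s ^+ m.+1 * expR (- (b ^+ 2 / (4 * s))).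
Proof.
(* Half of the Gaussian absorbs the factor e^t of [bcoef_sq_le] with t = eta r^2; the other half is
   the integrable majorant. *)
move=> s0 b0; pose eta := s / 2; have e0 : 0 < eta by rewrite divr_gt0.
pose f k (r : R) : R := (b / 2) ^+ m * (bcoef m k * (b ^+ 2 / 4) ^+ k) * gwts s (m + k) r.
have fE (r : R) k : f k r = r ^+ m.+1 * expR (- (s * r ^+ 2)) * ((r * b / 2) ^+ m) *
     (bcoef m k * ((r * b) ^+ 2 / 4) ^+ k).
  have e1 : (r * b / 2) ^+ m = r ^+ m * (b / 2) ^+ m by rewrite -mulrA exprMn.
  have e2 : ((r * b) ^+ 2 / 4) ^+ k = (r ^+ 2) ^+ k * (b ^+ 2 / 4) ^+ k.
    by rewrite -[RHS]exprMn; congr (_ ^+ _); ring.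
  rewrite /f /gwts e1 e2.
  have -> : r ^+ (2 * (m + k)).+1 = r ^+ m.+1 * r ^+ m * (r ^+ 2) ^+ k.
    by rewrite -exprM -!exprD; congr (_ ^+ _); lia.
  by ring.
have fsum (r : R) : 0 < r -> csum (fun k => (f k r)%:C) =
    (r ^+ m.+1 * expR (- (s * r ^+ 2)) * Jn m (r * b))%:C.
  move=> r0; set A := r ^+ m.+1 * expR (- (s * r ^+ 2)) * ((r * b / 2) ^+ m).
  have cb := @bser_cvg R m ((r * b) ^+ 2 / 4).
  transitivity (csum (fun k => (A * (bcoef m k * ((r * b) ^+ 2 / 4) ^+ k))%:C)).
    by apply: eq_csum => k; rewrite fE.
  rewrite csum_real; last exact: is_cvg_seriesZ.
  by rewrite lim_seriesZ// /Jn mulrA.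
have fle k (r : R) : 0 < r -> `|f k r| <= (b / 2) ^+ m * exp_coeff (b ^+ 2 / (4 * eta)) k * gwts eta m r.
  move=> r0; rewrite fE normrM.
  have A0 : 0 <= r ^+ m.+1 * expR (- (s * r ^+ 2)) * ((r * b / 2) ^+ m).
    by rewrite !mulr_ge0 ?expR_ge0// exprn_ge0// ?divr_ge0 ?mulr_ge0// ltW.
  rewrite (ger0_norm A0).
  have t0 : 0 < eta * r ^+ 2 by rewrite mulr_gt0 ?exprn_gt0.
  have x0 : 0 <= (r * b) ^+ 2 / 4 by rewrite divr_ge0 ?sqr_ge0.
  apply: le_trans (ler_wpM2l A0 (bcoef_sq_le m k x0 t0)) _.
  have -> : (r * b) ^+ 2 / 4 / (eta * r ^+ 2) = b ^+ 2 / (4 * eta).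
    by field; rewrite !gt_eqF.
  have -> : expR (- (s * r ^+ 2)) = expR (- (eta * r ^+ 2)) * expR (- (eta * r ^+ 2)).
    by rewrite -expRD /eta; congr expR; field.
  rewrite /gwts (_ : (2 * m).+1 = m.+1 + m)%N; last by lia.
  have e1 : (r * b / 2) ^+ m = r ^+ m * (b / 2) ^+ m by rewrite -mulrA exprMn.
  rewrite exprD e1.
  have ee := expRxMexpNx_1 (eta * r ^+ 2).
  move: (expR _) (expR _) ee (r ^+ m.+1) (r ^+ m) ((b / 2) ^+ m) (exp_coeff _ _).
  move=> E' E ee u v q c.
  rewrite [leLHS](_ : _ = q * c * (u * v * E') * (E * E')); last by ring.
  by rewrite ee mulr1.
have [||||||_ ci E] := @cint_csum _ _ R mu _ half_line_measurable (fun k r => (f k r)%:C)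
  (fun k => (b / 2) ^+ m * exp_coeff (b ^+ 2 / (4 * eta)) k) (gwts eta m).
- move=> k; apply: cmeas_real; apply: measurable_half_line => r r0.
  apply: continuousM; first exact: cvg_cst.
  by apply: continuousM; [exact: exprn_continuous|exact: expRN_sqr_continuous].
- move=> k; apply: mulr_ge0; first by rewrite exprn_ge0// divr_ge0.
  by apply: exp_coeff_ge0; rewrite divr_ge0 ?sqr_ge0// mulr_ge0// ltW.
- by apply: is_cvg_seriesZ; exact: is_cvg_series_exp_coeff.
- by move=> r /half_lineP r0; rewrite mulr_ge0 ?expR_ge0// exprn_ge0// ltW.
- exact: gwts_integrable.
- by move=> k r /half_lineP r0; rewrite cabs_real; exact: fle.
apply: (@complexI R).
have ir : mu.-integrable D (EFin \o (fun r => r ^+ m.+1 * expR (- (s * r ^+ 2)) * Jn m (r * b))).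
  case: ci => ci _; apply: eq_integrable ci => //.
  by move=> r /set_mem /half_lineP r0; rewrite /= fsum.
rewrite -cint_real//; transitivity (cintegral mu D (fun r => csum (fun k => (f k r)%:C))).
  by apply: eq_cint => r /set_mem /half_lineP r0; rewrite fsum.
rewrite E; pose c := 2^-1 * (b / 2) ^+ m / s ^+ m.+1.
transitivity (csum (fun k => (c * exp_coeff (- (b ^+ 2 / (4 * s))) k)%:C)).
  apply: eq_csum => k; rewrite cint_real.
    rewrite /f RintegralZl//; last exact: gwts_integrable.
    rewrite gwts_int//; congr (_%:C); rewrite /c /bcoef /exp_coeff /= (addnC m k).
    have -> : (- (b ^+ 2 / (4 * s))) ^+ k = (-1) ^+ k * (b ^+ 2 / 4) ^+ k * (s ^+ k)^-1.
      rewrite -[(s ^+ k)^-1]exprVn -!exprMn; congr (_ ^+ _); field.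
      by rewrite gt_eqF.
    rewrite -addnS exprD.
    have f0 : (k`!)%:R != 0 :> R by rewrite pnatr_eq0 -lt0n fact_gt0.
    have f1 : ((k + m)`!)%:R != 0 :> R by rewrite pnatr_eq0 -lt0n fact_gt0.
    have sk : s ^+ k != 0 by rewrite expf_neq0// gt_eqF.
    have sm : s ^+ m.+1 != 0 by rewrite expf_neq0// gt_eqF.
    move: (k`!)%:R f0 ((k + m)`!)%:R f1 (s ^+ k) sk (s ^+ m.+1) sm ((b / 2) ^+ m)
      ((b ^+ 2 / 4) ^+ k) ((-1) ^+ k) => a a0 a' a0' u u0 v v0 q d e.
    by field; rewrite a0 a0' u0 v0.
  have := integrableZl half_line_measurable ((b / 2) ^+ m * (bcoef m k * (b ^+ 2 / 4) ^+ k))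
    (gwts_integrable (m + k) s0).
  by apply: eq_integrable.
rewrite csum_real; last by apply: is_cvg_seriesZ; exact: is_cvg_series_exp_coeff.
by rewrite lim_seriesZ//; exact: is_cvg_series_exp_coeff.
Qed.

End IntegerBessel.

(** * The Laplace transform of the integral side *)

Section Kernel.
Context {R : realType}.
Notation mu := (@lebesgue_measure R).
Notation D := (`]0%R, +oo[%classic : set R).
Implicit Types (r y t th : R) (n : nat) (nu : R[i]).

Definition wf th y : R[i] := ((y + y^-1) * cos th) +i* ((y - y^-1) * sin th).

Lemma wfE th y : 0 < y ->
  y%:C * cexp ('i%C * th%:C) + (y%:C * cexp ('i%C * th%:C))^-1 = wf th y.
Proof.
move=> y0; rewrite invfM -cexpN -fmorphV.
apply: complex_ext; rewrite /cexp.
  by rewrite cReD !cReM /= !(mul0r, mul1r, mulr0, subr0, sub0r, addr0, add0r, oppr0, expR0, cosN, sinN, mulrN); ring.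
by rewrite cImD !cImM /= !(mul0r, mul1r, mulr0, subr0, sub0r, addr0, add0r, oppr0, expR0, cosN, sinN, mulrN); ring.
Qed.

Lemma wf_sqr th y : 0 < y ->
  cabs (wf th y) ^+ 2 = (y ^+ 2 + y^-1 ^+ 2) + 2 * cos (2 * th).
Proof.
move=> y0; rewrite cabsE sqr_sqrtr ?addr_ge0 ?sqr_ge0//=.
have -> : 2 * th = th *+ 2 by rewrite mulr_natl.
have cs := cos2Dsin2 th; rewrite cos_mulr2n mulr2n.
have yy : y * y^-1 = 1 by rewrite divff// gt_eqF.
have -> : ((y + y^-1) * cos th) ^+ 2 + ((y - y^-1) * sin th) ^+ 2 =
  (y ^+ 2 + y^-1 ^+ 2) * (cos th ^+ 2 + sin th ^+ 2) + 2 * (y * y^-1) *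
   (cos th ^+ 2 - sin th ^+ 2) by ring.
by rewrite cs yy sin2cos2; ring.
Qed.

Lemma wf_ge th y : 0 < y -> `|y - y^-1| <= cabs (wf th y).
Proof.
move=> y0; rewrite cabsE /= -sqrtr_sqr ler_wsqrtr//.
have -> : (y - y^-1) ^+ 2 = (y - y^-1) ^+ 2 * (cos th ^+ 2 + sin th ^+ 2).
  by rewrite cos2Dsin2 mulr1.
rewrite mulrDr !exprMn lerD2r ler_wpM2r ?sqr_ge0//.
have yV : 0 < y^-1 by rewrite invr_gt0.
nra.
Qed.

Lemma inv_continuous_pos y : 0 < y -> {for y, continuous (@GRing.inv R)}.
Proof. by move=> y0; apply: inv_continuous; rewrite gt_eqF. Qed.

Lemma wf_ccont th y : 0 < y -> ccont (wf th) y.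
Proof.
move=> y0; apply/ccvg_ReIm; split => /=; apply: cvgM; try exact: cvg_cst.
  by apply: cvgD; [exact: cvg_id|exact: inv_continuous_pos].
by apply: cvgB; [exact: cvg_id|exact: inv_continuous_pos].
Qed.

(** The integrand with |w|^(2n) cancelled between the direction of w and the Bessel function, hence
    continuous in y also where w = 0. *)
Definition Kr n nu th r y : R[i] := cpow y (2 * nu - 1) * wf th y ^+ (2 * n) *
  ((r / 2) ^+ (2 * n) * bser (2 * n) ((r * cabs (wf th y)) ^+ 2 / 4))%:C.

Lemma integrandE n nu th u y : 0 < y ->
  integrand nu n%:Z u th y = Kr n nu th (cabs u) y.
Proof.
move=> y0; rewrite /integrand wfE// /Kr -mulrA -[RHS]mulrA; congr (_ * _).
have -> : (2 * n%:Z)%:~R = (2 * n)%:R :> R[i] by rewrite -PoszM.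
have -> : (wf th y / `|wf th y|) ^ (2 * n%:Z) = (wf th y / (cabs (wf th y))%:C) ^+ (2 * n).
  rewrite -PoszM -exprnP; congr (_ ^+ _); congr (_ / _); exact: normcE.
rewrite besselJ_nat ?mulr_ge0 ?cabs_ge0// /Jn.
(* Where w = 0 both sides vanish for n > 0, and for n = 0 the direction has exponent 0, so its
   conventional value is irrelevant. *)
move: (wf th y) => w; have [w0|w0] := eqVneq (cabs w) 0.
  rewrite w0 mulr0 mul0r.
  have -> : w = 0 by apply/eqP; rewrite -cabs_eq0 w0.
  rewrite mul0r; case: n => [|n]; first by rewrite muln0 !expr0.
  by rewrite mulnS !exprS !mul0r.
have w1 : (cabs w)%:C != 0 :> R[i].
  by rewrite -(inj_eq (@complexI R)) in w0.
rewrite exprMn exprVn [cabs u * _ / 2]mulrAC [(cabs u / 2 * _) ^+ _]exprMn.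
have E1 (a b c : R) : (a * b * c)%:C = a%:C * b%:C * c%:C :> R[i] by rewrite !rmorphM.
have E2 (a b : R) : (a * b)%:C = a%:C * b%:C :> R[i] by rewrite rmorphM.
have E3 (a : R) k : (a ^+ k)%:C = a%:C ^+ k :> R[i] by rewrite rmorphXn.
rewrite E1 E2 [(cabs w ^+ _)%:C]E3.
have w2 : (cabs w)%:C ^+ (2 * n) != 0 by rewrite expf_neq0.
move: (w ^+ _) ((cabs w)%:C ^+ _) w2 ((cabs u / 2) ^+ _)%:C (bser _ _)%:C => a b b0 c e.
by field.
Qed.

(** The order strip enters here: at 0 the exponent is 2 Re nu + 1/2 - 1 and at infinity 2 Re nu -
    1/2 - 1, so integrability at both ends means |Re nu| < 1/4. *)
Definition gdom nu y : R := y `^ (2 * complex.Re nu - 1) *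
  (2 * Num.min (y `^ 2^-1) (y `^ (- 2^-1))).

Lemma gdom_ge0 nu y : 0 <= gdom nu y.
Proof. by rewrite mulr_ge0 ?powR_ge0// mulr_ge0// le_min !powR_ge0. Qed.

Lemma gdom_integrable nu : `|complex.Re nu| < 4^-1 -> mu.-integrable D (EFin \o gdom nu).
Proof.
rewrite ltr_norml => /andP[n1 n2]; set s := complex.Re nu in n1 n2.
apply: (@integrable_pow _ _ (2 * s + 2^-1) (2^-1 - 2 * s) 2).
- apply: measurable_funM.
    by apply: measurable_half_line => x x0; exact: powR_continuous.
  apply: measurable_funM; first exact: measurable_cst.
  by apply: measurable_minr; apply: measurable_half_line => x x0; exact: powR_continuous.
- lra.
- lra.
- move=> y /andP[y0 y1]; rewrite ger0_norm ?gdom_ge0// /gdom -/s mulrCA ler_wpM2l//.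
  have -> : y `^ (2 * s + 2^-1 - 1) = y `^ (2 * s - 1) * y `^ 2^-1.
    by rewrite -powRD ?(gt_eqF y0) ?implybT//; congr powR; ring.
  by rewrite ler_wpM2l ?powR_ge0// ge_min lexx.
- move=> y y1; have y0 : 0 < y by apply: lt_le_trans y1.
  rewrite ger0_norm ?gdom_ge0// /gdom -/s mulrCA ler_wpM2l//.
  have -> : y `^ (- (2^-1 - 2 * s) - 1) = y `^ (2 * s - 1) * y `^ (- 2^-1).
    by rewrite -powRD ?(gt_eqF y0) ?implybT//; congr powR; ring.
  by rewrite ler_wpM2l ?powR_ge0// ge_min lexx orbT.
Qed.

Lemma powR_half y : 0 <= y -> y `^ 2^-1 = Num.sqrt y.
Proof. exact: powR12_sqrt. Qed.

(** For y >= 2 or y <= 1/2, |w| >= |y - 1/y| is comparable with the larger of y and 1/y, and the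
    decay z^(-1/2) applies. In between, where w may vanish, the uniform bound on J suffices. The
    bound separates r and y, as Fubini requires. *)
Lemma kernel_decay n th : exists C, 0 <= C /\ forall r y, 0 < r -> 0 < y ->
  `|Jn (2 * n) (r * cabs (wf th y))| <=
  C * (1 + (Num.sqrt r)^-1) * (2 * Num.min (y `^ 2^-1) (y `^ (- 2^-1))).
Proof.
have [C [C0 HC]] := @Jn_decay R (2 * n); exists C; split => // r y r0 y0.
set w := cabs (wf th y); have w0 : 0 <= w by exact: cabs_ge0.
have [h1 h2] := HC (r * w) (mulr_ge0 (ltW r0) w0).
have sr : 0 < Num.sqrt r by rewrite sqrtr_gt0.
have srV : 0 < (Num.sqrt r)^-1 by rewrite invr_gt0.
have yw := wf_ge th y0; rewrite -/w in yw.
have yV : 0 < y^-1 by rewrite invr_gt0.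
have yy : y * y^-1 = 1 by rewrite divff// gt_eqF.
rewrite powRN powR_half ?(ltW y0)//; set q := Num.sqrt y.
have q0 : 0 < q by rewrite sqrtr_gt0.
have qV : 0 < q^-1 by rewrite invr_gt0.
have qq : q * q = y by rewrite -expr2 sqr_sqrtr// ltW.
have qqV : q * q^-1 = 1 by rewrite divff// gt_eqF.
have far (v : R) : 0 < v -> v * v <= 4 * w -> `|Jn (2 * n) (r * w)| <=
    C * (1 + (Num.sqrt r)^-1) * (2 * v^-1).
  move=> v0 vw.
  have vs : v <= 2 * Num.sqrt w.
    rewrite -(ger0_norm (ltW v0)) -sqrtr_sqr expr2.
    have -> : 2 * Num.sqrt w = Num.sqrt (4 * w).
      rewrite sqrtrM//; congr (_ * _).
      by rewrite (_ : 4 = 2 ^+ 2 :> R) ?sqrtr_sqr ?ger0_norm// expr2; lra.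
    by rewrite ler_wsqrtr.
  rewrite sqrtrM ?(ltW r0)// in h2.
  have vV : 0 < v^-1 by rewrite invr_gt0.
  apply: (@le_trans _ _ (C * (Num.sqrt r)^-1 * (2 * v^-1))); last first.
    by rewrite ler_wpM2r ?mulr_ge0 ?(ltW vV)// ler_wpM2l// lerDr.
  have -> : C * (Num.sqrt r)^-1 * (2 * v^-1) = 2 * C / (v * Num.sqrt r).
    by rewrite invfM; ring.
  rewrite ler_pdivlMr ?mulr_gt0//.
  apply: (@le_trans _ _ (2 * (Num.sqrt r * Num.sqrt w * `|Jn (2 * n) (r * w)|))); last first.
    by rewrite ler_wpM2l.
  rewrite mulrC -!mulrA [in leRHS]mulrCA !mulrA ler_wpM2r//.
  by rewrite mulrC -mulrA ler_wpM2l// ltW.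
have [y2|y2] := leP 2 y.
  have -> : Num.min q q^-1 = q^-1.
    by apply: min_idPr; nra.
  apply: far => //; rewrite qq.
  have := le_trans (ler_norm _) yw; nra.
have [y3|y3] := leP y 2^-1.
  have -> : Num.min q q^-1 = q^-1^-1.
    rewrite invrK; apply: min_idPl; nra.
  apply: far => //; rewrite -invfM qq.
  have := yw; rewrite distrC => /(le_trans (ler_norm _)); nra.
apply: le_trans h1 _; rewrite -[leLHS]mulr1 -mulrA ler_wpM2l//.
apply: (@le_trans _ _ (1 * (2 * Num.min q q^-1))).
  have : 2^-1 <= Num.min q q^-1.
    by rewrite le_min; apply/andP; split; nra.
  lra.
by rewrite ler_wpM2r ?mulr_ge0 ?le_min ?(ltW q0) ?(ltW qV)// lerDl ltW.
Qed.

End Kernel.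

(** * Continuity in a parameter and measurability on the quadrant *)

Section ParametricIntegral.
Context {d : measure_display} {T : measurableType d} {R : realType}.
Context {mu : {measure set T -> \bar R}} {D : set T} (mD : measurable D).

Lemma cint_param_ccont (f : R -> T -> R[i]) (g : T -> R) (u v a : R) : u < a < v ->
  (forall r, u < r < v -> cmeas D (f r)) -> mu.-integrable D (EFin \o g) ->
  (forall r y, u < r < v -> D y -> cabs (f r y) <= g y) ->
  (forall r y, u < r < v -> D y -> ccont (f^~ y) r) ->
  ccont (fun r => cintegral mu D (f r)) a.
Proof.
move=> uav mf ig fg cf.
have itvP (r : R) : r \in (`]u, v[%classic : set R) -> u < r < v by rewrite inE /= in_itv.
have If r : u < r < v -> cintegrable mu D (f r).
  by move=> uv; apply: (cintegrable_le mD) (mf r uv) ig _ => y Dy; exact: fg.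
apply/ccvg_ReIm; split.
  apply: (@continuity_under_integral _ _ _ mu (fun r y => complex.Re (f r y)) D mD u v _ _ g ig).
  - by move=> r /= ruv; have [] := If r (itvP r (mem_set ruv)).
  - apply: aeW => y Dy r ruv.
    by have /ccvg_ReIm[] := cf r y (itvP r ruv) Dy.
  - move=> r ruv; apply: aeW => y Dy; apply: le_trans (cabs_Re _) _.
    exact: fg (itvP r (mem_set ruv)) Dy.
  - by rewrite inE /= in_itv.
apply: (@continuity_under_integral _ _ _ mu (fun r y => complex.Im (f r y)) D mD u v _ _ g ig).
- by move=> r /= ruv; have [] := If r (itvP r (mem_set ruv)).
- apply: aeW => y Dy r ruv.
  by have /ccvg_ReIm[] := cf r y (itvP r ruv) Dy.
- move=> r ruv; apply: aeW => y Dy; apply: le_trans (cabs_Im _) _.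
  exact: fg (itvP r (mem_set ruv)) Dy.
- by rewrite inE /= in_itv.
Qed.

End ParametricIntegral.

Section ProductMeasurability.
Context {R : realType}.
Notation D := (`]0%R, +oo[%classic : set R).

Lemma measurable_fst_half_line (h : R -> R) : measurable_fun D h ->
  measurable_fun (D `*` D) (fun z : R * R => h z.1).
Proof.
move=> mh; apply: (@measurable_comp _ _ _ _ _ _ D) => //.
- by move=> _ [z [z1 _] <-].
- by apply: measurable_funS measurable_fst => //; exact: measurableT.
Qed.

Lemma measurable_snd_half_line (h : R -> R) : measurable_fun D h ->
  measurable_fun (D `*` D) (fun z : R * R => h z.2).
Proof.
move=> mh; apply: (@measurable_comp _ _ _ _ _ _ D) => //.
- by move=> _ [z [_ z2] <-].
- by apply: measurable_funS measurable_snd => //; exact: measurableT.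
Qed.

Lemma cmeas_fst_half_line (f : R -> R[i]) : cmeas D f ->
  cmeas (D `*` D) (fun z : R * R => f z.1).
Proof. by case=> h1 h2; split;
  [exact: (measurable_fst_half_line h1)|exact: (measurable_fst_half_line h2)]. Qed.

Lemma cmeas_snd_half_line (f : R -> R[i]) : cmeas D f ->
  cmeas (D `*` D) (fun z : R * R => f z.2).
Proof. by case=> h1 h2; split;
  [exact: (measurable_snd_half_line h1)|exact: (measurable_snd_half_line h2)]. Qed.

End ProductMeasurability.

Section KernelIntegral.
Context {R : realType}.
Notation mu := (@lebesgue_measure R).
Notation D := (`]0%R, +oo[%classic : set R).
Implicit Types (r y t th s : R) (n : nat) (nu : R[i]).

Lemma bser_continuous n (x : R) : {for x, continuous (@bser R n)}.
Proof. exact: is_derive_continuous (is_derive_bser n x). Qed.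

Lemma Jn_wf n th r y :
  cabs (wf th y ^+ (2 * n) *
    ((r / 2) ^+ (2 * n) * bser (2 * n) ((r * cabs (wf th y)) ^+ 2 / 4))%:C) =
  `|Jn (2 * n) (r * cabs (wf th y))|.
Proof.
rewrite cabsM cabs_real cabsX /Jn -[X in X * _](ger0_norm (exprn_ge0 _ (cabs_ge0 _))).
rewrite -normrM; congr `|_|; rewrite mulrA; congr (_ * _).
by rewrite -exprMn; congr (_ ^+ _); ring.
Qed.

Lemma Kr_bound n th : exists C, 0 <= C /\ forall nu r y, 0 < r -> 0 < y ->
  cabs (Kr n nu th r y) <= C * (1 + (Num.sqrt r)^-1) * gdom nu y.
Proof.
have [C [C0 HC]] := kernel_decay n th; exists C; split => // nu r y r0 y0.
rewrite /Kr -mulrA cabsM Jn_wf cabs_cpow// Re_2B1 /gdom mulrCA ler_wpM2l ?powR_ge0//.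
exact: HC.
Qed.

Lemma wf_cabs_measurable th : measurable_fun D (fun y => cabs (wf th y)).
Proof. by apply: cmeas_cabs; apply: cmeas_half_line => y; exact: wf_ccont. Qed.

Lemma cmeas_cpow_wf n nu th : cmeas D (fun y => cpow y (2 * nu - 1) * wf th y ^+ (2 * n)).
Proof.
apply: cmeasM; first by apply: cmeas_half_line => y; exact: ccont_cpow.
by apply: cmeasX; apply: cmeas_half_line => y; exact: wf_ccont.
Qed.

Lemma cmeas_Kr2 n nu th : cmeas (D `*` D) (fun z : R * R => Kr n nu th z.1 z.2).
Proof.
apply: cmeasM; first exact: (cmeas_snd_half_line (cmeas_cpow_wf n nu th)).
apply: cmeas_real; apply: measurable_funM.
  apply: (measurable_fst_half_line (h := fun r => (r / 2) ^+ (2 * n))).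
  by apply: measurable_funX; apply: measurable_funM.
apply: (@measurableT_comp _ _ _ _ _ _ (@bser R (2 * n))).
  by apply: continuous_measurable_fun => x; exact: bser_continuous.
apply: measurable_funM; last exact: measurable_cst.
apply: measurable_funX; apply: measurable_funM.
  by apply: (measurable_fst_half_line (h := id)); exact: measurable_id.
exact: (measurable_snd_half_line (wf_cabs_measurable th)).
Qed.

End KernelIntegral.

(** * The integral as a function of |u|, and its transform *)

Section IntegralSide.
Context {R : realType}.
Notation mu := (@lebesgue_measure R).
Notation D := (`]0%R, +oo[%classic : set R).
Implicit Types (r y t th s : R) (n : nat) (nu : R[i]).

Lemma cmeas_Kr n nu th r : cmeas D (Kr n nu th r).
Proof.
apply: cmeasM; first exact: cmeas_cpow_wf.
apply: cmeas_real; apply: measurable_funM; first exact: measurable_cst.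
apply: (@measurableT_comp _ _ _ _ _ _ (@bser R (2 * n))).
  by apply: continuous_measurable_fun => x; exact: bser_continuous.
apply: measurable_funM; last exact: measurable_cst.
apply: measurable_funX; apply: measurable_funM; first exact: measurable_cst.
exact: wf_cabs_measurable.
Qed.

Lemma scaleX_continuous c k t : {for t, continuous (fun r => (r * c) ^+ k)}.
Proof.
apply: (@continuous_comp _ _ _ (fun r => r * c) (fun z => z ^+ k)).
  by apply: cvgM; [exact: cvg_id|exact: cvg_cst].
exact: exprn_continuous.
Qed.

Lemma cintegrable_real (h : R -> R) : mu.-integrable D (EFin \o h) ->
  cintegrable mu D (fun x => (h x)%:C).
Proof.
by move=> ih; split => //=; exact: (@integrable0 _ _ R mu D).
Qed.

Lemma RintegrableZ c (h : R -> R) : mu.-integrable D (EFin \o h) ->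
  mu.-integrable D (EFin \o (fun x => c * h x)).
Proof.
move=> ih; have := integrableZl half_line_measurable c ih.
by apply: eq_integrable => //; exact: half_line_measurable.
Qed.

Lemma Kr_integrable n nu th r : `|complex.Re nu| < 4^-1 -> 0 < r ->
  cintegrable mu D (Kr n nu th r).
Proof.
move=> hnu r0; have [C [C0 HC]] := Kr_bound n th.
apply: (cintegrable_le half_line_measurable (cmeas_Kr n nu th r)
  (RintegrableZ (C * (1 + (Num.sqrt r)^-1)) (gdom_integrable hnu))) => y /half_lineP y0.
exact: HC.
Qed.

(** The integral of the theorem for [p = n], viewed as a function of r = |u|, the variable of the
    Laplace transform. *)
Definition Gint n nu th r : R[i] := cintegral mu D (Kr n nu th r).

Lemma Gint_ccont n nu th r : `|complex.Re nu| < 4^-1 -> 0 < r -> ccont (Gint n nu th) r.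
Proof.
move=> hnu r0; have [C [C0 HC]] := Kr_bound n th.
have r2 : 0 < r / 2 by rewrite divr_gt0.
apply: (cint_param_ccont half_line_measurable (u := r / 2) (v := r + 1)
  (g := fun y => C * (1 + (Num.sqrt (r / 2))^-1) * gdom nu y)).
- by apply/andP; split; lra.
- by move=> t _; exact: cmeas_Kr.
- exact: (RintegrableZ (C * (1 + (Num.sqrt (r / 2))^-1)) (gdom_integrable hnu)).
- move=> t y /andP[t1 t2] /half_lineP y0; have t0 : 0 < t by apply: lt_trans t1.
  apply: le_trans (HC nu t y t0 y0) _.
  rewrite ler_wpM2r ?gdom_ge0// ler_wpM2l// lerD2l lef_pV2 ?posrE ?sqrtr_gt0//.
  by rewrite ler_wsqrtr// ltW.
- move=> t y _ _; apply: ccontM; first exact: ccont_cst.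
  apply: ccont_real; apply: continuousM.
    exact: scaleX_continuous.
  apply: (continuous_comp (f := fun r => (r * cabs (wf th y)) ^+ 2 / 4)).
    by apply: continuousM; [exact: scaleX_continuous|exact: cvg_cst].
  exact: bser_continuous.
Qed.

(** The weight times the r-part of [kernel_decay]; its singularity r^(-1/2) is absorbed by the power
    of r in the weight. *)
Definition gdom1 s n r : R := gwts s n r * (1 + (Num.sqrt r)^-1).

Lemma gdom1_integrable s n : 0 < s -> mu.-integrable D (EFin \o gdom1 s n).
Proof.
move=> s0.
have i1 := @gwts_integrable R s n s0.
have c0 : 0 < (2 * n)%:R + 2^-1 + 1 :> R by rewrite ltr_wpDl// addr_ge0.
have i2 := integrable_gauss c0 s0.
have i3 := integrableD half_line_measurable i1 i2.
apply: eq_integrable i3; first exact: half_line_measurable.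
move=> r /set_mem /half_lineP r0; rewrite /= -EFinD; congr (_%:E).
rewrite /gdom1 mulrDr mulr1; congr (_ + _); rewrite /gwts mulrAC; congr (_ * _).
rewrite addrK powRD ?(gt_eqF r0) ?implybT// powR_mulrn ?(ltW r0)// powR_half ?(ltW r0)//.
have sr : 0 < Num.sqrt r by rewrite sqrtr_gt0.
rewrite exprSr -mulrA; congr (_ * _).
by rewrite -[X in _ = X * _](sqr_sqrtr (ltW r0)) expr2 mulfK// gt_eqF.
Qed.

Lemma bser_weight_integrable m s b : 0 < s -> 0 <= b -> b ^+ m != 0 ->
  mu.-integrable D (EFin \o (fun r => r ^+ m.+1 * expR (- (s * r ^+ 2)) *
     ((r / 2) ^+ m * bser m ((r * b) ^+ 2 / 4)))).
Proof.
move=> s0 b0 bm; have [C [C0 HC]] := @Jn_decay R m.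
  have ig := @integrable_gauss R m.+2%:R s (ltr0Sn _ _) s0.
  apply: (integrable_le half_line_measurable _ (RintegrableZ (C / b ^+ m) ig)).
    apply: measurable_half_line => r _; apply: continuousM.
      by apply: continuousM; [exact: exprn_continuous|exact: expRN_sqr_continuous].
    apply: continuousM.
      exact: scaleX_continuous.
    apply: (continuous_comp (f := fun r => (r * b) ^+ 2 / 4)).
      by apply: continuousM; [exact: scaleX_continuous|exact: cvg_cst].
    exact: bser_continuous.
  move=> r /half_lineP r0; rewrite normrM.
  have -> : m.+2%:R - 1 = m.+1%:R :> R by rewrite -(natr1 m.+1) addrK.
  have w0 : 0 <= r ^+ m.+1 * expR (- (s * r ^+ 2)).
    by rewrite mulr_ge0 ?expR_ge0// exprn_ge0// ltW.
  rewrite powR_mulrn ?(ltW r0)// (ger0_norm w0) mulrC ler_wpM2r//.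
  have b1 : 0 < b ^+ m by rewrite lt0r bm exprn_ge0.
  rewrite ler_pdivlMr// mulrC -[X in X * _](ger0_norm (ltW b1)) -normrM.
  have [+ _] := HC (r * b) (mulr_ge0 (ltW r0) b0); rewrite /Jn.
  have -> : (r * b / 2) ^+ m = b ^+ m * (r / 2) ^+ m.
    by rewrite -exprMn; congr (_ ^+ _); ring.
  by rewrite mulrA.
Qed.

(** Weber's integral divided by [b ^+ m]. Where that power is 0 the division fails, but in the
    application [c] contains the factor w^m with |w| = b and vanishes there too. *)
Lemma bser_laplace m s b (c : R[i]) : 0 < s -> 0 <= b -> (b = 0 -> m != 0%N -> c = 0) ->
  cintegral mu D (fun r => c * (r ^+ m.+1 * expR (- (s * r ^+ 2)) *
     ((r / 2) ^+ m * bser m ((r * b) ^+ 2 / 4)))%:C) =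
  c * (2^-1 * (2^-1) ^+ m / s ^+ m.+1 * expR (- (b ^+ 2 / (4 * s))))%:C.
Proof.
move=> s0 b0 cb.
have [bm|bm] := eqVneq (b ^+ m) 0.
  move/eqP: bm; rewrite expf_eq0 => /andP[m0 /eqP b00].
  rewrite cb// -?lt0n// mul0r.
  transitivity (cintegral mu D (fun r : R => 0 * 0 : R[i])).
    by apply: eq_cint => r _; rewrite !mul0r.
  by rewrite (cintZ half_line_measurable) ?mul0r//; exact: cintegrable0.
have ih := bser_weight_integrable s0 b0 bm.
rewrite (cintZ half_line_measurable); last by apply: cintegrable_real.
rewrite cint_real//; congr (_ * _%:C); apply: (mulfI bm).
rewrite -(RintegralZl _ half_line_measurable ih).
have -> : b ^+ m * (2^-1 * 2^-1 ^+ m / s ^+ m.+1 * expR (- (b ^+ 2 / (4 * s)))) =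
  2^-1 * (b / 2) ^+ m / s ^+ m.+1 * expR (- (b ^+ 2 / (4 * s))).
  by rewrite exprMn; ring.
rewrite -Jn_laplace//; apply: eq_Rintegral => r _.
rewrite mulrCA; congr (_ * _); rewrite /Jn mulrA; congr (_ * _).
by rewrite -exprMn; congr (_ ^+ _); ring.
Qed.

Lemma Gint_laplace n nu th s : `|complex.Re nu| < 4^-1 -> 0 < s ->
  [/\ cintegrable mu D (fun r => (gwts s n r)%:C * Gint n nu th r),
   cintegrable mu D (fun y => cpow y (2 * nu - 1) * wf th y ^+ (2 * n) *
       (2^-1 * (2^-1) ^+ (2 * n) / s ^+ (2 * n).+1 *
          expR (- (cabs (wf th y) ^+ 2 / (4 * s))))%:C) &
   cintegral mu D (fun r => (gwts s n r)%:C * Gint n nu th r) =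
     cintegral mu D (fun y => cpow y (2 * nu - 1) * wf th y ^+ (2 * n) *
       (2^-1 * (2^-1) ^+ (2 * n) / s ^+ (2 * n).+1 *
          expR (- (cabs (wf th y) ^+ 2 / (4 * s))))%:C)].
Proof.
move=> hnu s0; have [C [C0 HC]] := Kr_bound n th.
have mg : measurable_fun D (gwts s n).
  apply: measurable_half_line => r _.
  by apply: continuousM; [exact: exprn_continuous|exact: expRN_sqr_continuous].
have [||||I1 I2 E] := @cfubini _ _ _ _ _ mu mu D D half_line_measurable half_line_measurable
  (fun r => C * gdom1 s n r) (gdom nu) _ _ (fun r y => (gwts s n r)%:C * Kr n nu th r y).
- exact: RintegrableZ (gdom1_integrable n s0).
- exact: gdom_integrable.
- apply: cmeasM; last exact: cmeas_Kr2.
  exact: (cmeas_fst_half_line (cmeas_real mg)).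
- move=> r y /half_lineP r0 /half_lineP y0.
  have w0 : 0 <= gwts s n r by rewrite mulr_ge0 ?expR_ge0// exprn_ge0// ltW.
  rewrite cabsM cabs_real (ger0_norm w0) /gdom1.
  by rewrite [leRHS](_ : _ = gwts s n r * (C * (1 + (Num.sqrt r)^-1) * gdom nu y));
    [rewrite ler_wpM2l// HC|ring].
have E1 r : D r -> cintegral mu D (fun y => (gwts s n r)%:C * Kr n nu th r y) =
    (gwts s n r)%:C * Gint n nu th r.
  by move=> /half_lineP r0; apply: (cintZ half_line_measurable); exact: Kr_integrable.
have E2 y : D y -> cintegral mu D (fun r => (gwts s n r)%:C * Kr n nu th r y) =
  cpow y (2 * nu - 1) * wf th y ^+ (2 * n) *
       (2^-1 * (2^-1) ^+ (2 * n) / s ^+ (2 * n).+1 *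
          expR (- (cabs (wf th y) ^+ 2 / (4 * s))))%:C.
  move=> /half_lineP y0.
  have H := @bser_laplace (2 * n) s (cabs (wf th y))
    (cpow y (2 * nu - 1) * wf th y ^+ (2 * n)) s0 (cabs_ge0 _).
  have W : cabs (wf th y) = 0 -> (2 * n)%N != 0%N ->
      cpow y (2 * nu - 1) * wf th y ^+ (2 * n) = 0.
    by move=> /eqP; rewrite cabs_eq0 => /eqP -> n0; rewrite expr0n (negbTE n0) mulr0.
  rewrite -(H W).
  apply: eq_cint => r _; rewrite /Kr mulrCA; congr (_ * _).
  by rewrite [RHS]rmorphM.
split.
- by apply: eq_cintegrable I1 => [|r /set_mem Dr]; [exact: half_line_measurable|exact: E1].
- by apply: eq_cintegrable I2 => [|r /set_mem Dr]; [exact: half_line_measurable|exact: E2].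
- transitivity (cintegral mu D (fun r => cintegral mu D (fun y => (gwts s n r)%:C * Kr n nu th r y))).
    by apply: eq_cint => r /set_mem Dr; rewrite E1.
  by rewrite E; apply: eq_cint => r /set_mem Dr; rewrite E2.
Qed.

End IntegralSide.

(** * Differentiation under the integral sign *)

Section DerivativeUnderIntegral.
Context {d : measure_display} {T : measurableType d} {R : realType}.
Context {mu : {measure set T -> \bar R}} {D : set T} (mD : measurable D).

Lemma is_derive_Rint (f df : R -> T -> R) (g : T -> R) (u v a : R) : u < a < v ->
  (forall r, u < r < v -> mu.-integrable D (EFin \o f r)) ->
  mu.-integrable D (EFin \o g) ->
  (forall r y, u < r < v -> D y -> is_derive r 1 (f^~ y) (df r y)) ->
  (forall r y, u < r < v -> D y -> `|df r y| <= g y) ->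
  is_derive a 1 (fun r => \int[mu]_(y in D) f r y) (\int[mu]_(y in D) df a y).
Proof.
move=> uav fi gi fd fg.
have Ia : (`]u, v[%classic : set R) a by rewrite /= in_itv.
have itvP (r : R) : (`]u, v[%classic : set R) r -> u < r < v by rewrite /= in_itv.
have d1E r y : u < r < v -> D y -> partial1of2 f r y = df r y.
  by move=> ruv Dy; rewrite partial1of2E; have [_] := fd r y ruv Dy.
have H1 r : (`]u, v[%classic : set R) r -> mu.-integrable D (EFin \o f r).
  by move=> /itvP; exact: fi.
have H2 r y : (`]u, v[%classic : set R) r -> D y -> derivable (f^~ y) r 1.
  by move=> /itvP ruv Dy; have [] := fd r y ruv Dy.
have H3 y : 0 <= `|g y| by [].
have H4 : mu.-integrable D (EFin \o (fun y => `|g y|)).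
  by have := integrable_abse gi; apply: eq_integrable => // y _.
have H5 r y : (`]u, v[%classic : set R) r -> D y -> `|partial1of2 f r y| <= `|g y|.
  move=> /itvP ruv Dy; rewrite d1E//; exact: le_trans (fg _ _ ruv Dy) (ler_norm _).
have Dv := derivable_under_integral mD Ia H1 H2 H3 H4 H5.
have Ev := differentiation_under_integral mD Ia H1 H2 H3 H4 H5.
apply: DeriveDef Dv _; rewrite -derive1E Ev.
by apply: eq_Rintegral => y /set_mem Dy; exact: d1E.
Qed.

Lemma cderiv_cint (f df : R -> T -> R[i]) (g : T -> R) (u v a : R) : u < a < v ->
  (forall r, u < r < v -> cintegrable mu D (f r)) ->
  mu.-integrable D (EFin \o g) ->
  (forall r y, u < r < v -> D y -> cderiv (f^~ y) r (df r y)) ->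
  (forall r y, u < r < v -> D y -> cabs (df r y) <= g y) ->
  cderiv (fun r => cintegral mu D (f r)) a (cintegral mu D (df a)).
Proof.
move=> uav fi gi fd fg; split.
  apply: (@is_derive_Rint (fun r y => complex.Re (f r y)) (fun r y => complex.Re (df r y)) g
  u v a uav _ gi).
  - by move=> r ruv; have [] := fi r ruv.
  - by move=> r y ruv Dy; have [] := fd r y ruv Dy.
  - by move=> r y ruv Dy; exact: le_trans (cabs_Re _) (fg r y ruv Dy).
apply: (@is_derive_Rint (fun r y => complex.Im (f r y)) (fun r y => complex.Im (df r y)) g
  u v a uav _ gi).
- by move=> r ruv; have [] := fi r ruv.
- by move=> r y ruv Dy; have [] := fd r y ruv Dy.
- by move=> r y ruv Dy; exact: le_trans (cabs_Im _) (fg r y ruv Dy).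
Qed.

End DerivativeUnderIntegral.

(** * The functions K and I *)

Section ModifiedBesselK.
Context {R : realType}.
Notation mu := (@lebesgue_measure R).
Notation D := (`]0%R, +oo[%classic : set R).
Implicit Types (x y k c : R) (m : R[i]).

Lemma ccontN (f : R -> R[i]) x : ccont f x -> ccont (fun y => - f y) x.
Proof. exact: cvgN. Qed.

Definition kexp x y : R := expR (- (x * (y ^+ 2 + y^-1 ^+ 2))).

Lemma kexp_ge0 x y : 0 <= kexp x y. Proof. exact: expR_ge0. Qed.

Lemma kexp_continuous x y : 0 < y -> {for y, continuous (kexp x)}.
Proof.
move=> y0; apply: (@continuous_comp _ _ _ (fun y => - (x * (y ^+ 2 + y^-1 ^+ 2))) expR).
  apply: continuousN; apply: continuousM; first exact: cvg_cst.
  apply: continuousD; first exact: exprn_continuous.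
  apply: (@continuous_comp _ _ _ (@GRing.inv R) (fun z => z ^+ 2)).
    exact: inv_continuous_pos.
  exact: exprn_continuous.
exact: continuous_expR.
Qed.

Lemma kexp_le x x' y : x <= x' -> kexp x' y <= kexp x y.
Proof. by move=> xx; rewrite ler_expR lerN2 ler_wpM2r// addr_ge0// sqr_ge0. Qed.

Lemma kexpV x y : kexp x y^-1 = kexp x y.
Proof. by rewrite /kexp invrK addrC. Qed.

Lemma kexp_decay c x : 0 < x -> exists M, 0 <= M /\ forall y, 1 <= y ->
  y `^ c * kexp x y <= M * y `^ (- 1 - 1).
Proof.
move=> x0; have c1 : 0 < `|c| + 1 by rewrite ltr_wpDl.
have [M [M1 HM]] := gauss_decay c1 x0; exists M; split; first exact: le_trans M1.
move=> y y1; apply: le_trans (HM _ y1).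
apply: ler_pM; rewrite ?powR_ge0 ?kexp_ge0//.
  by apply: ler_powR => //; rewrite addrK ler_norm.
by rewrite ler_expR lerN2 mulrDr lerDl mulr_ge0 ?sqr_ge0// ltW.
Qed.

Lemma kexp_integrable c x : 0 < x ->
  mu.-integrable D (EFin \o (fun y => y `^ (c - 1) * kexp x y)).
Proof.
move=> x0.
have [M [M0 HM]] := kexp_decay (c - 1) x0.
have [M' [M'0 HM']] := kexp_decay (1 - c) x0.
have nn y : 0 <= y `^ (c - 1) * kexp x y by rewrite mulr_ge0 ?powR_ge0 ?kexp_ge0.
apply: (@integrable_pow _ _ 1 1 (M + M')) => //.
- apply: measurable_half_line => y y0; apply: continuousM; first exact: powR_continuous.
  exact: kexp_continuous.
- move=> y /andP[y0 y1]; rewrite ger0_norm// subrr powRr0 mulr1.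
  have w1 : 1 <= y^-1 by rewrite invr_ge1// unitf_gt0.
  have w0 : 0 < y^-1 by rewrite invr_gt0.
  have -> : y `^ (c - 1) = y^-1 `^ (1 - c).
    rewrite -{1}[y]invrK -(powR_inv1 (ltW w0)) -powRrM; congr powR; ring.
  rewrite -kexpV; apply: le_trans (HM' _ w1) _.
  apply: (@le_trans _ _ M'); last by rewrite lerDr.
  rewrite -[leRHS]mulr1 ler_wpM2l//.
  by rewrite -[leRHS](powRr0 y^-1); apply: ler_powR => //; lra.
- move=> y y1; rewrite ger0_norm//; apply: le_trans (HM _ y1) _.
  by rewrite ler_wpM2r ?powR_ge0// lerDl.
Qed.

(** The Macdonald function K_m(2x), by the substitution v = y^2 in its usual integral
    representation. *)
Definition Kint m x : R[i] := cintegral mu D (fun y => cpow y (2 * m - 1) * (kexp x y)%:C).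

Lemma kint_ccont m x y : 0 < y -> ccont (fun y => cpow y m * (kexp x y)%:C) y.
Proof.
move=> y0; apply: ccontM; first exact: ccont_cpow.
by apply: ccont_real; exact: kexp_continuous.
Qed.

Lemma cabs_kint m x y : 0 < y ->
  cabs (cpow y (2 * m - 1) * (kexp x y)%:C) = y `^ (2 * complex.Re m - 1) * kexp x y.
Proof.
by move=> y0; rewrite cabsM cabs_real ger0_norm ?kexp_ge0// cabs_cpow// Re_2B1.
Qed.

Lemma kint_integrable m x : 0 < x ->
  cintegrable mu D (fun y => cpow y (2 * m - 1) * (kexp x y)%:C).
Proof.
move=> x0; apply: (cintegrable_le half_line_measurable _
  (kexp_integrable (2 * complex.Re m) x0)).
  by apply: cmeas_half_line => y; exact: kint_ccont.
by move=> y /half_lineP y0; rewrite cabs_kint.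
Qed.

Lemma KintN m x : 0 < x -> Kint (- m) x = Kint m x.
Proof.
move=> x0; rewrite /Kint.
pose f m y := cpow y (2 * m - 1) * (kexp x y)%:C.
have E y : 0 < y -> f m y^-1 * (y^-1 * y^-1)%:C = f (- m) y.
  move=> y0; rewrite /f cpowV// /kexp invrK (addrC (y^-1 ^+ 2)) mulrAC; congr (_ * _).
  have -> : (y^-1 * y^-1)%:C = cpow y (- (2%:R)).
    by rewrite cpowN// cpow_nat// -exprVn -fmorphV expr2 rmorphM.
  by rewrite -cpowD//; congr cpow; rewrite -natC /=; ring.
have I1 := kint_integrable m x0; have I2 := kint_integrable (- m) x0.
rewrite [RHS](cint_inv (F := f m))//.
- by apply: eq_cint => y /set_mem/half_lineP y0; rewrite E.
- by move=> y; exact: kint_ccont.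
- apply: (eq_cintegrable half_line_measurable _ I2) => y /set_mem/half_lineP y0.
  by rewrite E.
Qed.

Lemma cderiv_kexp x y : cderiv (fun x => (kexp x y)%:C) x
  (- (y ^+ 2 + y^-1 ^+ 2) * kexp x y)%:C.
Proof.
apply: cderiv_real.
have d1 : is_derive x 1 (fun x : R => - (x * (y ^+ 2 + y^-1 ^+ 2))) (- (y ^+ 2 + y^-1 ^+ 2)).
  have dd := is_deriveN (is_derive_mul (is_derive_id x 1) (is_derive_cst (y ^+ 2 + y^-1 ^+ 2) x 1)).
  by apply: is_derive_eq dd _; rewrite mulr0 add0r mulr1.
have dd := @is_derive1_comp _ expR (fun x => - (x * (y ^+ 2 + y^-1 ^+ 2))) _ _ _
  (is_derive_expR (- (x * (y ^+ 2 + y^-1 ^+ 2)))) d1.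
by apply: is_derive_eq dd _; rewrite /kexp; ring.
Qed.

(** Differentiation brings down -(y^2 + y^(-2)), which moves the order by 1 in both directions; for
    parameters above x/2 the kernel at x/2 dominates. *)
Lemma cderiv_Kint m x : 0 < x -> cderiv (Kint m) x (- (Kint (m + 1) x + Kint (m - 1) x)).
Proof.
move=> x0.
pose g y := y `^ (2 * complex.Re (m + 1) - 1) * kexp (x / 2) y +
            y `^ (2 * complex.Re (m - 1) - 1) * kexp (x / 2) y.
pose df t y := - (cpow y (2 * (m + 1) - 1) * (kexp t y)%:C + cpow y (2 * (m - 1) - 1) * (kexp t y)%:C).
have x2 : 0 < x / 2 by rewrite divr_gt0.
have -> : - (Kint (m + 1) x + Kint (m - 1) x) = cintegral mu D (df x).
  rewrite (cintN half_line_measurable); last first.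
    by apply: (cintegrableD half_line_measurable); exact: kint_integrable.
  by rewrite (cintD half_line_measurable)//; exact: kint_integrable.
apply: (cderiv_cint half_line_measurable (u := x / 2) (v := x + 1) (g := g)).
- by apply/andP; split; lra.
- by move=> t /andP[t1 _]; apply: kint_integrable; exact: lt_trans t1.
- have := integrableD half_line_measurable
    (kexp_integrable (2 * complex.Re (m + 1)) x2) (kexp_integrable (2 * complex.Re (m - 1)) x2).
  by apply: eq_integrable => //; exact: half_line_measurable.
- move=> t y _ /half_lineP y0.
  have dd := cderivZ (cpow y (2 * m - 1)) (cderiv_kexp t y).
  have -> : df t y = cpow y (2 * m - 1) * (- (y ^+ 2 + y^-1 ^+ 2) * kexp t y)%:C.
    have e1 : cpow y (2 * (m + 1) - 1) = cpow y (2 * m - 1) * (y ^+ 2)%:C.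
      by rewrite rmorphXn -cpow_nat// -cpowD//; congr cpow; rewrite -natC /=; ring.
    have e2 : cpow y (2 * (m - 1) - 1) = cpow y (2 * m - 1) * (y^-1 ^+ 2)%:C.
      rewrite rmorphXn fmorphV exprVn -cpow_nat// -cpowN// -cpowD//; congr cpow.
      by rewrite -natC /=; ring.
    have e3 (a b c : R) : (- (a + b) * c)%:C = - (a%:C + b%:C) * c%:C :> R[i].
      by rewrite rmorphM rmorphN rmorphD.
    rewrite /df e1 e2 e3.
    move: (cpow _ _) (y ^+ 2)%:C (y^-1 ^+ 2)%:C (kexp t y)%:C => a b c e; ring.
  exact: dd.
- move=> t y /andP[t1 _] /half_lineP y0; rewrite /df cabsN.
  apply: le_trans (cabs_triangle _ _) _; rewrite !cabs_kint// /g.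
  by apply: lerD; rewrite ler_wpM2l ?powR_ge0// kexp_le// ltW.
Qed.

Lemma cderiv_kexp_var x y : 0 < y ->
  cderiv (fun y => (kexp x y)%:C) y (- (2 * x) * (y - y^-1 * y^-1 ^+ 2) * kexp x y)%:C.
Proof.
move=> y0; apply: cderiv_real; have yn : y != 0 by rewrite gt_eqF.
have dV := is_deriveV yn (is_derive_id y 1).
have dy := is_derive_mul (is_derive_id y 1) (is_derive_id y 1).
have dVV := is_derive_mul dV dV.
have d1 : is_derive y 1 (fun y : R => - (x * (y ^+ 2 + y^-1 ^+ 2)))
    (- (2 * x) * (y - y^-1 * y^-1 ^+ 2)).
  have dd := is_deriveN (is_derive_mul (is_derive_cst x y 1) (is_deriveD dy dVV)).
  by apply: is_derive_eq dd _ => /=; rewrite /GRing.scale /=; field.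
have dd := @is_derive1_comp _ expR (fun y => - (x * (y ^+ 2 + y^-1 ^+ 2))) _ _ _
  (is_derive_expR (- (x * (y ^+ 2 + y^-1 ^+ 2)))) d1.
by apply: is_derive_eq dd _; rewrite /kexp; ring.
Qed.

(** Integration of the derivative of y^(2m) e^(-x(y^2 + y^(-2))), a function that vanishes at both
    ends whatever m is. *)
Lemma Kint_rec m x : 0 < x -> m * Kint m x = x%:C * (Kint (m + 1) x - Kint (m - 1) x).
Proof.
move=> x0.
pose f s y := cpow y (2 * s - 1) * (kexp x y)%:C.
pose F y := cpow y (2 * m) * (kexp x y)%:C.
have If s := kint_integrable s x0.
have FE y : 0 < y -> 2 * m * f m y - 2 * x%:C * (f (m + 1) y - f (m - 1) y) =
   cpow y (2 * m) * (- (2 * x) * (y - y^-1 * y^-1 ^+ 2) * kexp x y)%:C +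
   (kexp x y)%:C * (2 * m * cpow y (2 * m - 1)).
  move=> y0.
  have e1 : cpow y (2 * (m + 1) - 1) = cpow y (2 * m) * y%:C.
    by rewrite -(cpow1 y0) -cpowD//; congr cpow; ring.
  have e2 : cpow y (2 * (m - 1) - 1) = cpow y (2 * m) * (y^-1 * y^-1 ^+ 2)%:C.
    rewrite -exprS rmorphXn fmorphV exprVn -cpow_nat// -cpowN// -cpowD//; congr cpow.
    by rewrite -natC /=; ring.
  have e3 (a b c d : R) : (- (2 * a) * (b - c) * d)%:C = - (2 * a%:C) * (b%:C - c%:C) * d%:C :> R[i].
    by rewrite !rmorphM rmorphN rmorphB rmorphM rmorph_nat.
  rewrite /f e1 e2 e3.
  move: (cpow _ _) (cpow _ _) x%:C y%:C (y^-1 * _)%:C (kexp x y)%:C => a b c e g h; ring.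
have I1 : cintegrable mu D (fun y => 2 * m * f m y).
  exact: (cintegrableZ half_line_measurable (2 * m) (If m)).
have I2 : cintegrable mu D (fun y => f (m + 1) y - f (m - 1) y).
  exact: (cintegrableD half_line_measurable (If _) (cintegrableN half_line_measurable (If _))).
have I3 : cintegrable mu D (fun y => 2 * x%:C * (f (m + 1) y - f (m - 1) y)).
  exact: (cintegrableZ half_line_measurable (2 * x%:C) I2).
pose s := complex.Re (2 * m).
have [M [M0 HM]] := kexp_decay s x0.
have [M' [M'0 HM']] := kexp_decay (- s) x0.
have cF y : 0 < y -> cabs (F y) = y `^ s * kexp x y.
  by move=> y0; rewrite /F cabsM cabs_real ger0_norm ?kexp_ge0// cabs_cpow.
have lim0 (C : R) : (fun n => C * (n.+1%:R^-1 : R) `^ 2) @ \oo --> 0.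
  rewrite -[X in _ --> X](mulr0 C); apply: cvgM; first exact: cvg_cst.
  exact: cvg_powR_exh_left.
have powE n : (n.+1%:R : R) `^ (- 1 - 1) = n.+1%:R^-1 `^ 2.
  by rewrite -(powR_inv1 (ler0n _ n.+1)) -powRrM; congr powR; ring.
have n1 n : 1 <= n.+1%:R :> R by rewrite ler1n.
have E := @cint_FTC_half_line _ F
  (fun y => 2 * m * f m y - 2 * x%:C * (f (m + 1) y - f (m - 1) y)) 0 0.
have {}E : cintegral mu D (fun y => 2 * m * f m y - 2 * x%:C * (f (m + 1) y - f (m - 1) y)) = 0 - 0.
  apply: E.
  - move=> y y0; apply: ccontD.
      by apply: ccontM; [exact: ccont_cst|exact: kint_ccont].
    apply: ccontN; apply: ccontM; first exact: ccont_cst.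
    by apply: ccontD; [exact: kint_ccont|apply: ccontN; exact: kint_ccont].
  - move=> y y0; rewrite FE//.
    apply: (cderivM _ (cderiv_kexp_var x y0)).
    exact: cderiv_cpow.
  - exact: (cintegrableD half_line_measurable I1 (cintegrableN half_line_measurable I3)).
  - apply: (cvg_cabs0 _ (lim0 M')) => n.
    rewrite cF ?invr_gt0// kexpV -powE.
    apply: le_trans (HM' _ (n1 n)); rewrite ler_wpM2r ?kexp_ge0//.
    by rewrite -(powR_inv1 (ler0n _ n.+1)) -powRrM mulN1r.
  - apply: (cvg_cabs0 _ (lim0 M)) => n.
    by rewrite cF// -powE; exact: HM.
rewrite subr0 in E.
have /eqP : 2 * m * Kint m x - 2 * x%:C * (Kint (m + 1) x - Kint (m - 1) x) = 0.
  rewrite -E (cintB half_line_measurable I1 I3) (cintZ half_line_measurable _ (If m)).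
  rewrite (cintZ half_line_measurable _ I2) (cintB half_line_measurable (If _) (If _)).
  by [].
rewrite subr_eq0 -!mulrA => /eqP.
by apply: mulfI; rewrite pnatr_eq0.
Qed.

End ModifiedBesselK.

(** * Behaviour of K at 0 *)

Section KintLimits.
Context {R : realType}.
Notation mu := (@lebesgue_measure R).
Notation D := (`]0%R, +oo[%classic : set R).
Implicit Types (x y k c r : R) (m : R[i]).

Let H m x r : R[i] := cpow r (2 * m - 1) * (expR (- (r ^+ 2 + x ^+ 2 * r^-1 ^+ 2)))%:C.

Let H_le m x r : 0 < r -> cabs (H m x r) <=
  cabs (cpow r (2 * m - 1) * (expR (- (1 * r ^+ 2)))%:C).
Proof.
move=> r0; rewrite !cabsM ler_wpM2l ?cabs_ge0// !cabs_real !ger0_norm ?expR_ge0//.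
by rewrite ler_expR lerN2 mul1r lerDl mulr_ge0 ?sqr_ge0.
Qed.

Let H_ccont m x r : 0 < r -> ccont (H m x) r.
Proof.
move=> r0; apply: ccontM; first exact: ccont_cpow.
apply: ccont_real; apply: (@continuous_comp _ _ _ (fun r => - (r ^+ 2 + x ^+ 2 * r^-1 ^+ 2)) expR).
  apply: continuousN; apply: continuousD; first exact: exprn_continuous.
  apply: continuousM; first exact: cvg_cst.
  apply: (@continuous_comp _ _ _ (@GRing.inv R) (fun z => z ^+ 2)).
    exact: inv_continuous_pos.
  exact: exprn_continuous.
exact: continuous_expR.
Qed.

Let H_integrable m x : 0 < complex.Re m -> cintegrable mu D (H m x).
Proof.
move=> m0; have I := cintegrable_cabs half_line_measurable (gint_integrable m0 ltr01).
apply: (cintegrable_le half_line_measurable _ I) => [|r /half_lineP r0]; last exact: H_le.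
by apply: cmeas_half_line => r; exact: H_ccont.
Qed.

(** The substitution y = r / sqrt x moves x out of the main exponential; as x tends to 0 the new
    kernel tends, from below, to that of Euler's integral. *)
Lemma Kint_scale m x : 0 < complex.Re m -> 0 < x ->
  cpow x m * Kint m x = cintegral mu D (H m x).
Proof.
move=> m0 x0; pose c := Num.sqrt x^-1.
have xV : 0 < x^-1 by rewrite invr_gt0.
have c0 : 0 < c by rewrite sqrtr_gt0.
have c2 : c ^+ 2 = x^-1 by rewrite sqr_sqrtr// ltW.
have E r : 0 < r -> cpow (c * r) (2 * m - 1) * (kexp x (c * r))%:C = cpow c (2 * m - 1) * H m x r.
  move=> r0; rewrite cpowM// -mulrA; congr (_ * (_ * (expR _)%:C)).
  have cV : c^-1 ^+ 2 = x by rewrite exprVn c2 invrK.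
  rewrite invfM !exprMn c2 cV mulrDr !mulrA divff ?mul1r ?gt_eqF//.
have E2 : cintegral mu D (fun r => cpow (c * r) (2 * m - 1) * (kexp x (c * r))%:C) =
    cpow c (2 * m - 1) * cintegral mu D (H m x).
  rewrite -(cintZ half_line_measurable _ (H_integrable x m0)).
  by apply: eq_cint => r /set_mem/half_lineP r0; rewrite E.
have E3 := @cint_scale R (fun y => cpow y (2 * m - 1) * (kexp x y)%:C) c c0
  (fun y => @kint_ccont R (2 * m - 1) x y) (kint_integrable m x0).
rewrite /Kint E3 ?E2.
  have e : c%:C * cpow c (2 * m - 1) = cpow x (- m).
    rewrite -(cpow1 c0) -cpowD// -(cpowV _ x0) -c2 cpow_exp//; congr cpow; ring.
  by rewrite [c%:C * _]mulrA e mulrA -cpowD// subrr cpow0// mul1r.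
have := cintegrableZ half_line_measurable (cpow c (2 * m - 1)) (H_integrable x m0).
by apply: (eq_cintegrable half_line_measurable) => r /set_mem/half_lineP r0; rewrite E.
Qed.

(** Limits at 0 from the right are taken along this sequence only, which is enough to identify a
    constant function. *)
Definition seq0 (n : nat) : R := n.+1%:R^-1.

Lemma seq0_gt0 n : 0 < seq0 n.
Proof. by rewrite invr_gt0. Qed.

Lemma seq0_sqr_cvg : (fun n => seq0 n ^+ 2) @ \oo --> 0.
Proof.
rewrite -[X in _ --> X](mul0r 0); under eq_fun do rewrite expr2.
by apply: cvgM; exact: cvg_exh_left.
Qed.

Lemma Kint_cvg m : 0 < complex.Re m ->
  (cpow (seq0 n) m * Kint m (seq0 n) : R[i]^o) @[n --> \oo] --> (gint m 1 : R[i]^o).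
Proof.
move=> m0; have I := cintegrable_cabs half_line_measurable (gint_integrable m0 ltr01).
have H1 := @cint_dominated _ _ _ mu D half_line_measurable (fun n => H m (seq0 n))
  (fun r => cpow r (2 * m - 1) * (expR (- (1 * r ^+ 2)))%:C) _ _ _ _ I.
under eq_fun do rewrite (Kint_scale m0 (seq0_gt0 _)).
apply: H1.
- by move=> n; apply: cmeas_half_line => r; exact: H_ccont.
- exact: cintegrable_cmeas (gint_integrable m0 ltr01).
- move=> r /half_lineP r0.
  apply/ccvgP.
  have C0 := cabs_ge0 (cpow r (2 * m - 1)).
  rewrite (_ : (fun n => _) = (fun n => cabs (cpow r (2 * m - 1)) *
     `|expR (- (r ^+ 2 + seq0 n ^+ 2 * r^-1 ^+ 2)) - expR (- (1 * r ^+ 2))|)); last first.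
    by apply/funext => n; rewrite /H -mulrBr cabsM -rmorphB cabs_real.
  rewrite -[X in _ --> X](mulr0 (cabs (cpow r (2 * m - 1)))).
  apply: cvgM; first exact: cvg_cst.
  rewrite -(normr0 R) -[X in `|X|](subrr (expR (- (1 * r ^+ 2)))).
  apply: cvg_norm; apply: cvgB; last exact: cvg_cst.
  apply: (@cvg_comp _ _ _ (fun n => - (r ^+ 2 + seq0 n ^+ 2 * r^-1 ^+ 2)) expR _
    (nbhs (- (1 * r ^+ 2)))); last exact: continuous_expR.
  apply: cvgN; rewrite mul1r -[X in _ --> X]addr0 -(mul0r (r^-1 ^+ 2)).
  apply: cvgD; first exact: cvg_cst.
  by apply: cvgM; [exact: seq0_sqr_cvg|exact: cvg_cst].
- by move=> n r /half_lineP r0; exact: H_le.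
Qed.

Lemma ccvgM (T : Type) (F : set_system T) {FF : Filter F} (f g : T -> R[i]) a b :
  ((f x : R[i]^o) @[x --> F] --> (a : R[i]^o)) ->
  ((g x : R[i]^o) @[x --> F] --> (b : R[i]^o)) ->
  ((f x * g x : R[i]^o) @[x --> F] --> (a * b : R[i]^o)).
Proof. exact: cvgM. Qed.

Lemma cpow_cvg0 (s : R[i]) : 0 < complex.Re s ->
  (cpow (seq0 n) s : R[i]^o) @[n --> \oo] --> (0 : R[i]^o).
Proof.
move=> s0; apply: (cvg_cabs0 _ (cvg_powR_exh_left s0)) => n.
by rewrite cabs_cpow ?seq0_gt0.
Qed.

Lemma Kint_cvg0 m : m != 0 -> -1 < complex.Re m < 1 ->
  (cpow (seq0 n) (m + 2) * Kint m (seq0 n) : R[i]^o) @[n --> \oo] --> (0 : R[i]^o).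
Proof.
move=> mn /andP[m1 m2].
have h1 : 0 < complex.Re (m + 1) by rewrite cReD /=; lra.
have h2 : 0 < complex.Re (1 - m) by rewrite cReB /=; lra.
have h3 : 0 < complex.Re (2 * (m + 1)) by rewrite -natC cReZ mulr_gt0.
have E n : cpow (seq0 n) (m + 2) * Kint m (seq0 n) = m^-1 *
  (cpow (seq0 n) 2%:R * (cpow (seq0 n) (m + 1) * Kint (m + 1) (seq0 n))
   - cpow (seq0 n) (2 * (m + 1)) * (cpow (seq0 n) (1 - m) * Kint (1 - m) (seq0 n))).
  have x0 := seq0_gt0 n; move: (seq0 n) x0 => x x0.
  apply: (mulfI mn); rewrite mulVKf// mulrCA Kint_rec//.
  rewrite -[Kint (m - 1) x]KintN// opprB.
  have e1 : cpow x 2%:R * cpow x (m + 1) = cpow x (m + 2) * x%:C.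
    by rewrite -[in RHS](cpow1 x0) -!cpowD//; congr cpow; ring.
  have e2 : cpow x (2 * (m + 1)) * cpow x (1 - m) = cpow x (m + 2) * x%:C.
    by rewrite -[in RHS](cpow1 x0) -!cpowD//; congr cpow; ring.
  by rewrite !mulrA e1 e2 mulrBr.
under eq_fun => n do rewrite E.
have -> : 0 = m^-1 * (0 * gint (m + 1) 1 - 0 * gint (1 - m) 1).
  by rewrite !mul0r subr0 mulr0.
apply: ccvgM; first exact: cvg_cst.
apply: cvgB; apply: ccvgM.
- by apply: cpow_cvg0; rewrite cRe_nat.
- exact: Kint_cvg.
- exact: cpow_cvg0.
- exact: Kint_cvg.
Qed.

End KintLimits.

(** * The function I and the Wronskians *)

Section ModifiedBesselI.
Context {R : realType}.
Implicit Types (x y r t : R) (m : R[i]) (k : nat) (c : nat -> R[i]).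

Lemma realCM x y : (x * y)%:C = x%:C * y%:C :> R[i]. Proof. exact: rmorphM. Qed.
Lemma realCN x : (- x)%:C = - x%:C :> R[i]. Proof. exact: rmorphN. Qed.
Lemma realCX x k : (x ^+ k)%:C = x%:C ^+ k :> R[i]. Proof. exact: rmorphXn. Qed.
Lemma realCV x : (x^-1)%:C = x%:C^-1 :> R[i]. Proof. exact: fmorphV. Qed.

(** Growth at most geometric: the exponential generating function is then entire and can be
    differentiated term by term. *)
Definition geom (c : nat -> R[i]) : Prop :=
  exists C B, [/\ 0 <= C, 0 <= B & forall k, cabs (c k) <= C * B ^+ k].

Definition egf_term (c : nat -> R[i]) t k : R[i] := (t ^+ k / k`!%:R)%:C * c k.

Definition egf c t : R[i] := csum (egf_term c t).

Lemma geomS c : geom c -> geom (fun k => c k.+1).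
Proof.
move=> [C [B [C0 B0 H]]]; exists (C * B), B; split; rewrite ?mulr_ge0// => k.
by rewrite -mulrA -exprS.
Qed.

Lemma egf_term_le (c : nat -> R[i]) (C B : R) : (forall k, cabs (c k) <= C * B ^+ k) ->
  forall t M k, `|t| <= M -> cabs (egf_term c t k) <= C * exp_coeff (B * M) k.
Proof.
move=> HC t M k tM; rewrite /egf_term cabsM cabs_real.
have f0 : 0 < k`!%:R :> R by rewrite ltr0n fact_gt0.
rewrite normrM normfV (ger0_norm (ltW f0)) normrX /exp_coeff /= exprMn.
have -> : C * (B ^+ k * M ^+ k / k`!%:R) = M ^+ k / k`!%:R * (C * B ^+ k) by ring.
apply: ler_pM; rewrite ?cabs_ge0 ?divr_ge0 ?exprn_ge0 ?(ltW f0)//.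
rewrite ler_wpM2r ?invr_ge0 ?(ltW f0)//.
by rewrite lerXn2r// ?nnegrE//; apply: le_trans tM.
Qed.

Lemma egf_abssum c t : geom c -> abssum (egf_term c t).
Proof.
move=> [C [B [C0 B0 HC]]].
apply: (abssum_le (fun n => egf_term_le HC n (lexx `|t|))).
exact: is_cvg_seriesZ (is_cvg_series_exp_coeff _).
Qed.

Lemma abssum_shift (f : nat -> R[i]) : abssum (fun n => f n.+1) -> abssum f.
Proof.
move=> sf; apply/cvg_ex; exists (cabs (f 0) + limn (series (fun n => cabs (f n.+1)))).
rewrite -(cvg_shiftS (series (fun n => cabs (f n)))).
rewrite (_ : (fun n => _) = fun n => cabs (f 0) + series (fun n => cabs (f n.+1)) n).
  by apply: cvgD; [exact: cvg_cst|].
by apply/funext => n; rewrite /series /= big_nat_recl.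
Qed.

Lemma csum_eq0 (f : nat -> R[i]) : (forall n, f n = 0) -> csum f = 0.
Proof.
move=> f0; apply: climE; apply: cvg_near_cst; apply: nearW => n.
by rewrite /series /= big1.
Qed.

Lemma csum1 (f : nat -> R[i]) : abssum f -> (forall n, f n.+1 = 0) -> csum f = f 0.
Proof. by move=> sf f0; rewrite csum_recl// csum_eq0// addr0. Qed.

Lemma egf0 c : geom c -> egf c 0 = c 0.
Proof.
move=> gc; rewrite /egf csum1//; last by move=> n; rewrite /egf_term expr0n mul0r mul0r.
  by rewrite /egf_term expr0 divr1 mul1r.
exact: egf_abssum.
Qed.

Definition isr_coef m k : R[i] := rGamma (m + k%:R + 1).

Definition isr m t : R[i] := egf (isr_coef m) t.

Lemma isr_geom m : geom (isr_coef m).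
Proof.
have [C HC] := rGamma_bound (m + 1); exists C, 1.
split => //; first by apply: le_trans (HC 0); exact: cabs_ge0.
by move=> k; rewrite expr1n mulr1 /isr_coef addrAC.
Qed.

Lemma isr_abssum m t : abssum (egf_term (isr_coef m) t).
Proof. exact: egf_abssum (isr_geom m). Qed.

Lemma isr0 m : isr m 0 = rGamma (m + 1).
Proof. by rewrite /isr (egf0 (isr_geom m)) /isr_coef addr0. Qed.

Lemma isr_rec m t : isr (m - 1) t = m * isr m t + t%:C * isr (m + 1) t.
Proof.
(* The functional equation of [rGamma] brings out the factor m + k. The part with k cancels against
   k! and is a series starting one place later, which is [b]. *)
pose b k : R[i] := if k is j.+1 then t%:C * egf_term (isr_coef (m + 1)) t j else 0.
have E k : egf_term (isr_coef (m - 1)) t k = m * egf_term (isr_coef m) t k + b k.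
  have g1 : rGamma (m - 1 + k%:R + 1) = (m + k%:R) * rGamma (m + k%:R + 1).
    by rewrite -rGammaS; congr rGamma; ring.
  rewrite /egf_term /isr_coef g1 /b; case: k {g1} => [|k]; first by rewrite addr0; ring.
  rewrite /egf_term /isr_coef exprS factS natrM.
  have -> : m + 1 + k%:R + 1 = m + k.+1%:R + 1 by rewrite -(natr1 k); ring.
  have e : (t * t ^+ k / (k.+1%:R * k`!%:R))%:C * k.+1%:R = t%:C * (t ^+ k / k`!%:R)%:C :> R[i].
    have k0 : k.+1%:R != 0 :> R by rewrite pnatr_eq0.
    have f0 : k`!%:R != 0 :> R by rewrite pnatr_eq0 -lt0n fact_gt0.
    have eR : t * t ^+ k / (k.+1%:R * k`!%:R) * k.+1%:R = t * (t ^+ k / k`!%:R).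
      by move: k.+1%:R k0 k`!%:R f0 => a a0 c c0; field; rewrite a0 c0.
    transitivity ((t * t ^+ k / (k.+1%:R * k`!%:R) * k.+1%:R)%:C : R[i]).
      by rewrite [RHS]realCM natC.
    by rewrite eR realCM.
  have split_sum (a g n : R[i]) : a * ((m + n) * g) = m * (a * g) + a * n * g by ring.
  by rewrite split_sum e -[t%:C * _ * _]mulrA.
have bS : abssum b by apply: abssum_shift; apply: abssumZ; exact: isr_abssum.
rewrite {1}/isr /egf (eq_csum E) (csumD (abssumZ (c := m) (@isr_abssum m t)) bS).
rewrite (csumZ _ (@isr_abssum m t)) (csum_recl bS) /b add0r.
by rewrite (csumZ _ (@isr_abssum (m + 1) t)).
Qed.

Lemma is_derive_exprn_fact k t :
  is_derive t 1 (fun t : R => t ^+ k.+1 / k.+1`!%:R) (t ^+ k / k`!%:R).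
Proof.
have dX : is_derive t 1 (fun t : R => t ^+ k.+1) (k.+1%:R * t ^+ k).
  elim: k => [|k IH].
    by apply: is_derive_eq (is_derive_id t 1) _; rewrite expr0 mulr1.
  have dd := is_derive_mul (is_derive_id t (1 : R)) IH.
  by apply: is_derive_eq dd _ => /=; rewrite -(natr1 k.+1) !exprS; ring.
have dd := is_derive_mul dX (is_derive_cst (k.+1`!%:R^-1 : R) t 1).
apply: is_derive_eq dd _ => /=; rewrite mulr0 add0r factS natrM.
have k0 : k.+1%:R != 0 :> R by rewrite pnatr_eq0.
have f0 : k`!%:R != 0 :> R by rewrite pnatr_eq0 -lt0n fact_gt0.
by move: k.+1%:R k0 k`!%:R f0 => a a0 c c0; field; rewrite a0 c0.
Qed.

(** Differentiation under the integral sign for the counting measure; the derivative of term k + 1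
    is term k of the shifted sequence. *)
Lemma cderiv_egf c t : geom c -> cderiv (egf c) t (egf (fun k => c k.+1) t).
Proof.
move=> gc; pose M := `|t| + 1.
have gS := geomS gc; have [C [B [C0 B0 HC]]] := gS.
pose df r k : R[i] := if k is j.+1 then egf_term (fun k => c k.+1) r j else 0.
pose g k : R := if k is j.+1 then C * exp_coeff (B * M) j else 0.
have M0 : 0 <= M by rewrite addr_ge0.
have g0 k : 0 <= g k by case: k => [|k] //=; rewrite mulr_ge0// exp_coeff_ge0// mulr_ge0.
have dS r : abssum (df r) by apply: abssum_shift; exact: egf_abssum.
have gs : abssum (fun k => (g k)%:C).
  apply: abssum_shift; apply: (@abssum_le _ _ (fun n => C * exp_coeff (B * M) n)).
    by move=> n; rewrite cabs_real ger0_norm.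
  exact: is_cvg_seriesZ (is_cvg_series_exp_coeff _).
have -> : egf (fun k => c k.+1) t = cintegral (@counting nat R) setT (df t).
  by rewrite -csumE// csum_recl// add0r.
rewrite (_ : egf c = fun r => cintegral (@counting nat R) setT (egf_term c r)); last first.
  by apply/funext => r; rewrite -csumE//; exact: egf_abssum.
apply: (@cderiv_cint _ _ R (@counting nat R) setT measurableT (egf_term c) df g (t - 1) (t + 1)).
- by apply/andP; split; lra.
- by move=> r _; apply: cintegrable_counting; exact: egf_abssum.
- exact: integrable_counting (proj1 (cabs_real_cplx g) gs).
- move=> r [|k] _ _.
    have := cderiv_cst (egf_term c r 0) r; rewrite /egf_term.
    by under eq_fun do rewrite expr0.
  rewrite /egf_term /df /egf_term.
  set w := c k.+1; have := cderivZ w (cderiv_real (is_derive_exprn_fact k r)).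
  rewrite mulrC; rewrite (_ : (fun y => w * _) = fun y => (y ^+ k.+1 / k.+1`!%:R)%:C * w)//.
  by apply/funext => y; rewrite mulrC.
- move=> r [|k] /andP[r1 r2] _; first by rewrite cabs0.
  apply: egf_term_le => //; rewrite /M ler_norml; have := ler_norm t; have := ler_norm (- t).
  by rewrite normrN => h1 h2; apply/andP; split; lra.
Qed.

Lemma cderiv_isr m t : cderiv (isr m) t (isr (m + 1) t).
Proof.
have := cderiv_egf t (isr_geom m); rewrite /isr.
rewrite (_ : (fun k => isr_coef m k.+1) = isr_coef (m + 1))//.
by apply/funext => k; rewrite /isr_coef -(natr1 k); congr rGamma; ring.
Qed.

(** The modified Bessel function I_m(2x); the doubled argument is the one of [Kint]. *)
Definition ImB m x : R[i] := cpow x m * isr m (x ^+ 2).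

Lemma ImB_rec m x : 0 < x -> ImB (m - 1) x = m / x%:C * ImB m x + ImB (m + 1) x.
Proof.
move=> x0; rewrite /ImB isr_rec rmorphXn /= cpowD// cpowN// cpow1// [cpow x (m + 1)]cpowD// cpow1//.
have xn : x%:C != 0 :> R[i] by rewrite (inj_eq (@complexI R)) gt_eqF.
by move: x%:C xn (cpow _ _) (isr _ _) (isr _ _) => a a0 b c d; field.
Qed.

Lemma cderiv_ImB m x : 0 < x ->
  cderiv (ImB m) x (m / x%:C * ImB m x + 2 * ImB (m + 1) x).
Proof.
move=> x0.
have d2 := is_derive_mul (is_derive_id x (1 : R)) (is_derive_id x (1 : R)).
have d1 : cderiv (fun x => isr m (x ^+ 2)) x (2 * x%:C * isr (m + 1) (x ^+ 2)).
  have [h1 h2] := cderiv_isr m (x ^+ 2); rewrite -natC -rmorphM.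
  have d3 : is_derive x 1 (fun x : R => x ^+ 2) (2 * x).
    by apply: is_derive_eq d2 _ => /=; ring.
  split.
    by apply: is_derive_eq (@is_derive1_comp _ (fun t => complex.Re (isr m t)) (fun x => x ^+ 2) x _ _ h1 d3) _; rewrite cReZ mulrC.
  by apply: is_derive_eq (@is_derive1_comp _ (fun t => complex.Im (isr m t)) (fun x => x ^+ 2) x _ _ h2 d3) _; rewrite cImZ mulrC.
have dd := cderivM (cderiv_cpow m x0) d1.
have -> : m / x%:C * ImB m x + 2 * ImB (m + 1) x =
  cpow x m * (2 * x%:C * isr (m + 1) (x ^+ 2)) + isr m (x ^+ 2) * (m * cpow x (m - 1)).
  rewrite /ImB cpowD// [cpow x (m - 1)]cpowD// cpowN// !cpow1//.
  by move: x%:C (cpow _ _) (isr _ _) (isr _ _) => a b c d; ring.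
exact: dd.
Qed.

Lemma cderiv_ImBS m x : 0 < x ->
  cderiv (ImB (m + 1)) x (2 * ImB m x - (m + 1) / x%:C * ImB (m + 1) x).
Proof.
move=> x0; have := cderiv_ImB (m + 1) x0; have := ImB_rec (m + 1) x0.
rewrite addrK => ->; set a := _ / _ * _; set b := ImB _ _.
by have -> : a + 2 * b = 2 * (a + b) - a by ring.
Qed.

(* The Abel identity for the first-order system satisfied by the pairs
   (K_m, K_(m+1)) and (I_(-m), - I_(-m-1)). *)
Lemma wronskian_deriv m (P Q : R -> R[i]) x : 0 < x ->
  cderiv P x (m / x%:C * P x - 2 * Q x) ->
  cderiv Q x (- (2 * P x + (m + 1) / x%:C * Q x)) ->
  cderiv (fun x => x%:C * (ImB m x * Q x + ImB (m + 1) x * P x)) x 0.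
Proof.
move=> x0 dP dQ.
have dx := cderiv_real (is_derive_id x (1 : R)).
have dd := cderivM dx (cderivD (cderivM (cderiv_ImB m x0) dQ) (cderivM (cderiv_ImBS m x0) dP)).
have xn : x%:C != 0 :> R[i] by rewrite (inj_eq (@complexI R)) gt_eqF.
move: dd; rewrite [X in cderiv _ _ X](_ : _ = 0)// (_ : 1%:C = 1)//.
by move: x%:C xn (ImB _ _) (ImB _ _) (P x) (Q x) => a a0 b c e f; field.
Qed.

Lemma cderiv0_cst (F : R -> R[i]) l : (forall x, 0 < x -> cderiv F x 0) ->
  (F (seq0 n) : R[i]^o) @[n --> \oo] --> (l : R[i]^o) -> forall x, 0 < x -> F x = l.
Proof.
move=> dF Fl.
have H (a b : R) : 0 < a -> a < b -> F a = F b.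
  move=> a0 ab; suff : F b - F a = 0 by move/eqP; rewrite subr_eq0 => /eqP.
  rewrite -(@cint_FTC R F (fun=> 0) a b ab).
  - by rewrite /cintegral /= /Rintegral integral0.
  - by move=> x _; exact: ccont_cst.
  - by move=> x /andP[ax _]; apply: dF; exact: lt_le_trans ax.
move=> x x0; apply: (cvg_unique (@norm_hausdorff _ R[i]^o) _ Fl).
rewrite (_ : (fun n => F (seq0 n)) = fun=> F x); first exact: cvg_cst.
apply/funext => n; have := @seq0_gt0 R n; move: (seq0 n) => y y0.
by have [/H->|/H->|->] := ltgtP x y.
Qed.

Lemma cderivN (F : R -> R[i]) x (l : R[i]) : cderiv F x l -> cderiv (fun y => - F y) x (- l).
Proof.
move=> dF; have := cderivZ (-1) dF.
by rewrite mulN1r (_ : (fun y => -1 * F y) = (fun y => - F y))//; apply/funext => y; rewrite mulN1r.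
Qed.

Lemma isr_seq0_cvg m : (isr m (seq0 n ^+ 2) : R[i]^o) @[n --> \oo] --> (rGamma (m + 1) : R[i]^o).
Proof.
rewrite -isr0; apply: (@cvg_comp _ _ _ (fun n => seq0 n ^+ 2) (isr m) _ (nbhs (0 : R))).
  exact: seq0_sqr_cvg.
exact: cderiv_ccont (cderiv_isr m 0).
Qed.

Lemma real_neq0 x : 0 < x -> x%:C != 0 :> R[i].
Proof. by move=> x0; rewrite (inj_eq (@complexI R)) gt_eqF. Qed.

Lemma gint_rGamma m : 0 < complex.Re m -> rGamma m * gint m 1 = 2^-1.
Proof.
move=> m0; have := gam_rGamma m0; rewrite /gam mulrCA => H.
by apply: (mulfI (_ : 2 != 0)); rewrite ?H ?divff// pnatr_eq0.
Qed.

(** The expression is constant by the Abel identity. At 0 only the product of I_m and K_(m+1)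
    survives, with limit Euler's integral times [rGamma] at m + 1; the other product carries an
    extra power of x. *)
Lemma wronskian_K m x : m != 0 -> -1 < complex.Re m < 1 -> 0 < x ->
  x%:C * (ImB m x * Kint (m + 1) x + ImB (m + 1) x * Kint m x) = 2^-1.
Proof.
move=> mn hm; move: x; apply: cderiv0_cst => [x x0|].
  apply: wronskian_deriv => //.
    have -> : m / x%:C * Kint m x - 2 * Kint (m + 1) x = - (Kint (m + 1) x + Kint (m - 1) x).
      by rewrite mulrAC Kint_rec// mulrAC divff ?real_neq0// mul1r; move: (Kint _ _) (Kint _ _) => a b; ring.
    exact: cderiv_Kint.
  have -> : - (2 * Kint m x + (m + 1) / x%:C * Kint (m + 1) x) = - (Kint (m + 1 + 1) x + Kint (m + 1 - 1) x).
    rewrite mulrAC Kint_rec// mulrAC divff ?real_neq0// mul1r addrK.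
    by move: (Kint _ _) (Kint _ _) => a b; ring.
  exact: cderiv_Kint.
have m1 : 0 < complex.Re (m + 1) by rewrite cReD /=; move: hm => /andP[h1 h2]; lra.
have -> : 2^-1 = rGamma (m + 1) * gint (m + 1) 1 + rGamma (m + 1 + 1) * 0 :> R[i].
  by rewrite gint_rGamma// mulr0 addr0.
rewrite (_ : (fun n => _) = fun n => isr m (seq0 n ^+ 2) * (cpow (seq0 n) (m + 1) * Kint (m + 1) (seq0 n))
   + isr (m + 1) (seq0 n ^+ 2) * (cpow (seq0 n) (m + 2) * Kint m (seq0 n))).
  apply: cvgD; apply: ccvgM.
  - exact: isr_seq0_cvg.
  - exact: Kint_cvg.
  - exact: isr_seq0_cvg.
  - exact: Kint_cvg0.
apply/funext => n; have := @seq0_gt0 R n; move: (seq0 n) => x x0.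
rewrite /ImB !cpowD// cpow1//.
by move: x%:C (cpow _ _) (isr _ _) (isr _ _) (Kint _ _) (Kint _ _) => a b c d e f; ring.
Qed.

(** The constant is again found at 0, where the leading coefficients multiply to 1/(Gamma(1-m)
    Gamma(m)); the reflection formula turns this into the sine. *)
Lemma wronskian_I m x : m != 0 -> 0 < x ->
  x%:C * (ImB (- m) x * ImB (m - 1) x - ImB (1 - m) x * ImB m x) = csin (pi%:C * m) / pi%:C.
Proof.
move=> mn x0.
have H : forall x, 0 < x -> x%:C * (ImB (- m) x * - ImB (m - 1) x + ImB (- m + 1) x * ImB m x) =
    - (csin (pi%:C * m) / pi%:C).
  apply: cderiv0_cst => [y y0|].
    apply: wronskian_deriv => //.
      have -> : - m / y%:C * ImB m y - 2 * - ImB (m - 1) y = m / y%:C * ImB m y + 2 * ImB (m + 1) y.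
        by rewrite ImB_rec//; move: y%:C (ImB _ _) (ImB _ _) => a b c; ring.
      exact: cderiv_ImB.
    have dI := cderivN (cderiv_ImB (m - 1) y0); rewrite subrK in dI.
    have -> : - (2 * ImB m y + (- m + 1) / y%:C * - ImB (m - 1) y) =
        - ((m - 1) / y%:C * ImB (m - 1) y + 2 * ImB m y).
      by move: y%:C (ImB _ _) (ImB _ _) => a b c; ring.
    exact: dI.
  have -> : - (csin (pi%:C * m) / pi%:C) =
      - (rGamma (- m + 1) * rGamma (m - 1 + 1)) + 0 * (rGamma (- m + 1 + 1) * rGamma (m + 1)).
    have pn : pi%:C != 0 :> R[i] by rewrite real_neq0// pi_gt0.
    rewrite mul0r addr0 subrK [rGamma m]rGammaS (addrC m) (addrC (- m)) mulrCA.
    rewrite [rGamma _ * rGamma _]mulrC rGamma_reflection//.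
    have G (c p : R[i]) : p != 0 -> c / p = m * (c / (p * m)).
      by move=> p0; field; rewrite mn p0.
    by rewrite -G.
  rewrite (_ : (fun n => _) = fun n => - (isr (- m) (seq0 n ^+ 2) * isr (m - 1) (seq0 n ^+ 2)) +
     (cpow (seq0 n) 2%:R * (isr (- m + 1) (seq0 n ^+ 2) * isr m (seq0 n ^+ 2)))).
    apply: cvgD; [apply: cvgN|]; apply: ccvgM; try exact: isr_seq0_cvg.
      by apply: cpow_cvg0; rewrite cRe_nat.
    by apply: ccvgM; exact: isr_seq0_cvg.
  apply/funext => n; have := @seq0_gt0 R n; move: (seq0 n) => y y0.
  rewrite /ImB !cpowD// !cpowN// cpow1//.
  have yn := real_neq0 y0; have cn := cpow_neq0 m y0.
  move: y%:C yn (cpow _ _) cn (isr _ _) (isr _ _) (isr _ _) (isr _ _) => a a0 b b0 c d e f.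
  by field; rewrite a0 b0.
have := H x x0; rewrite (addrC (- m)) => /(congr1 -%R); rewrite opprK => <-.
by move: x%:C (ImB (- m) x) (ImB (m - 1) x) (ImB (1 - m) x) (ImB m x) => a b c d e; ring.
Qed.

(** In 1/2 (I_(-m) - I_m) the constant 1/2 is written as the K-Wronskian at m in front of I_(-m) and
    at -m in front of I_m. The recurrence eliminates K_(m+1) - K_(m-1), and K_m remains times the
    Wronskian of I. *)
Lemma Kint_ImB m x : m != 0 -> -1 < complex.Re m < 1 -> 0 < x ->
  Kint m x * (csin (pi%:C * m) / pi%:C) = 2^-1 * (ImB (- m) x - ImB m x).
Proof.
move=> mn hm x0; rewrite -(wronskian_I mn x0).
have W1 := wronskian_K mn hm x0.
have W2 : x%:C * (ImB (- m) x * Kint (m - 1) x + ImB (1 - m) x * Kint m x) = 2^-1.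
  rewrite -[Kint m x]KintN// -[Kint (m - 1) x]KintN// opprB (addrC 1).
  apply: wronskian_K => //; first by rewrite oppr_eq0.
  by rewrite cReN; move: hm => /andP[h1 h2]; apply/andP; split; lra.
have K := Kint_rec m x0; have I := ImB_rec m x0.
have xn := real_neq0 x0.
have G (u v w a b : R[i]) : u = w -> v = w -> w * (a - b) = u * a - v * b.
  by move=> -> ->; rewrite mulrBr.
rewrite (G _ _ _ _ _ W1 W2).
have -> : Kint (m + 1) x = Kint (m - 1) x + m / x%:C * Kint m x.
  rewrite mulrAC K mulrAC divff// mul1r.
  by move: (Kint _ _) (Kint _ _) => a b; ring.
rewrite I; move: (ImB (- m) x) (ImB (1 - m) x) (ImB m x) (ImB (m + 1) x) => b c d e.
by move: x%:C xn (Kint m x) (Kint (m - 1) x) => a a0 f g; field.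
Qed.

End ModifiedBesselI.

(** * The relation between K and I at orders shifted by integers *)

Section Shifts.
Context {R : realType}.
Implicit Types (x : R) (m nu : R[i]) (n l : nat).

(** A predicate of the order, because the Wronskian proof needs -1 < Re m < 1 whereas the binomial
    sums involve all orders nu - n + l. *)
Definition Kformula m := forall x, 0 < x ->
  Kint m x * (csin (pi%:C * m) / pi%:C) = 2^-1 * (ImB (- m) x - ImB m x).

Lemma csinN m : csin (- m) = - csin m.
Proof. by rewrite /csin mulrN opprK -[in RHS]mulNr opprB. Qed.

Lemma cexp_ipi : cexp ('i%C * pi%:C) = -1 :> R[i].
Proof.
by apply: complex_ext; rewrite /cexp /= !(mul0r, mulr0, mul1r, subr0, sub0r, oppr0, addr0, add0r)
  ?(expR0, cospi, sinpi, mul1r, oppr0).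
Qed.

Lemma csin_shift m : csin (pi%:C * (m + 1)) = - csin (pi%:C * m).
Proof.
rewrite /csin mulrDr mulr1 mulrDr opprD !cexpD cexp_ipi [cexp (- ('i%C * pi%:C))]cexpN cexp_ipi.
by rewrite invrN1 !mulrN1 -opprD mulNr.
Qed.

Lemma csin_shiftn m n : csin (pi%:C * (m + n%:R)) = (-1) ^+ n * csin (pi%:C * m).
Proof.
elim: n => [|n IH]; first by rewrite addr0 mul1r.
by rewrite -natr1 addrA csin_shift IH exprS mulN1r mulNr.
Qed.

Lemma csin_shift_sub m n : csin (pi%:C * (m - n%:R)) = (-1) ^+ n * csin (pi%:C * m).
Proof.
have := csin_shiftn (m - n%:R) n; rewrite subrK => ->.
by rewrite mulrA -exprMn mulrNN mulr1 expr1n mul1r.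
Qed.

Lemma cderiv_unique (f g : R -> R[i]) x (a b : R[i]) :
  (\near x, f x = g x) -> cderiv f x a -> cderiv g x b -> a = b.
Proof.
move=> fg [fr fi] [gr gi].
have fgr : \near x, complex.Re (f x) = complex.Re (g x) by apply: filterS fg => y ->.
have fgi : \near x, complex.Im (f x) = complex.Im (g x) by apply: filterS fg => y ->.
have [_ r1] := near_is_derive fgr fr; have [_ i1] := near_is_derive fgi fi.
have [_ r2] := gr; have [_ i2] := gi.
by apply: complex_ext; [rewrite -r1 -r2|rewrite -i1 -i2].
Qed.

Lemma KformulaN m : Kformula m -> Kformula (- m).
Proof.
move=> H x x0; rewrite KintN// opprK mulrN csinN mulNr mulrN H// -mulrN opprB.
by [].
Qed.

(** Differentiating the relation in x yields K_(m+1) + K_(m-1), and the recurrence yields their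
    difference; together they isolate K_(m+1). *)
Lemma KformulaS m : Kformula m -> Kformula (m + 1).
Proof.
move=> H x x0; rewrite csin_shift mulNr; pose c := csin (pi%:C * m) / pi%:C; rewrite -/c.
have xn := real_neq0 x0.
have dK := cderivZ c (cderiv_Kint m x0).
have dI1 := cderiv_ImB (- m) x0; have dI2 := cderiv_ImB m x0.
have dS := cderivZ 2^-1 (cderivD dI1 (cderivN dI2)).
have nE : \near x, c * Kint m x = 2^-1 * (ImB (- m) x + - ImB m x).
  near=> y; rewrite mulrC [LHS]H//; near: y; exact: lt_nbhsr.
have E := cderiv_unique nE dK dS.
have KR := Kint_rec m x0; have HK := H x x0; rewrite -/c in HK.
have IR := ImB_rec (- m) x0.
have -> : - (m + 1) = - m - 1 by ring.
have K1 : Kint (m + 1) x = 2^-1 * (m / x%:C * Kint m x - (- (Kint (m + 1) x + Kint (m - 1) x))).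
  rewrite mulrAC KR mulrAC divff// mul1r.
  by move: (Kint _ _) (Kint _ _) => a b; field.
rewrite mulrN {}K1.
move: E IR HK; move: (Kint m x) (- (Kint (m + 1) x + _)) => a b.
move: (ImB (- m) x) (ImB (- m - 1) x) (ImB (- m + 1) x) (ImB m x) (ImB (m + 1) x).
move=> e f g h k E -> HK; clear nE dK dS dI1 dI2 KR; clearbody c.
move: x%:C xn E => y y0 E.
have -> : - (2^-1 * (m / y * a - b) * c) = 2^-1 * (c * b - m / y * (a * c)) by ring.
by rewrite E HK; field.
Unshelve. all: by end_near. Qed.

(** Downward steps are upward steps of the negated order. *)
Lemma Kformula_shift nu n l : Kformula nu -> Kformula (nu + l%:R - n%:R).
Proof.
move=> H.
have up m j : Kformula m -> Kformula (m + j%:R).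
  move=> Hm; elim: j => [|j IH]; first by rewrite addr0.
  by rewrite -natr1 addrA; exact: KformulaS.
have := up _ n (KformulaN (up _ l H)) => /KformulaN.
by rewrite opprD opprK.
Qed.

End Shifts.

(** * The Laplace transform of the series side *)

Section ExponentialSeries.
Context {R : realType}.
Implicit Types (X Y z al : R[i]) (h f : nat -> R[i]) (n N a k i j l : nat).

Definition cexp_coeff z k : R[i] := z ^+ k / k`!%:R.

Lemma cabs_cexp_coeff z k : cabs (cexp_coeff z k) = exp_coeff (cabs z) k.
Proof. by rewrite /cexp_coeff cabsM cabsX cabsV cabs_nat. Qed.

Lemma exp_coeffS z k : k.+1%:R * cexp_coeff z k.+1 = z * cexp_coeff z k.
Proof.
rewrite /cexp_coeff exprS factS natrM.
have k0 : k.+1%:R != 0 :> R[i] by rewrite pnatr_eq0.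
have f0 : k`!%:R != 0 :> R[i] by rewrite pnatr_eq0 -lt0n fact_gt0.
by move: k.+1%:R k0 k`!%:R f0 => a a0 c c0; field; rewrite a0 c0.
Qed.

Lemma abssum_exp h (C B : R) z : 0 <= C -> 0 <= B -> (forall k, cabs (h k) <= C * B ^+ k) ->
  abssum (fun k => cexp_coeff z k * h k).
Proof.
move=> C0 B0 H; apply: (@abssum_le _ _ (fun k => C * exp_coeff (cabs z * B) k)).
  move=> k; rewrite cabsM cabs_cexp_coeff.
  have -> : C * exp_coeff (cabs z * B) k = exp_coeff (cabs z) k * (C * B ^+ k).
    by rewrite /exp_coeff /= exprMn; ring.
  by rewrite ler_wpM2l// exp_coeff_ge0// cabs_ge0.
exact: is_cvg_seriesZ (is_cvg_series_exp_coeff _).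
Qed.

Lemma abssum_cexp z : abssum (cexp_coeff z).
Proof.
have := @abssum_exp (fun=> 1) 1 1 z ler01 ler01 _.
rewrite (_ : (fun k => _) = cexp_coeff z); last by apply/funext => k; rewrite mulr1.
by apply => k; rewrite cabs1 expr1n mulr1.
Qed.

(** [cexp] is built from the real exponential and trigonometric functions. Along the real line, the
    series at tz times e^(-tz) has derivative 0, so its values at t = 0 and t = 1 agree. *)
Lemma csum_cexp z : csum (cexp_coeff z) = cexp z.
Proof.
have gz : geom (fun k => z ^+ k).
  by exists 1, (cabs z); split; rewrite ?cabs_ge0// => k; rewrite mul1r cabsX.
pose F (t : R) := egf (fun k => z ^+ k) t * cexp (t%:C * - z).
have dF t : cderiv F t 0.
  have dd := cderivM (cderiv_egf t gz) (cderiv_cexp_line (- z) t).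
  move: dd; rewrite [X in cderiv _ _ X](_ : _ = 0)//.
  have -> : egf (fun k => z ^+ k.+1) t = z * egf (fun k => z ^+ k) t.
    rewrite /egf -csumZ; last exact: egf_abssum.
    by apply: eq_csum => k; rewrite /egf_term exprS mulrCA.
  by move: (egf _ _) (cexp _) => a b; ring.
have F1 : F 1 = F 0.
  apply: (@cderiv0_cst R F (F 0) (fun t _ => dF t) _ 1 ltr01).
  apply: (@cvg_comp _ _ _ (fun n => seq0 n) F _ (nbhs (0 : R))).
    exact: cvg_exh_left.
  exact: cderiv_ccont (dF 0).
move: F1; rewrite /F (egf0 gz) mul0r cexp0 expr0 mul1r mul1r cexpN => E.
have -> : csum (cexp_coeff z) = egf (fun k => z ^+ k) 1.
  by apply: eq_csum => k; rewrite /egf_term expr1n mul1r realCV natC mulrC.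
by apply: (divIf (cexp_neq0 z)); rewrite divff ?cexp_neq0.
Qed.

Lemma csum_finite f N : (forall i, (N <= i)%N -> f i = 0) -> csum f = \sum_(i < N) f i.
Proof.
move=> f0; apply: climE; apply: cvg_near_cst; near=> M; rewrite /series /=.
rewrite -(big_mkord xpredT f) (@big_cat_nat _ _ _ N)//=; last by near: M; exact: nbhs_infty_ge.
by rewrite [X in _ + X]big_nat_cond [X in _ + X]big1 ?addr0// => i /andP[/andP[Ni _] _]; exact: f0.
Unshelve. all: by end_near. Qed.

Lemma abssum_behead f : abssum f -> abssum (fun n => f n.+1).
Proof.
move=> sf; apply/cvg_ex; exists (limn (series (fun n => cabs (f n))) - cabs (f 0)).
rewrite (_ : series _ = fun n => series (fun n => cabs (f n)) n.+1 - cabs (f 0)).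
  by apply: cvgB; [rewrite cvg_shiftS|exact: cvg_cst].
by apply/funext => n; rewrite /series /= big_nat_recl//= addrC addKr.
Qed.

Lemma csum_drop f i : abssum f -> (forall k, (k < i)%N -> f k = 0) ->
  csum f = csum (fun k => f (i + k)%N).
Proof.
elim: i f => [|i IH] f sf f0; first by apply: eq_csum.
rewrite csum_recl// f0// add0r IH.
- by apply: eq_csum => k.
- exact: abssum_behead.
- by move=> k ki; exact: f0.
Qed.

(** The value at 0 of (1 + S)^N h, with S the shift of sequences; [bsumS] splits off one factor 1 +
    S. *)
Definition bsum N h : R[i] := \sum_(i < N.+1) 'C(N, i)%:R * h i.

Lemma bsumS N h : bsum N.+1 h = bsum N h + bsum N (fun i => h i.+1).
Proof.
rewrite /bsum big_ord_recl bin0 mul1r.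
under eq_bigr => i _ do rewrite /= /bump /= add1n binS natrD mulrDl.
rewrite big_split /= addrA; congr (_ + _).
rewrite [RHS]big_ord_recl bin0 mul1r; congr (_ + _).
by rewrite big_ord_recr /= bin_small// mul0r addr0; apply: eq_bigr => i _.
Qed.

Lemma bin_le_exp2 k i : ('C(k, i) <= 2 ^ k)%N.
Proof.
elim: k i => [|k IH] [|i]; rewrite ?bin0 ?expn_gt0//.
by rewrite binS expnS mul2n -addnn leq_add.
Qed.

Lemma bsum_le h (C B : R) k : (forall i, cabs (h i) <= C * B ^+ i) ->
  cabs (bsum k h) <= C * (1 + B) ^+ k.
Proof.
move=> H; apply: le_trans (cabs_sum _ _ _) _; rewrite exprDn mulr_sumr.
apply: ler_sum => i _; rewrite cabsM cabs_nat expr1n mul1r mulr_natl mulrnAr.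
exact: ler_wMn2r.
Qed.

(** The value at 0 of e^(YS) h, with S the shift. The binomial transform is then e^(Y(1+S)) = e^Y
    e^(YS). *)
Definition shift_sum Y h : R[i] := csum (fun m => cexp_coeff Y m * h m).

Lemma cexp_coeff_bin Y k i : (i <= k)%N ->
  cexp_coeff Y k * 'C(k, i)%:R = cexp_coeff Y i * cexp_coeff Y (k - i).
Proof.
move=> ik; have /(congr1 (fun x : nat => x%:R : R[i])) := bin_fact ik.
rewrite !natrM /cexp_coeff -[in Y ^+ k](subnKC ik) exprD => E.
have f0 j : j`!%:R != 0 :> R[i] by rewrite pnatr_eq0 -lt0n fact_gt0.
have b0 := f0 i; have c0 := f0 (k - i)%N; have d0 := f0 k.
move: ('C(k, i)%:R) i`!%:R b0 (k - i)`!%:R c0 k`!%:R d0 E => u b b0 c c0 e e0 E.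
rewrite -E; rewrite -E in e0; have u0 : u != 0.
  by apply: contraNN e0 => /eqP ->; rewrite mul0r.
by field; rewrite u0 b0 c0.
Qed.

(* The binomial transform: both sides are sums over i <= k of
   Y^k / (i! (k-i)!) h_i, summed over k first or over i first. *)
Lemma binomial_transform h (C : R) Y : 0 <= C -> (forall i, cabs (h i) <= C * 2^-1 ^+ i) ->
  abssum (fun k => cexp_coeff Y k * bsum k h) /\
  csum (fun k => cexp_coeff Y k * bsum k h) = cexp Y * shift_sum Y h.
Proof.
move=> C0 H.
pose f i k : R[i] := cexp_coeff Y k * ('C(k, i)%:R * h i).
(* The crude bound 2^k for the binomial coefficient separates i and k; the decay of [h] then makes
   the majorant summable in i. *)
have fle i k : cabs (f i k) <= C * 2^-1 ^+ i * exp_coeff (cabs Y * 2) k.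
  rewrite /f cabsM cabs_cexp_coeff cabsM cabs_nat.
  have -> : C * 2^-1 ^+ i * exp_coeff (cabs Y * 2) k =
      exp_coeff (cabs Y) k * (2 ^+ k * (C * 2^-1 ^+ i)).
    by rewrite /exp_coeff /= exprMn; ring.
  rewrite ler_wpM2l ?exp_coeff_ge0 ?cabs_ge0//; apply: ler_pM; rewrite ?cabs_ge0//.
  by rewrite -natrX ler_nat bin_le_exp2.
have Ek k : csum (f^~ k) = cexp_coeff Y k * bsum k h.
  rewrite (@csum_finite _ k.+1) /bsum ?mulr_sumr// => i ki.
  by rewrite /f bin_small// mul0r mulr0.
have sf i : abssum (f i).
  apply: (abssum_le (fun k => fle i k)).
  exact: is_cvg_seriesZ (is_cvg_series_exp_coeff _).
have Ei i : csum (f i) = cexp Y * (cexp_coeff Y i * h i).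
  rewrite (csum_drop (i := i))//; last by move=> k ki; rewrite /f bin_small// mul0r mulr0.
  rewrite -csum_cexp mulrC -csumZ; last exact: abssum_cexp.
  apply: eq_csum => k; rewrite /f mulrA cexp_coeff_bin ?leq_addr// addKn; ring.
have aS : cvgn (series (fun i => C * 2^-1 ^+ i : R)).
  apply: (@is_cvg_geometric_series _ C 2^-1).
  by rewrite ger0_norm// invf_lt1// ltr1n.
have gS : cvgn (series (fun k => `|exp_coeff (cabs Y * 2) k|)).
  have -> : (fun k => `|exp_coeff (cabs Y * 2) k|) = exp_coeff (cabs Y * 2).
    by apply/funext => k; rewrite ger0_norm// exp_coeff_ge0// mulr_ge0 ?cabs_ge0.
  exact: is_cvg_series_exp_coeff.
have [||||||A1 A2 A3] := @cint_csum _ _ R (@counting nat R) setT measurableT f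
  (fun i => C * 2^-1 ^+ i) (exp_coeff (cabs Y * 2)).
- by move=> i; exact: cintegrable_cmeas (cintegrable_counting (sf i)).
- by move=> i; rewrite mulr_ge0// exprn_ge0.
- exact: aS.
- by move=> k _; rewrite exp_coeff_ge0// mulr_ge0 ?cabs_ge0.
- exact: integrable_counting.
- by move=> i k _; exact: fle.
have S1 : abssum (fun k => cexp_coeff Y k * bsum k h).
  by apply: (@abssum_exp _ C (1 + 2^-1)) => // k; exact: bsum_le.
split => //.
rewrite csumE//.
transitivity (cintegral (@counting nat R) setT (fun k => csum (f^~ k))).
  by apply: eq_cint => k _; rewrite Ek.
rewrite A3.
transitivity (csum (fun i => cexp Y * (cexp_coeff Y i * h i))).
  by apply: eq_csum => i; rewrite -csumE// Ei.
rewrite csumZ//; apply: (@abssum_exp _ C 1) => // i.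
apply: le_trans (H i) _; rewrite expr1n mulr1 -[leRHS]mulr1 ler_wpM2l//.
by rewrite exprn_ile1// invf_le1// ler1n.
Qed.

End ExponentialSeries.

(** * Kummer's transformation and the double series *)

Section DoubleSeries.
Context {R : realType}.
Implicit Types (X Y z al : R[i]) (h f : nat -> R[i]) (n N a k i j l : nat).

(** With S the shift, (1+S)^a e^(Y(1+S)) = e^Y (1+S)^a e^(YS); the induction peels off one factor 1
    + S on both sides. *)
Lemma binomial_series a h (C : R) Y : 0 <= C -> (forall i, cabs (h i) <= C * 2^-1 ^+ i) ->
  abssum (fun k => cexp_coeff Y k * bsum (a + k) h) /\
  csum (fun k => cexp_coeff Y k * bsum (a + k) h) =
    cexp Y * bsum a (fun l => shift_sum Y (fun m => h (l + m)%N)).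
Proof.
elim: a h C => [|a IH] h C C0 H.
  have [h1 h2] := binomial_transform Y C0 H; split => //.
  by rewrite h2 /bsum big_ord_recl big_ord0 bin0 mul1r addr0.
have C20 : 0 <= C * 2^-1 by rewrite mulr_ge0.
have H2 i : cabs (h i.+1) <= C * 2^-1 * 2^-1 ^+ i.
  by rewrite -mulrA -exprS.
have [s1 e1] := IH h C C0 H; have [s2 e2] := IH _ _ C20 H2.
have E k : cexp_coeff Y k * bsum (a + k) h + cexp_coeff Y k * bsum (a + k) (fun i => h i.+1) =
    cexp_coeff Y k * bsum (a.+1 + k) h.
  by rewrite addSn bsumS mulrDr.
split; first exact: eq_abssum E (abssumD s1 s2).
by rewrite -(eq_csum E) (csumD s1 s2) e1 e2 -mulrDr bsumS.
Qed.

(** The Pochhammer symbol. *)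
Definition rising z j : R[i] := \prod_(0 <= i < j) (z + i%:R).

Lemma risingS z j : rising z j.+1 = rising z j * (z + j%:R).
Proof. by rewrite /rising big_nat_recr. Qed.

Lemma risingSl z j : rising z j.+1 = z * rising (z + 1) j.
Proof.
rewrite /rising big_nat_recl// addr0; congr (_ * _).
by apply: eq_bigr => i _; rewrite -(natr1 i); ring.
Qed.

Lemma rising_rGamma al j : rising (al + 1) j * rGamma (al + j%:R + 1) = rGamma (al + 1).
Proof.
elim: j => [|j IH]; first by rewrite /rising big_geq// mul1r addr0.
rewrite risingS -mulrA -IH; congr (_ * _).
rewrite [RHS]rGammaS -(natr1 j); congr (_ * rGamma _); ring.
Qed.

(** Kummer's transformation of 1F1(al+N+1; al+1; X) / Gamma(al+1), where the transformed series
    terminates. The reciprocal Gamma factors stay inside the sum, so al may be a negative integer.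
    The induction on N combines the cases al and al + 1. *)
Lemma kummer N al X :
  abssum (fun j => cexp_coeff X j * (rising (al + N%:R + 1) j * rGamma (al + j%:R + 1))) /\
  csum (fun j => cexp_coeff X j * (rising (al + N%:R + 1) j * rGamma (al + j%:R + 1))) =
    cexp X * bsum N (fun i => X ^+ i * rGamma (al + i%:R + 1)).
Proof.
elim: N al => [|N IH] al.
  have E j : rGamma (al + 1) * cexp_coeff X j =
      cexp_coeff X j * (rising (al + 0%:R + 1) j * rGamma (al + j%:R + 1)).
    by rewrite addr0 rising_rGamma mulrC.
  split; first by apply: (eq_abssum E); apply: abssumZ; exact: abssum_cexp.
  rewrite -(eq_csum E) (csumZ _ (@abssum_cexp _ X)) csum_cexp /bsum big_ord_recl big_ord0.
  by rewrite bin0 addr0 expr0 !mul1r addr0 mulrC.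
have [s1 e1] := IH al; have [s2 e2] := IH (al + 1).
pose b j : R[i] := if j is i.+1 then X * (cexp_coeff X i *
  (rising (al + 1 + N%:R + 1) i * rGamma (al + 1 + i%:R + 1))) else 0.
have sb : abssum b by apply: abssum_shift; apply: abssumZ; exact: s2.
have E j : cexp_coeff X j * (rising (al + N%:R + 1) j * rGamma (al + j%:R + 1)) + b j =
    cexp_coeff X j * (rising (al + N.+1%:R + 1) j * rGamma (al + j%:R + 1)).
  case: j => [|j]; first by rewrite /b addr0 /rising !big_geq.
  rewrite /b [X * (_ * _)]mulrA -exp_coeffS [rising _ j.+1]risingSl risingS.
  have -> : al + 1 + N%:R + 1 = al + N.+1%:R + 1 by rewrite -(natr1 N); ring.
  have -> : al + 1 + j%:R + 1 = al + j.+1%:R + 1 by rewrite -(natr1 j); ring.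
  have -> : al + N%:R + 1 + 1 = al + N.+1%:R + 1 by rewrite -(natr1 N); ring.
  move: (cexp_coeff _ _) (rGamma _) (rising _ _) => u v w.
  by rewrite -(natr1 N) -(natr1 j); ring.
split; first exact: eq_abssum E (abssumD s1 sb).
rewrite -(eq_csum E) (csumD s1 sb) e1 (csum_recl sb) /b add0r (csumZ _ s2) e2.
rewrite bsumS mulrDr; congr (_ + _); rewrite mulrCA; congr (_ * _).
rewrite /bsum mulr_sumr; apply: eq_bigr => i _.
have -> : al + 1 + i%:R + 1 = al + i.+1%:R + 1 by rewrite -(natr1 i); ring.
by rewrite exprS; ring.
Qed.

Lemma shift_sum_isr l al X Y (x : R) : Y * X = x%:C ->
  shift_sum Y (fun m => X ^+ (l + m) * rGamma (al + (l + m)%:R + 1)) =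
  X ^+ l * isr (al + l%:R) x.
Proof.
move=> YX; rewrite /shift_sum /isr /egf -csumZ; last exact: isr_abssum.
apply: eq_csum => m; rewrite /egf_term /isr_coef natrD addrA exprD /cexp_coeff.
rewrite realCM realCV natC realCX -YX exprMn.
by move: (rGamma _) => g; ring.
Qed.

(** The condition on X gives X^i / Gamma(al+i+1) the decay 2^(-i) that the binomial transform needs;
    the condition on Y X makes the shifted sums values of [isr]. *)
Lemma double_series n al X Y (x : R) : cabs X <= 2^-1 -> Y * X = x%:C ->
  abssum (fun k => cexp_coeff Y k * csum (fun j => cexp_coeff X j *
    (rising (al + (2 * n + k)%:R + 1) j * rGamma (al + j%:R + 1)))) /\
  csum (fun k => cexp_coeff Y k * csum (fun j => cexp_coeff X j *
    (rising (al + (2 * n + k)%:R + 1) j * rGamma (al + j%:R + 1)))) =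
  cexp (X + Y) * bsum (2 * n) (fun l => X ^+ l * isr (al + l%:R) x).
Proof.
move=> X2 YX; have [C HC] := rGamma_bound (al + 1).
have C0 : 0 <= C by apply: le_trans (HC 0); exact: cabs_ge0.
have H i : cabs (X ^+ i * rGamma (al + i%:R + 1)) <= C * 2^-1 ^+ i.
  rewrite cabsM cabsX mulrC; apply: ler_pM; rewrite ?cabs_ge0 ?exprn_ge0 ?cabs_ge0//.
    by rewrite addrAC.
  by rewrite lerXn2r// ?nnegrE ?cabs_ge0.
have [s e] := binomial_series (2 * n) Y C0 H.
have E k : cexp X * (cexp_coeff Y k * bsum (2 * n + k) (fun i => X ^+ i * rGamma (al + i%:R + 1))) =
    cexp_coeff Y k * csum (fun j => cexp_coeff X j *
      (rising (al + (2 * n + k)%:R + 1) j * rGamma (al + j%:R + 1))).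
  by have [_ ->] := kummer (2 * n + k) al X; rewrite mulrCA.
split; first by apply: (eq_abssum E); apply: abssumZ; exact: s.
rewrite -(eq_csum E).
rewrite (csumZ _ s) e mulrA -cexpD; congr (_ * _); apply: eq_bigr => l _.
by rewrite (shift_sum_isr _ _ YX).
Qed.

End DoubleSeries.

(** * Laplace transform of a product of two entire series *)

Section LaplaceSeries.
Context {R : realType}.
Notation mu := (@lebesgue_measure R).
Notation D := (`]0%R, +oo[%classic : set R).
Implicit Types (r t s : R) (be : R[i]) (c : nat -> R[i]) (k j : nat).

(** Writing t/4 as 1/2 times t/2 leaves a summable factor 2^(-k) in each term, while the growth in t
    = r^2 is only e^(t/2). *)
Lemma egf_bound c (C : R) t : 0 <= C -> (forall k, cabs (c k) <= C * 4^-1 ^+ k) -> 0 <= t ->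
  (forall k, cabs (egf_term c t k) <= C * (2^-1 ^+ k * expR (t / 2))) /\
  cabs (egf c t) <= C * expR (t / 2).
Proof.
move=> C0 H t0; have tt : `|t| <= t by rewrite ger0_norm.
have B := fun k => egf_term_le H k tt; split.
  move=> k; apply: le_trans (B k) _; rewrite ler_wpM2l//.
  apply: (@le_trans _ _ (2^-1 ^+ k * ((t / 2) ^+ k / k`!%:R))); last first.
    by rewrite ler_wpM2l ?exprn_ge0// expR_ge_exprn// divr_ge0.
  rewrite (_ : 4^-1 * t = 2^-1 * (t / 2)); last by field.
  by rewrite /exp_coeff /= exprMn mulrA.
have cv := is_cvg_series_exp_coeff (4^-1 * t).
apply: le_trans (cabs_csum B (is_cvg_seriesZ (k := C) cv)) _.
rewrite lim_seriesZ// ler_wpM2l//.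
have : expR (4^-1 * t) <= expR (t / 2) by rewrite ler_expR; lra.
exact.
Qed.

(** Two series of growth e^(r^2/2) cost e^(r^2) together; from s = 2 on a full Gaussian e^(-r^2) is
    left. *)
Lemma gauss_weight be s r : 0 < r -> 2 <= s ->
  cabs (cpow r (2 * (be + 1) - 1) * (expR (- (s * r ^+ 2)))%:C) * (expR (r ^+ 2 / 2) * expR (r ^+ 2 / 2))
  <= r `^ (2 * complex.Re (be + 1) - 1) * expR (- (1 * r ^+ 2)).
Proof.
move=> r0 s2; rewrite cabsM cabs_real ger0_norm ?expR_ge0// cabs_cpow// Re_2B1 -mulrA.
rewrite ler_wpM2l ?powR_ge0// -!expRD ler_expR.
have : 0 <= (s - 2) * r ^+ 2 by rewrite mulr_ge0 ?sqr_ge0// subr_ge0.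
lra.
Qed.

Lemma laplace_egf2 be s cA cB (CA CB : R) : 2 <= s -> 0 < complex.Re (be + 1) ->
  0 <= CA -> (forall k, cabs (cA k) <= CA * 4^-1 ^+ k) ->
  0 <= CB -> (forall k, cabs (cB k) <= CB * 4^-1 ^+ k) ->
  let W r := cpow r (2 * (be + 1) - 1) * (expR (- (s * r ^+ 2)))%:C in
  cintegrable mu D (fun r => W r * (egf cB (r ^+ 2) * egf cA (r ^+ 2))) /\
  cintegral mu D (fun r => W r * (egf cB (r ^+ 2) * egf cA (r ^+ 2))) =
  csum (fun k => csum (fun j => cB k / k`!%:R * (cA j / j`!%:R) *
     gint (be + 1 + k%:R + j%:R) s)).
Proof.
move=> s2 be1 CA0 HA CB0 HB W.
have s0 : 0 < s by apply: lt_le_trans s2.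
have gA : geom cA by exists CA, 4^-1; split.
have gB : geom cB by exists CB, 4^-1; split.
have geom2 : cvgn (series (fun n => 2^-1 ^+ n : R)).
  have := @is_cvg_geometric_series R 1 2^-1.
  rewrite /geometric /=; under [X in series X]eq_fun do rewrite mul1r.
  by apply; rewrite ger0_norm// invf_lt1// ltr1n.
pose g r := CA * CB * (r `^ (2 * complex.Re (be + 1) - 1) * expR (- (1 * r ^+ 2))).
have g0 r : 0 <= g r by rewrite !mulr_ge0 ?powR_ge0 ?expR_ge0.
have ig : mu.-integrable D (EFin \o g).
  by apply: RintegrableZ; apply: integrable_gauss => //; rewrite mulr_gt0.
have cW r : 0 < r -> ccont W r by move=> r0; exact: gint_ccont.
have cE c r : geom c -> ccont (fun r => egf c (r ^+ 2)) r.
  move=> gc; apply: (@ccont_comp _ (fun r => r ^+ 2) (egf c)); first exact: exprn_continuous.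
  exact: cderiv_ccont (cderiv_egf _ gc).
have cT c k r : ccont (fun r => egf_term c (r ^+ 2) k) r.
  apply: ccontM; last exact: ccont_cst.
  apply: ccont_real; apply: continuousM; last exact: cvg_cst.
  apply: (@continuous_comp _ _ _ (fun r => r ^+ 2) (fun r => r ^+ k)); exact: exprn_continuous.
(* The numbers [a1] and [a2] are powers of 1/2 for single terms of the series and 1 for a whole
   series, so that one estimate serves both termwise integrations. *)
have bnd (a1 a2 : R) (b c : R[i]) r : 0 < r -> 0 <= a1 -> 0 <= a2 ->
    cabs b <= CB * (a1 * expR (r ^+ 2 / 2)) ->
    cabs c <= CA * (a2 * expR (r ^+ 2 / 2)) -> cabs (W r * (b * c)) <= a1 * a2 * g r.
  move=> r0 a10 a20 bB cA'; rewrite cabsM (cabsM b c).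
  apply: (@le_trans _ _ (cabs (W r) * (CB * (a1 * expR (r ^+ 2 / 2)) * (CA * (a2 * expR (r ^+ 2 / 2)))))).
    by rewrite ler_wpM2l ?cabs_ge0//; apply: ler_pM; rewrite ?cabs_ge0.
  have -> : cabs (W r) * (CB * (a1 * expR (r ^+ 2 / 2)) * (CA * (a2 * expR (r ^+ 2 / 2)))) =
    a1 * a2 * (CA * CB * (cabs (W r) * (expR (r ^+ 2 / 2) * expR (r ^+ 2 / 2)))) by ring.
  have aa : 0 <= a1 * a2 by exact: mulr_ge0.
  have CC : 0 <= CA * CB by exact: mulr_ge0.
  by apply: (ler_wpM2l aa); apply: (ler_wpM2l CC); exact: gauss_weight.
have p0 k : 0 <= 2^-1 ^+ k :> R by rewrite exprn_ge0.
have r20 r : 0 <= r ^+ 2 by exact: sqr_ge0.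
have eA r : cabs (egf cA (r ^+ 2)) <= CA * (1 * expR (r ^+ 2 / 2)).
  by rewrite mul1r; have [] := egf_bound CA0 HA (r20 r).
have tA k r : cabs (egf_term cA (r ^+ 2) k) <= CA * (2^-1 ^+ k * expR (r ^+ 2 / 2)).
  by have [H _] := egf_bound CA0 HA (r20 r).
have tB k r : cabs (egf_term cB (r ^+ 2) k) <= CB * (2^-1 ^+ k * expR (r ^+ 2 / 2)).
  by have [H _] := egf_bound CB0 HB (r20 r).
pose f k r := W r * (egf_term cB (r ^+ 2) k * egf cA (r ^+ 2)).
pose f2 k j r := W r * (egf_term cB (r ^+ 2) k * egf_term cA (r ^+ 2) j).
have [||||||S1 I1 E1] := @cint_csum _ _ R mu _ half_line_measurable f (fun k => 2^-1 ^+ k) g.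
- move=> k; apply: cmeas_half_line => r r0; apply: ccontM; first exact: cW.
  by apply: ccontM; [exact: cT|exact: cE].
- exact: p0.
- exact: geom2.
- by move=> r _; exact: g0.
- exact: ig.
- move=> k r /half_lineP r0; rewrite -[X in X * g r]mulr1.
  by apply: (bnd _ _ _ _ _ r0).
have F1 r : csum (f^~ r) = W r * (egf cB (r ^+ 2) * egf cA (r ^+ 2)).
  transitivity (csum (fun k => W r * egf cA (r ^+ 2) * egf_term cB (r ^+ 2) k)).
    by apply: eq_csum => k; rewrite /f; ring.
  by rewrite csumZ; [rewrite -/(egf cB _); ring|exact: egf_abssum].
have F2 k : cintegral mu D (f k) = csum (fun j => cintegral mu D (f2 k j)).
  have [||||||S2 I2 E2] := @cint_csum _ _ R mu _ half_line_measurable (f2 k)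
    (fun j => 2^-1 ^+ k * 2^-1 ^+ j) g.
  - move=> j; apply: cmeas_half_line => r r0; apply: ccontM; first exact: cW.
    by apply: ccontM; exact: cT.
  - by move=> j; rewrite mulr_ge0.
  - exact: (@is_cvg_seriesZ _ _ (2^-1 ^+ k) geom2).
  - by move=> r _; exact: g0.
  - exact: ig.
  - move=> j r /half_lineP r0.
    by apply: (bnd _ _ _ _ _ r0).
  rewrite -E2; apply: eq_cint => r _.
  transitivity (csum (fun j => W r * egf_term cB (r ^+ 2) k * egf_term cA (r ^+ 2) j)).
    rewrite csumZ; first by rewrite /f mulrA.
    exact: egf_abssum.
  by apply: eq_csum => j; rewrite /f2 mulrA.
have F3 k j : cintegral mu D (f2 k j) =
    cB k / k`!%:R * (cA j / j`!%:R) * gint (be + 1 + k%:R + j%:R) s.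
  rewrite /gint -(cintZ half_line_measurable); last first.
    by apply: gint_integrable => //; rewrite (cReD _ j%:R) (cReD _ k%:R) !cRe_nat ltr_wpDr// ltr_wpDr.
  apply: eq_cint => r /set_mem/half_lineP r0; rewrite /f2 /W /egf_term.
  have -> : cpow r (2 * (be + 1 + k%:R + j%:R) - 1) =
      cpow r (2 * (be + 1) - 1) * (r ^+ 2)%:C ^+ k * (r ^+ 2)%:C ^+ j.
    rewrite realCX -!exprM -!cpow_nat// -!cpowD//; congr cpow; rewrite !natrM; ring.
  rewrite !realCM !realCV !natC !realCX.
  by move: (cpow _ _) (expR _)%:C => u v; ring.
split.
  by apply: (eq_cintegrable half_line_measurable _ I1) => r _; exact: F1.
transitivity (cintegral mu D (fun r => csum (f^~ r))).
  by apply: eq_cint => r _; rewrite F1.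
rewrite E1; apply: eq_csum => k; rewrite F2; apply: eq_csum => j; exact: F3.
Qed.

End LaplaceSeries.

(** * The product of Bessel functions in polar coordinates *)

Section BesselProduct.
Context {R : realType}.
Notation mu := (@lebesgue_measure R).
Notation D := (`]0%R, +oo[%classic : set R).
Implicit Types (r t s x th : R) (nu al z q : R[i]) (k j n l : nat).

Definition cis th : R[i] := cexp ('i%C * th%:C).

Lemma cis_neq0 th : cis th != 0. Proof. exact: cexp_neq0. Qed.

Lemma cabs_cis th : cabs (cis th) = 1.
Proof. by rewrite cabs_cexp /= !(mul0r, mulr0, mul1r, subr0, sub0r, oppr0) expR0. Qed.

Lemma cisN th : cis (- th) = (cis th)^-1.
Proof. by rewrite /cis realCN mulrN cexpN. Qed.

Lemma conj_cis th : (cis th)^*%C = cis (- th).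
Proof.
apply: complex_ext; rewrite /cis /cexp /=;
  rewrite !(mul0r, mulr0, mul1r, subr0, sub0r, oppr0, addr0, add0r, expR0) ?cosN ?sinN//.
Qed.

(** Coefficients of J*_al(r e^(i th)) as an exponential generating function of r^2, with q = e^(2 i
    th). *)
Definition jcoef al q k : R[i] := (- (q / 4)) ^+ k * rGamma (al + k%:R + 1).

Lemma jcoef_le al q : cabs q = 1 ->
  exists C, 0 <= C /\ forall k, cabs (jcoef al q k) <= C * 4^-1 ^+ k.
Proof.
move=> q1; have [C HC] := rGamma_bound (al + 1); exists C.
split; first by apply: le_trans (HC 0); exact: cabs_ge0.
move=> k; rewrite /jcoef cabsM cabsX cabsN cabsM cabsV cabs_nat q1 mul1r mulrC.
by rewrite ler_wpM2r ?exprn_ge0// addrAC.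
Qed.

Lemma besselJstar_egf al th r :
  besselJstar al (r%:C * cis th) = egf (jcoef al (cis th ^+ 2)) (r ^+ 2).
Proof.
rewrite besselJstarE_csum; apply: eq_csum => k.
rewrite /bstar_term /egf_term /jcoef realCM realCV natC !realCX.
have -> : (r%:C * cis th / 2) ^+ (2 * k) = (r%:C ^+ 2) ^+ k * (cis th ^+ 2 / 4) ^+ k.
  rewrite exprM -exprMn; congr (_ ^+ _).
  by move: (cis th) r%:C => a b; field.
by rewrite [(- (_ / _)) ^+ k]exprNn; move: (rGamma _) ((cis th ^+ 2 / 4) ^+ k) => a b; ring.
Qed.

Lemma cabs_polar r th : 0 < r -> cabs (r%:C * cis th) = r.
Proof. by move=> r0; rewrite cabsM cabs_real cabs_cis mulr1 ger0_norm// ltW. Qed.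

Lemma polar_dir th r : 0 < r -> r%:C * cis th / `|r%:C * cis th| = cis th.
Proof.
move=> r0; transitivity (r%:C * cis th / (cabs (r%:C * cis th))%:C).
  by congr (_ / _); exact: normcE.
by rewrite cabs_polar// mulrAC divff ?mul1r// real_neq0.
Qed.

Lemma conj_polar r th : (r%:C * cis th)^*%C = r%:C * cis (- th).
Proof.
rewrite -conj_cis; apply: complex_ext => /=; ring.
Qed.

Lemma calJ_polar nu n th r : 0 < r -> calJ nu n%:Z (r%:C * cis th) =
  cpow (r / 2) (2 * nu) * (cis th ^+ (2 * n))^-1 *
  (egf (jcoef (nu + n%:R) (cis (- th) ^+ 2)) (r ^+ 2) * egf (jcoef (nu - n%:R) (cis th ^+ 2)) (r ^+ 2)).
Proof.
move=> r0; rewrite /calJ conj_polar !besselJstar_egf.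
have -> : cabs (r%:C * cis th / 2) = r / 2 by rewrite cabsM cabsV cabs_nat cabs_polar.
rewrite (polar_dir th r0).
have -> : cis th ^ (- (2 * n%:Z)) = (cis th ^+ (2 * n))^-1.
  by rewrite -PoszM exprnN.
have -> : n%:Z%:~R = n%:R :> R[i] by [].
by move: (egf _ _) (egf _ _) (cpow _ _ * _) => a b c; rewrite -mulrA (mulrC a).
Qed.

(** Changing the sign of p exchanges the two Bessel factors and inverts the direction, and so does
    conjugating u; this reduces the theorem to p >= 0. *)
Lemma calJN nu n th r : 0 < r ->
  calJ nu (- n%:Z) (r%:C * cis th) = calJ nu n%:Z (r%:C * cis (- th)).
Proof.
move=> r0; rewrite /calJ !conj_polar.
have cE t : cabs (r%:C * cis t / 2) = r / 2 by rewrite cabsM cabsV cabs_nat cabs_polar.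
rewrite !cE !(polar_dir _ r0).
have -> : cis (- th) ^ (- (2 * n%:Z)) = cis th ^ (- (2 * - n%:Z)).
  by rewrite cisN exprz_inv mulrN.
have -> : (- n%:Z)%:~R = - n%:~R :> R[i] by rewrite rmorphN.
rewrite !opprK; move: (besselJstar _ _) (besselJstar _ _) (cpow _ _ * _) => a b c.
exact: mulrAC.
Qed.

Lemma gam_rising z j : 0 < complex.Re z -> gam (z + j%:R) = rising z j * gam z.
Proof.
case: j => [|j] z0; first by rewrite addr0 /rising big_geq// mul1r.
by rewrite gamD.
Qed.

End BesselProduct.

(** * The transform of the Bessel product *)

Section Laplace.
Context {R : realType}.
Notation mu := (@lebesgue_measure R).
Notation D := (`]0%R, +oo[%classic : set R).
Implicit Types (r t s x th : R) (nu al z q : R[i]) (k j n l : nat).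

(** The factor common to the transforms of both sides. At x = 1/(4s) the power in it is 1/(4^n
    s^(2n+1)), the constant of Weber's integral. *)
Definition lap_factor n th x : R[i] := (2^-1 * (4 ^+ n.+1 * x ^+ (2 * n).+1))%:C *
  (expR (- (2 * x * cos (2 * th))))%:C * (cis th ^+ (2 * n))^-1.

Lemma cis_sqr_sum th : cis th ^+ 2 + cis (- th) ^+ 2 = (2 * cos (2 * th))%:C :> R[i].
Proof.
have e t : cis t ^+ 2 = cis (2 * t) :> R[i].
  by rewrite /cis -(cexpMn _ 2) realCM natC mulrCA.
rewrite !e mulrN; apply: complex_ext; rewrite /cis /cexp /=;
  rewrite !(mul0r, mulr0, mul1r, subr0, sub0r, oppr0, addr0, add0r, expR0) ?cosN ?sinN ?subrr//; ring.
Qed.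

Lemma calJ_laplace nu n th s : `|complex.Re nu| < 4^-1 -> 2 <= s ->
  let x := (4 * s)^-1 in
  cintegrable mu D (fun r => (gwts s n r)%:C * calJ nu n%:Z (r%:C * cis th)) /\
  cintegral mu D (fun r => (gwts s n r)%:C * calJ nu n%:Z (r%:C * cis th)) =
  lap_factor n th x *
    bsum (2 * n) (fun l => (- cis th ^+ 2) ^+ l * ImB (nu - n%:R + l%:R) x).
Proof.
move=> hnu s2 x; have s0 : 0 < s by apply: lt_le_trans s2.
have x0 : 0 < x by rewrite invr_gt0 mulr_gt0.
set al := nu - n%:R; pose be := nu + n%:R.
(* Gamma is taken as an integral at orders be + 1 + k + j only; the real part of [al] may be very
   negative, so that order enters through [rGamma] alone. *)
have be1 : 0 < complex.Re (be + 1).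
  rewrite /be !cReD cRe_nat /=; move: hnu; rewrite ltr_norml => /andP[h1 _].
  have := ler0n R n; lra.
pose q := cis th ^+ 2; pose q' := cis (- th) ^+ 2.
have q1 : cabs q = 1 by rewrite cabsX cabs_cis expr1n.
have q'1 : cabs q' = 1 by rewrite cabsX cabs_cis expr1n.
have qq : q' * q = 1 by rewrite /q /q' cisN exprVn mulVf// expf_neq0// cis_neq0.
have [CA [CA0 HA]] := jcoef_le al q1; have [CB [CB0 HB]] := jcoef_le be q'1.
have [I E] := @laplace_egf2 R be s _ _ _ _ s2 be1 CA0 HA CB0 HB.
pose c0 : R[i] := cpow 2 (- (2 * nu)) * (cis th ^+ (2 * n))^-1.
have Er r : 0 < r -> (gwts s n r)%:C * calJ nu n%:Z (r%:C * cis th) =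
    c0 * (cpow r (2 * (be + 1) - 1) * (expR (- (s * r ^+ 2)))%:C *
      (egf (jcoef be q') (r ^+ 2) * egf (jcoef al q) (r ^+ 2))).
  move=> r0; rewrite calJ_polar// -/q -/q' -/al -/be /gwts realCM realCX.
  rewrite cpowM ?invr_gt0// cpowV//.
  have -> : cpow r (2 * (be + 1) - 1) = cpow r (2 * nu) * r%:C ^+ (2 * n).+1.
    rewrite -cpow_nat// -cpowD//; congr cpow; rewrite /be -(natr1 (2 * n)) natrM; ring.
  rewrite /c0; move: (egf _ _) (egf _ _) (expR _)%:C (cpow r _) (cpow 2 _) (r%:C ^+ _) (_^-1).
  by move=> a b c d e f g; ring.
split.
  apply: (eq_cintegrable half_line_measurable (f := fun r => c0 * (cpow r (2 * (be + 1) - 1) * (expR (- (s * r ^+ 2)))%:C *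
      (egf (jcoef be q') (r ^+ 2) * egf (jcoef al q) (r ^+ 2))))).
    by move=> r /set_mem/half_lineP r0; rewrite Er.
  exact: (cintegrableZ half_line_measurable c0 I).
transitivity (c0 * csum (fun k => csum (fun j => jcoef be q' k / k`!%:R * (jcoef al q j / j`!%:R) *
     gint (be + 1 + k%:R + j%:R) s))).
  rewrite -E -(cintZ half_line_measurable c0 I).
  by apply: eq_cint => r /set_mem/half_lineP r0; rewrite Er.
(* The inner series runs in X, the outer in Y. Their exponentials multiply to e^(-2x cos(2 th)), and
   Y X = x^2 is the argument of [isr] in [ImB]. *)
pose X : R[i] := - (x%:C * q); pose Y : R[i] := - (x%:C * q').
pose K0 : R[i] := 2^-1 * cpow s (- (be + 1)).
have YX : Y * X = (x ^+ 2)%:C.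
  by rewrite /X /Y mulrNN mulrACA qq mulr1 realCX expr2.
have X2 : cabs X <= 2^-1.
  rewrite /X cabsN cabsM cabs_real q1 mulr1 ger0_norm ?(ltW x0)//.
  rewrite lef_pV2 ?posrE ?mulr_gt0//; lra.
have sx : s%:C^-1 = 4 * x%:C :> R[i].
  by rewrite -natC -realCM -realCV; congr (_%:C); rewrite /x; field; rewrite gt_eqF.
have [SY DS] := double_series n al X2 YX.
(* Gamma(be+1+k+j) is a Pochhammer symbol times Gamma(be+1+k), and the latter cancels the [rGamma]
   factor of [jcoef be]. What remains is a Kummer series, because be + 1 + k = al + (2n + k) + 1. *)
have term k j : jcoef be q' k / k`!%:R * (jcoef al q j / j`!%:R) * gint (be + 1 + k%:R + j%:R) s =
    K0 * cexp_coeff Y k * (cexp_coeff X j *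
      (rising (al + (2 * n + k)%:R + 1) j * rGamma (al + j%:R + 1))).
  have -> : al + (2 * n + k)%:R + 1 = be + 1 + k%:R by rewrite /al /be natrD natrM; ring.
  have bk : 0 < complex.Re (be + 1 + k%:R) by rewrite cReD cRe_nat ltr_wpDr.
  have bkj : 0 < complex.Re (be + 1 + k%:R + j%:R) by rewrite cReD cRe_nat ltr_wpDr.
  rewrite gint_scale//.
  have -> : gint (be + 1 + k%:R + j%:R) 1 = 2^-1 * (rising (be + 1 + k%:R) j * gam (be + 1 + k%:R)).
    by rewrite -gam_rising// /gam mulrA mulVf ?mul1r// pnatr_eq0.
  have -> : cpow s (- (be + 1 + k%:R + j%:R)) = cpow s (- (be + 1)) * (4 * x%:C) ^+ k * (4 * x%:C) ^+ j.
    rewrite -sx !exprVn -!cpow_nat// -!cpowN// -!cpowD//; congr cpow; ring.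
  rewrite /jcoef (addrAC be) /K0 /cexp_coeff /X /Y.
  have -> : (- (q' / 4)) ^+ k = (- (x%:C * q')) ^+ k / (4 * x%:C) ^+ k.
    rewrite -expr_div_n; congr (_ ^+ _); have := real_neq0 x0.
    by move: x%:C => a a0; field.
  have -> : (- (q / 4)) ^+ j = (- (x%:C * q)) ^+ j / (4 * x%:C) ^+ j.
    rewrite -expr_div_n; congr (_ ^+ _); have := real_neq0 x0.
    by move: x%:C => a a0; field.
  have n4 : (4 * x%:C : R[i]) != 0 by rewrite mulf_neq0 ?real_neq0// pnatr_eq0.
  have gg := gam_rGamma bk.
  have a0 := expf_neq0 k n4; have b0 := expf_neq0 j n4.
  have f0 i : i`!%:R != 0 :> R[i] by rewrite pnatr_eq0 -lt0n fact_gt0.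
  have c0' := f0 k; have d0 := f0 j.
  move: (rGamma (be + 1 + _)) (gam _) gg => u v gg.
  move: ((4 * x%:C) ^+ k) a0 ((4 * x%:C) ^+ j) b0 k`!%:R c0' j`!%:R d0 => a a0 b b0 c c0' d d0.
  move: (rGamma _) (rising _ _) (cpow _ _) ((- _) ^+ k) ((- _) ^+ j) => e f g h i.
  transitivity (2^-1 * g * (h / c) * (i / d * (f * e)) * (u * v)); last by rewrite gg mulr1.
  by field; rewrite a0 b0 c0' d0.
transitivity (c0 * (K0 * (cexp (X + Y) * bsum (2 * n) (fun l => X ^+ l * isr (al + l%:R) (x ^+ 2))))).
  congr (_ * _); rewrite -DS -(csumZ _ SY); apply: eq_csum => k.
  rewrite mulrA -csumZ; last by have [] := kummer (2 * n + k) al X.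
  by apply: eq_csum => j; exact: term.
have -> : cexp (X + Y) = (expR (- (2 * x * cos (2 * th))))%:C.
  have -> : X + Y = (- (2 * x * cos (2 * th)))%:C.
    by rewrite /X /Y -opprD -mulrDr cis_sqr_sum -realCM -realCN; congr (_%:C); ring.
  by rewrite cexp_real.
rewrite /lap_factor /bsum !mulr_sumr; apply: eq_bigr => l _.
rewrite /ImB cpowD// cpow_nat// /X -[- (x%:C * q)]mulrN exprMn /q.
have Ec : c0 * K0 = (2^-1 * (4 ^+ n.+1 * x ^+ (2 * n).+1))%:C * (cis th ^+ (2 * n))^-1 * cpow x al.
  rewrite /c0 /K0; have -> : cpow s (- (be + 1)) = cpow 2 (2 * (be + 1)) * cpow x (be + 1).
    have -> : cpow 2 (2 * (be + 1)) = cpow (4 : R) (be + 1).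
      by rewrite (_ : 4 = 2 ^+ 2 :> R) ?cpow_exp//; ring.
    rewrite -cpowM// -cpowV//; congr cpow.
    by rewrite /x invfM mulrA divff ?mul1r.
  have -> : cpow x (be + 1) = cpow x al * x%:C ^+ (2 * n).+1.
    by rewrite -cpow_nat// -cpowD//; congr cpow; rewrite /al /be -(natr1 (2 * n)) natrM; ring.
  have c2 : cpow 2 (- (2 * nu)) * cpow 2 (2 * (be + 1)) = (4 : R[i]) ^+ n.+1.
    rewrite -cpowD// (_ : 4 = 2 ^+ 2 :> R[i]); last by ring.
    rewrite -exprM -(natC 2) -cpow_nat//; congr cpow; rewrite /be natrM -(natr1 n); ring.
  rewrite (realCM 2^-1) (realCM (4 ^+ _)) !realCX (realCV 2) !natC -c2.
  by move: (cpow x al) (x%:C ^+ _) (cpow 2 _) (cpow 2 _) (_^-1) => a b c d e; ring.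
transitivity (c0 * K0 * ((expR (- (2 * x * cos (2 * th))))%:C *
   ('C(2 * n, l)%:R * (x%:C ^+ l * (- cis th ^+ 2) ^+ l * isr (al + l%:R) (x ^+ 2))))).
  by rewrite !mulrA.
rewrite Ec; move: (expR _)%:C (cpow x al) (isr _ _) (x%:C ^+ l) ((- _) ^+ l) (_^-1) => a b c d e f.
by move: ('C(_, _)%:R) => g; ring.
Qed.

End Laplace.

(** * The transform of the integral *)

Section GFormula.
Context {R : realType}.
Notation mu := (@lebesgue_measure R).
Notation D := (`]0%R, +oo[%classic : set R).
Implicit Types (r y s x th : R) (nu : R[i]) (l n : nat).

Lemma Gint_formula nu n th s : `|complex.Re nu| < 4^-1 -> 0 < s ->
  let x := (4 * s)^-1 in
  cintegral mu D (fun r => (gwts s n r)%:C * Gint n nu th r) =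
  lap_factor n th x * bsum (2 * n) (fun l => (cis th ^+ 2) ^+ l * Kint (nu - n%:R + l%:R) x).
Proof.
move=> hnu s0 x; have [_ _ ->] := Gint_laplace n th hnu s0.
have x0 : 0 < x by rewrite invr_gt0 mulr_gt0.
pose F (i : 'I_(2 * n).+1) y : R[i] := lap_factor n th x * ('C(2 * n, i)%:R * (cis th ^+ 2) ^+ i) *
  (cpow y (2 * (nu - n%:R + (i : nat)%:R) - 1) * (kexp x y)%:C).
have IF i : cintegrable mu D (F i).
  exact: (cintegrableZ half_line_measurable _ (kint_integrable _ x0)).
have [_ SE] := @cint_sum _ _ R mu D half_line_measurable _ (index_enum 'I_(2 * n).+1) F IF.
transitivity (\sum_(i < (2 * n).+1) cintegral mu D (F i)); last first.
  rewrite /bsum mulr_sumr; apply: eq_bigr => i _.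
  by rewrite (cintZ half_line_measurable _ (kint_integrable _ x0)) -!mulrA.
rewrite -SE; apply: eq_cint => y /set_mem/half_lineP y0.
have yn := real_neq0 y0; have cn := cis_neq0 th.
pose z := y%:C * cis th; have zn : z != 0 by rewrite mulf_neq0.
(* The binomial expansion of w^(2n) for w = z + 1/z: its term i carries y^(2i-2n), which shifts the
   order of K from nu to nu - n + i. *)
have -> : wf th y ^+ (2 * n) = \sum_(i < (2 * n).+1) 'C(2 * n, i)%:R * (z ^+ i / z ^+ (2 * n - i)).
  rewrite -wfE// -/(cis th) -/z addrC exprDn; apply: eq_bigr => i _.
  by rewrite -mulr_natl exprVn mulrC; ring.
have -> : (2^-1 * 2^-1 ^+ (2 * n) / s ^+ (2 * n).+1 * expR (- (cabs (wf th y) ^+ 2 / (4 * s))))%:C =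
  (2^-1 * (4 ^+ n.+1 * x ^+ (2 * n).+1))%:C * (expR (- (2 * x * cos (2 * th))))%:C * (kexp x y)%:C :> R[i].
  rewrite -!realCM; congr (_%:C); rewrite -[RHS]mulrA /kexp -expRD.
  have -> : 2^-1 * (4 ^+ n.+1 * x ^+ (2 * n).+1) = 2^-1 * 2^-1 ^+ (2 * n) / s ^+ (2 * n).+1.
    rewrite /x invfM exprMn -mulrA -exprVn; congr (2^-1 * _).
    rewrite mulrA [in RHS]exprVn; congr (_ * _).
    rewrite exprVn exprS [in X in _ / X]exprS (exprM 2 2 n) (_ : 2 ^+ 2 = 4 :> R); last by ring.
    rewrite (exprM _ 2 n) [4 ^+ 2]expr2 exprMn.
    have : 4 ^+ n != 0 :> R by rewrite expf_neq0.
    by move: (4 ^+ n) => a a0; field.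
  by congr (_ * expR _); rewrite wf_sqr// /x; ring.
rewrite mulr_sumr mulr_suml; apply: eq_bigr => i _; rewrite /F /lap_factor.
have -> : cpow y (2 * (nu - n%:R + (i : nat)%:R) - 1) = cpow y (2 * nu - 1) * (y%:C ^+ i / y%:C ^+ (2 * n - i)).
  rewrite -!cpow_nat// -cpowN// -!cpowD//; congr cpow.
  have i2n : (i <= 2 * n)%N by rewrite -ltnS.
  rewrite natrB// natrM; ring.
have -> : z ^+ i / z ^+ (2 * n - i) = (y%:C ^+ i / y%:C ^+ (2 * n - i)) * (cis th ^+ 2) ^+ i / cis th ^+ (2 * n).
  have i2n : (i <= 2 * n)%N by rewrite -ltnS.
  have e1 : (cis th ^+ 2) ^+ i = cis th ^+ i * cis th ^+ i by rewrite -exprM mul2n -addnn exprD.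
  have e2 : cis th ^+ (2 * n) = cis th ^+ (2 * n - i) * cis th ^+ i by rewrite -exprD subnK.
  have e3 k : z ^+ k = y%:C ^+ k * cis th ^+ k by exact: exprMn.
  rewrite e1 e2 !e3.
  have a0 := expf_neq0 i cn; have b0 := expf_neq0 (2 * n - i)%N cn; have c0 := expf_neq0 (2 * n - i)%N yn.
  move: (cis th ^+ i) a0 (cis th ^+ (2 * n - i)) b0 (y%:C ^+ (2 * n - i)) c0 (y%:C ^+ i).
  move=> a a0 b b0 c c0 d; transitivity (d * a * (c^-1 * b^-1) * (a / a)).
    by rewrite divff// mulr1 invfM.
  by rewrite [(b * a)^-1]invfM; ring.
have G (a b c d e f g h : R[i]) : a * (g * (b * c * d)) * (h * e * f) =
    h * e * d * (g * c) * (a * b * f) by ring.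
exact: G.
Qed.

End GFormula.

(** * Uniqueness and the conclusion *)

Section Lerch.
Context {R : realType}.
Notation mu := (@lebesgue_measure R).
Notation D := (`]0%R, +oo[%classic : set R).
Implicit Types (f : R -> R) (h : R -> R[i]) (r x : R) (n N : nat).

(** In this decreasing variable the hypotheses of Lerch's theorem at integer parameters become the
    vanishing of all polynomial moments. *)
Definition expsq r : R := expR (- (1 * r ^+ 2)).

Lemma expsq_bound r : 0 <= expsq r <= 1.
Proof.
by rewrite expR_ge0 -[leRHS]expR0 ler_expR oppr_le0 mul1r sqr_ge0.
Qed.

Lemma expsqX r N : expsq r ^+ N = expR (- (N%:R * r ^+ 2)).
Proof. by rewrite /expsq -expRM_natl; congr expR; ring. Qed.

Lemma expsq_lt r x : 0 <= r -> r < x -> expsq x < expsq r.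
Proof. by move=> r0 rx; rewrite ltr_expR ltrN2 !mul1r ltrXn2r// ?nnegrE// (le_trans r0)// ltW. Qed.

Lemma poly_moment f : (forall r, 0 < r -> {for r, continuous f}) ->
  mu.-integrable D (EFin \o f) ->
  (forall N, \int[mu]_(r in D) (f r * expR (- (N%:R * r ^+ 2))) = 0) ->
  forall p : {poly R}, mu.-integrable D (EFin \o (fun r => f r * p.[expsq r])) /\
    \int[mu]_(r in D) (f r * p.[expsq r]) = 0.
Proof.
move=> cf If H p.
have mf : measurable_fun D f by exact: measurable_half_line.
have If' : mu.-integrable D (EFin \o (fun r => `|f r|)).
  by have := integrable_abse If; apply: eq_integrable => //; exact: half_line_measurable.
pose F (i : 'I_(size p)) r : R := p`_i * (f r * expsq r ^+ i).
have I1 (N : nat) : mu.-integrable D (EFin \o (fun r => f r * expsq r ^+ N)).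
  apply: (integrable_le half_line_measurable _ If').
    apply: measurable_half_line => r r0; apply: continuousM; first exact: cf.
    have := @expRN_sqr_continuous R N%:R r.
    by rewrite (_ : (fun r => expR _) = (fun r => expsq r ^+ N))//; apply/funext => t; rewrite expsqX.
  move=> r _; have /andP[e0 e1] := expsq_bound r.
  rewrite normrM -[leRHS]mulr1 ler_wpM2l// ger0_norm ?exprn_ge0//.
  exact: exprn_ile1.
have I2 i : mu.-integrable D (EFin \o F i) by exact: RintegrableZ.
have [S1 S2] := Rint_sum (index_enum 'I_(size p)) I2.
have E r : \sum_(i <- index_enum 'I_(size p)) F i r = f r * p.[expsq r].
  by rewrite horner_coef mulr_sumr; apply: eq_bigr => i _; rewrite /F; ring.
split.
  by move: S1; under [X in _.-integrable _ (EFin \o X)]eq_fun do rewrite E.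
under eq_Rintegral do rewrite -E.
rewrite S2 big1// => i _.
rewrite /F (RintegralZl _ half_line_measurable (I1 i)).
under eq_Rintegral do rewrite expsqX.
by rewrite H mulr0.
Qed.

(* If f > 0 at r0, integrate f against powers of 1 - (e^(-r^2) - e^(-r0^2))^2,
   which concentrate at r0. *)
Lemma lerch_pos f : (forall r, 0 < r -> {for r, continuous f}) ->
  mu.-integrable D (EFin \o f) ->
  (forall N, \int[mu]_(r in D) (f r * expR (- (N%:R * r ^+ 2))) = 0) ->
  forall r, 0 < r -> f r <= 0.
Proof.
move=> cf If H r0 r00; rewrite leNgt; apply/negP => fr0.
have PM := poly_moment cf If H.
pose c := f r0 / 2; have c0 : 0 < c by rewrite divr_gt0.
have [d [d0 dr Hd]] : exists d, [/\ 0 < d, d < r0 & forall r, `|r - r0| <= d -> c <= f r].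
  have := cf r0 r00; move/cvgrPdist_lt => /(_ c c0) [e /= e0 He].
  exists (Num.min (e / 2) (r0 / 2)); split.
  - by rewrite lt_min !divr_gt0.
  - by rewrite gt_min; apply/orP; right; lra.
  - move=> r; rewrite le_min => /andP[re _]; have := He r; rewrite /ball_ /= distrC.
    move=> /(_ _); have re2 : `|r - r0| < e by lra.
    move=> /(_ re2); rewrite ltr_norml /c => /andP[_]; lra.
pose v := expsq r0; have /andP[v0 v1] := expsq_bound r0.
(* By monotonicity, at distance more than d from r0 the value of [expsq] differs from v by at least
   this much. *)
pose e := Num.min (v - expsq (r0 + d)) (expsq (r0 - d) - v).
have e0 : 0 < e by rewrite lt_min !subr_gt0 !expsq_lt//; [lra..].
have e1 : e <= 1.
  have := expsq_bound (r0 + d); rewrite /e ge_min => /andP[h1 h2]; apply/orP; left; rewrite /v; lra.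
have out r : 0 < r -> d < `|r - r0| -> e <= `|expsq r - v|.
  move=> rp; rewrite ltr_normr => /orP[h|h].
    have : expsq r < expsq (r0 + d) by apply: expsq_lt; lra.
    move=> h2; rewrite ler_normr; apply/orP; right; rewrite /e ge_min; apply/orP; left; lra.
  have : expsq (r0 - d) < expsq r by apply: expsq_lt; lra.
  move=> h2; rewrite ler_normr; apply/orP; left; rewrite /e ge_min; apply/orP; right; lra.
have [t [t0 td Ht]] : exists t, [/\ 0 < t, t <= d & forall r, `|r - r0| <= t -> `|expsq r - v| <= e / 2].
  have e2 : 0 < e / 2 by rewrite divr_gt0.
  have := @expRN_sqr_continuous R 1 r0; move/cvgrPdist_lt => /(_ _ e2) [e' /= e'0 He].
  exists (Num.min (e' / 2) d); split.
  - by rewrite lt_min divr_gt0.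
  - by rewrite ge_min lexx orbT.
  - move=> r; rewrite le_min => /andP[re _]; have := He r; rewrite /ball_ /= distrC.
    move=> /(_ _); have re2 : `|r - r0| < e' by lra.
    by move=> /(_ re2); rewrite distrC => /ltW.
(* After division by m, Q is at least 1 within distance t of r0 and at most rho < 1 beyond distance
   d. Between the two only the sign of Q matters, f being positive there. *)
pose Q r := 1 - (expsq r - v) ^+ 2.
pose m := 1 - (e / 2) ^+ 2; pose rho := (1 - e ^+ 2) / m.
have m0 : 0 < m by rewrite /m; nra.
have rho0 : 0 <= rho by rewrite divr_ge0 ?(ltW m0)//; nra.
have rho1 : rho < 1 by rewrite ltr_pdivrMr// mul1r /m; nra.
have Q0 r : 0 <= Q r.
  have /andP[a b] := expsq_bound r; rewrite /Q /v.
  have : `|expsq r - expsq r0| <= 1 by rewrite ler_norml; apply/andP; split; lra.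
  have := normr_ge0 (expsq r - expsq r0).
  rewrite -(real_normK (num_real (expsq r - expsq r0))); nra.
pose A : set R := `[r0 - t, r0 + t]%classic.
have low N r : 0 < r -> c * \1_A r - rho ^+ N * `|f r| <= f r * (Q r / m) ^+ N.
  move=> rp; have [rd|rd] := leP `|r - r0| d.
    have fr := Hd r rd; have fp : 0 <= f r by apply: le_trans fr; exact: ltW.
    have rN : 0 <= rho ^+ N * `|f r| by rewrite mulr_ge0 ?exprn_ge0.
    have [rt|rt] := boolP (r \in A).
      have rt' : `|r - r0| <= t.
        by move: rt; rewrite inE /A /= in_itv /= ler_norml => /andP[h1 h2]; apply/andP; split; lra.
      rewrite indicE rt mulr1.
      have Qm : 1 <= Q r / m.
        rewrite ler_pdivlMr// mul1r /Q /m lerB// -(real_normK (num_real (expsq r - v))).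
        by rewrite lerXn2r// ?nnegrE ?divr_ge0 ?(ltW e0)//; exact: Ht.
      have := exprn_ege1 N Qm; nra.
    rewrite indicE (negbTE rt) mulr0 sub0r.
    apply: (@le_trans _ _ 0); first by rewrite oppr_le0.
    by rewrite mulr_ge0// exprn_ge0// divr_ge0// ltW.
  have rA : (r \in A) = false.
    apply/negP; rewrite inE /A /= in_itv /= => /andP[h1 h2].
    by move: rd; rewrite ltNge ler_norml => /negP; apply; apply/andP; split; lra.
  rewrite indicE rA mulr0 sub0r lerNl.
  have Qr : Q r / m <= rho.
    rewrite /rho ler_wpM2r ?invr_ge0 ?(ltW m0)// /Q lerB// -(real_normK (num_real (expsq r - v))).
    by rewrite lerXn2r// ?nnegrE ?(ltW e0)//; exact: out.
  have QN : (Q r / m) ^+ N <= rho ^+ N by rewrite lerXn2r// nnegrE divr_ge0// ltW.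
  have Qp : 0 <= (Q r / m) ^+ N by rewrite exprn_ge0// divr_ge0// ltW.
  apply: le_trans (ler_norm _) _; rewrite normrN normrM (ger0_norm Qp) mulrC.
  by rewrite ler_wpM2r.
have mf : measurable_fun D f by exact: measurable_half_line.
have If' : mu.-integrable D (EFin \o (fun r => `|f r|)).
  by have := integrable_abse If; apply: eq_integrable => //; exact: half_line_measurable.
have AD r : A r -> 0 < r by rewrite /A /= in_itv /= => /andP[h _]; lra.
have mA : measurable (A : set (measurableTypeR R)) by exact: measurable_itv.
have IA : mu.-integrable D (EFin \o (fun r => \1_A r : R)).
  apply: (integrable_le half_line_measurable _ (RintegrableZ c^-1 If')).
    by apply: measurable_funTS; exact: measurable_indic.
  move=> r _; rewrite indicE; have [rA|_] := boolP (r \in A); last first.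
    by rewrite normr0 mulr_ge0 ?invr_ge0 ?(ltW c0).
  rewrite normr1 ler_pdivlMl// mulr1; apply: le_trans (Hd r _) (ler_norm _).
  by move: rA; rewrite inE /A /= in_itv /= ler_norml => /andP[h1 h2]; apply/andP; split; lra.
have EA : \int[mu]_(r in D) (\1_A r : R) = 2 * t.
  rewrite /Rintegral (@integral_indic _ _ _ mu D half_line_measurable A mA).
  have -> : A `&` D = A.
    by apply/seteqP; split => r; [case|move=> Ar; split => //; apply/half_lineP; exact: AD].
  transitivity (fine (2 * t)%:E); last by [].
  congr fine.
  apply: (eq_trans (@lebesgue_measure_itv R `[r0 - t, r0 + t])).
  rewrite /= lte_fin ifT; last by lra.
  by rewrite -EFinB; congr (_%:E); ring.
have main N : c * (2 * t) <= rho ^+ N * \int[mu]_(r in D) `|f r|.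
  pose p : {poly R} := ((1 - ('X - v%:P) ^+ 2) * (m^-1)%:P) ^+ N.
  have [P1 P2] := PM p.
  have pE r : p.[expsq r] = (Q r / m) ^+ N by rewrite /p !hornerE.
  have I2 := RintegrableZ c IA; have I3 := RintegrableZ (rho ^+ N) If'.
  have I4 : mu.-integrable D (EFin \o (fun r => c * \1_A r - rho ^+ N * `|f r|)).
    have := integrableB half_line_measurable I2 I3.
    by apply: eq_integrable => //; exact: half_line_measurable.
  have L : \int[mu]_(r in D) (c * \1_A r - rho ^+ N * `|f r|) <= \int[mu]_(r in D) (f r * p.[expsq r]).
    apply: (le_Rintegral half_line_measurable I4 P1).
    by move=> r /half_lineP rp; rewrite pE; exact: low.
  move: L; rewrite P2 (RintegralB half_line_measurable I2 I3).
  rewrite (RintegralZl _ half_line_measurable IA) (RintegralZl _ half_line_measurable If') EA.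
  by rewrite subr_le0.
have lim0 : (fun N => rho ^+ N * \int[mu]_(r in D) `|f r|) @ \oo --> 0.
  rewrite -[X in _ --> X](mul0r (\int[mu]_(r in D) `|f r|)).
  by apply: cvgM; [apply: cvg_expr; rewrite ger0_norm|exact: cvg_cst].
have : c * (2 * t) <= 0.
  by apply: (ler_cvg_to (cvg_cst _) lim0); exact: nearW.
by apply/negP; rewrite -ltNge mulr_gt0// mulr_gt0.
Qed.

Lemma lerch f : (forall r, 0 < r -> {for r, continuous f}) ->
  mu.-integrable D (EFin \o f) ->
  (forall N, \int[mu]_(r in D) (f r * expR (- (N%:R * r ^+ 2))) = 0) ->
  forall r, 0 < r -> f r = 0.
Proof.
move=> cf If H r r0; apply/eqP; rewrite eq_le lerch_pos//=.
rewrite -oppr_le0; apply: (@lerch_pos (fun r => - f r)) => //.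
- by move=> t t0; apply: continuousN; exact: cf.
- have := RintegrableZ (-1) If; apply: eq_integrable; first exact: half_line_measurable.
  by move=> t _ /=; rewrite mulN1r.
- move=> N; have [I0 E0] := poly_moment cf If H ('X^N).
  have E t : - f t * expR (- (N%:R * t ^+ 2)) = -1 * (f t * 'X^N.[expsq t]).
    by rewrite hornerXn expsqX mulN1r mulNr.
  under eq_Rintegral do rewrite E.
  by rewrite (RintegralZl _ half_line_measurable I0) E0 mulr0.
Qed.

(** The weight at s = 2 + N is the weight at s = 2 times e^(-N r^2). Hence the transforms are
    moments of the integrable function [gwts 2 n * h], and its nonvanishing weight can be divided
    out. *)
Lemma clerch (h : R -> R[i]) n : (forall r, 0 < r -> ccont h r) ->
  (forall N : nat, cintegrable mu D (fun r => (gwts (2 + N%:R) n r)%:C * h r) /\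
    cintegral mu D (fun r => (gwts (2 + N%:R) n r)%:C * h r) = 0) ->
  forall r, 0 < r -> h r = 0.
Proof.
move=> ch H r r0.
have E t N : gwts (2 + N%:R) n t = gwts 2 n t * expR (- (N%:R * t ^+ 2)).
  by rewrite /gwts -mulrA -expRD; congr (_ * expR _); ring.
have cg t : {for t, continuous (gwts 2 n : R -> R)}.
  by apply: continuousM; [exact: exprn_continuous|exact: expRN_sqr_continuous].
have [I0 _] := H 0%N; rewrite addr0 in I0.
have g0 : (gwts 2 n r : R) != 0.
  by rewrite mulf_neq0// ?expf_neq0 ?gt_eqF// expR_gt0.
have : (gwts 2 n r)%:C * h r = 0.
  apply: complex_ext.
    apply: (@lerch (fun t => complex.Re ((gwts 2 n t)%:C * h t))) => //.
    - move=> t t0; have /ccvg_ReIm[cR _] := ccontM (ccont_real (@cg t)) (ch t t0).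
      exact: cR.
    - by case: I0.
    - move=> N; have [_ E0] := H N.
      transitivity (complex.Re (cintegral mu D (fun r => (gwts (2 + N%:R) n r)%:C * h r))); last by rewrite E0.
      by apply: eq_Rintegral => t _; rewrite E !cReZ; ring.
  apply: (@lerch (fun t => complex.Im ((gwts 2 n t)%:C * h t))) => //.
  - move=> t t0; have /ccvg_ReIm[_ cI] := ccontM (ccont_real (@cg t)) (ch t t0).
    exact: cI.
  - by case: I0.
  - move=> N; have [_ E0] := H N.
      transitivity (complex.Im (cintegral mu D (fun r => (gwts (2 + N%:R) n r)%:C * h r))); last by rewrite E0.
    by apply: eq_Rintegral => t _; rewrite E !cImZ; ring.
by move/eqP; rewrite mulf_eq0 (inj_eq (@complexI R)) (negbTE g0) /= => /eqP.
Qed.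

End Lerch.

(** * Comparison of the two transforms *)

Section Assembly.
Context {R : realType}.
Notation mu := (@lebesgue_measure R).
Notation D := (`]0%R, +oo[%classic : set R).
Implicit Types (r s x th : R) (nu : R[i]) (l n : nat).

Lemma lap_factorN n th x : lap_factor n (- th) x = lap_factor n th x * (cis th ^+ 2) ^+ (2 * n).
Proof.
rewrite /lap_factor cisN mulrN cosN -[RHS]mulrA exprVn invrK; congr (_ * _).
have -> : (cis th ^+ 2) ^+ (2 * n) = cis th ^+ (2 * n) * cis th ^+ (2 * n).
  by rewrite -exprM (mul2n (2 * n)) -addnn exprD.
by rewrite mulKf// expf_neq0// cis_neq0.
Qed.

Lemma bsum_rev N (h : nat -> R[i]) : bsum N h = bsum N (fun l => h (N - l)%N).
Proof.
rewrite /bsum (reindex_inj rev_ord_inj) /=; apply: eq_bigr => i _.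
by rewrite subSS bin_sub// -ltnS.
Qed.

Lemma bsumZ N (c : R[i]) (h : nat -> R[i]) : c * bsum N h = bsum N (fun l => c * h l).
Proof. by rewrite /bsum mulr_sumr; apply: eq_bigr => i _; rewrite mulrCA. Qed.

Lemma bsumB N (h g : nat -> R[i]) : bsum N h - bsum N g = bsum N (fun l => h l - g l).
Proof. by rewrite /bsum -sumrB; apply: eq_bigr => i _; rewrite mulrBr. Qed.

Lemma eq_bsum N (h g : nat -> R[i]) : (forall l, (l <= N)%N -> h l = g l) -> bsum N h = bsum N g.
Proof. by move=> E; apply: eq_bigr => i _; rewrite E// -ltnS. Qed.

Lemma calJ_ccont nu n th r : 0 < r -> ccont (fun r => calJ nu n%:Z (r%:C * cis th)) r.
Proof.
move=> r0; pose f r := cpow (r / 2) (2 * nu) * (cis th ^+ (2 * n))^-1 *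
  (egf (jcoef (nu + n%:R) (cis (- th) ^+ 2)) (r ^+ 2) * egf (jcoef (nu - n%:R) (cis th ^+ 2)) (r ^+ 2)).
have E c : (exists C, 0 <= C /\ forall k : nat, cabs (c k) <= C * 4^-1 ^+ k) ->
    ccont (fun r => egf c (r ^+ 2)) r.
  move=> [C [C0 H]]; apply: (@ccont_comp _ (fun r => r ^+ 2) (egf c)); first exact: exprn_continuous.
  by apply: cderiv_ccont; apply: cderiv_egf; exists C, 4^-1; split.
have cf : ccont f r.
  apply: ccontM; [apply: ccontM; last exact: ccont_cst|apply: ccontM].
  - apply: (@ccont_comp _ (fun r => r / 2) (fun r => cpow r (2 * nu))).
      by apply: continuousM; [exact: cvg_id|exact: cvg_cst].
    by apply: ccont_cpow; rewrite divr_gt0.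
  - by apply: E; apply: jcoef_le; rewrite cabsX cabs_cis expr1n.
  - by apply: E; apply: jcoef_le; rewrite cabsX cabs_cis expr1n.
have fE t : 0 < t -> f t = calJ nu n%:Z (t%:C * cis th) by move=> t0; rewrite calJ_polar.
rewrite /ccont -fE//; apply: cvg_trans cf; apply: near_eq_cvg.
by near=> t; rewrite fE//; near: t; exact: lt_nbhsr.
Unshelve. all: by end_near. Qed.

Lemma calJ_diff_laplace nu n th s : nu != 0 -> `|complex.Re nu| < 4^-1 -> 2 <= s ->
  cintegral mu D (fun r => (gwts s n r)%:C * calJ (- nu) n%:Z (r%:C * cis (- th))) -
  cintegral mu D (fun r => (gwts s n r)%:C * calJ nu n%:Z (r%:C * cis th)) =
  (-1) ^+ n * (2 / pi)%:C * csin (pi%:C * nu) *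
    cintegral mu D (fun r => (gwts s n r)%:C * Gint n nu th r).
Proof.
move=> nu0 hnu s2; have s0 : 0 < s by apply: lt_le_trans s2.
have hnuN : `|complex.Re (- nu)| < 4^-1 by rewrite cReN normrN.
have [_ ->] := @calJ_laplace R (- nu) n (- th) s hnuN s2.
have [_ ->] := @calJ_laplace R nu n th s hnu s2.
rewrite Gint_formula//; set x := (4 * s)^-1.
have x0 : 0 < x by rewrite invr_gt0 mulr_gt0.
have KF : Kformula nu.
  move=> y y0; apply: Kint_ImB => //.
  by move: hnu; rewrite ltr_norml => /andP[h1 h2]; apply/andP; split; lra.
(* Reversing the sum for -nu turns its orders into the negatives of nu - n + l; with q = e^(2 i th),
   the factor q^(2n) of [lap_factorN] restores the power (-q)^l of the other sum. *)
rewrite lap_factorN -mulrA bsumZ bsum_rev.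
rewrite (@eq_bsum _ _ (fun l => (- cis th ^+ 2) ^+ l * ImB (- (nu - n%:R + l%:R)) x)); last first.
  move=> l l2n; rewrite mulrA cisN; congr (_ * ImB _ _); last first.
    by rewrite natrB// natrM; ring.
  have cn := cis_neq0 th.
  rewrite -[in LHS](subnK l2n) exprD mulrAC subnK// -exprMn exprVn mulrN divff ?expf_neq0//.
  rewrite -signr_odd oddB// oddM /= signr_odd.
  by rewrite [RHS]exprNn mulrC.
rewrite -mulrBr bsumB mulrCA; congr (_ * _); rewrite bsumZ; apply: eq_bsum => l _.
(* The sign (-1)^(l+n) of sin(pi (nu - n + l)) meets the sign of (-q)^l, so only (-1)^n survives. *)
have K := Kformula_shift n l KF.
rewrite (_ : nu + l%:R - n%:R = nu - n%:R + l%:R) in K; last by ring.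
have := K x x0; set Kv := Kint _ x; rewrite csin_shiftn csin_shift_sub => E.
have {E} : ImB (- (nu - n%:R + l%:R)) x - ImB (nu - n%:R + l%:R) x =
    2 * (Kv * ((-1) ^+ l * ((-1) ^+ n * csin (pi%:C * nu)) / pi%:C)).
  by rewrite E mulrA divff ?mul1r// pnatr_eq0.
rewrite -mulrBr => ->; rewrite [(- cis th ^+ 2) ^+ l]exprNn realCM realCV natC.
have sgn : (-1) ^+ l * (-1) ^+ l = 1 :> R[i] by rewrite -exprMn mulrNN mulr1 expr1n.
move: ((cis th ^+ 2) ^+ l) => q.
transitivity (((-1) ^+ l * (-1) ^+ l) * ((-1) ^+ n * (2 / pi%:C) * csin (pi%:C * nu) * (q * Kv))).
  by move: (csin _) ((-1) ^+ l) ((-1) ^+ n) => a b c; ring.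
by rewrite sgn mul1r.
Qed.

End Assembly.

(** * Orders other than 0, and an estimate near order 0 *)

Section MainFormula.
Context {R : realType}.
Notation mu := (@lebesgue_measure R).
Notation D := (`]0%R, +oo[%classic : set R).
Implicit Types (r s x th y : R) (nu : R[i]) (l n m k : nat).

Lemma calJ_diff nu n th r : nu != 0 -> `|complex.Re nu| < 4^-1 -> 0 < r ->
  calJ (- nu) n%:Z (r%:C * cis (- th)) - calJ nu n%:Z (r%:C * cis th) =
  (-1) ^+ n * (2 / pi)%:C * csin (pi%:C * nu) * Gint n nu th r.
Proof.
move=> nu0 hnu r0; set c := (-1) ^+ n * _ * _.
have hnuN : `|complex.Re (- nu)| < 4^-1 by rewrite cReN normrN.
pose J1 r := calJ (- nu) n%:Z (r%:C * cis (- th)); pose J2 r := calJ nu n%:Z (r%:C * cis th).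
pose h r := J1 r - J2 r - c * Gint n nu th r.
suff : h r = 0 by move/eqP; rewrite subr_eq0 => /eqP.
apply: (@clerch R h n) => // [t t0|N].
  apply: ccontD; last by apply: ccontN; apply: ccontM; [exact: ccont_cst|exact: Gint_ccont].
  by apply: ccontD; [exact: calJ_ccont|apply: ccontN; exact: calJ_ccont].
set s := 2 + N%:R; have s2 : 2 <= s by rewrite lerDl.
have s0 : 0 < s by apply: lt_le_trans s2.
have [I1 _] := @calJ_laplace R (- nu) n (- th) s hnuN s2.
have [I2 _] := @calJ_laplace R nu n th s hnu s2.
have [I3 _ _] := Gint_laplace n th hnu s0.
have L := calJ_diff_laplace n th nu0 hnu s2; rewrite -/c in L.
have I12 := cintegrableD half_line_measurable I1 (cintegrableN half_line_measurable I2).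
have I3c := cintegrableZ half_line_measurable c I3.
have E t : (gwts s n t)%:C * J1 t - (gwts s n t)%:C * J2 t - c * ((gwts s n t)%:C * Gint n nu th t) =
  (gwts s n t)%:C * h t.
  by rewrite /h; move: (J1 t) (J2 t) (Gint _ _ _ _) => a b d; ring.
have I4 := cintegrableD half_line_measurable I12 (cintegrableN half_line_measurable I3c).
split; first by apply: (eq_cintegrable half_line_measurable _ I4) => t _; exact: E.
transitivity (cintegral mu D (fun t => (gwts s n t)%:C * J1 t - (gwts s n t)%:C * J2 t -
    c * ((gwts s n t)%:C * Gint n nu th t))).
  by apply: eq_cint => t _; rewrite E.
rewrite (cintB half_line_measurable I12 I3c) (cintB half_line_measurable I1 I2).
by rewrite (cintZ half_line_measurable c I3) L subrr.
Qed.

(** By the reflection formula a zero of the sine would be a zero of [rGamma] at 1 + nu or 1 - nu,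
    where the real part is positive and Euler's integral is its inverse. *)
Lemma csin_neq0 nu : nu != 0 -> `|complex.Re nu| < 4^-1 -> csin (pi%:C * nu) != 0.
Proof.
move=> nu0; rewrite ltr_norml => /andP[h1 h2].
have g1 : 0 < complex.Re (1 + nu) by rewrite cReD /=; lra.
have g2 : 0 < complex.Re (1 - nu) by rewrite cReB /=; lra.
apply/eqP => s0; have := rGamma_reflection nu0; rewrite s0 mul0r => E.
have := gam_rGamma g1; have := gam_rGamma g2.
move/eqP: E; rewrite mulf_eq0 => /orP[/eqP->|/eqP->].
  by rewrite mul0r => _ /esym/eqP; rewrite oner_eq0.
by rewrite mul0r => /esym/eqP; rewrite oner_eq0.
Qed.

Lemma calK_genericE nu n th r : nu != 0 -> `|complex.Re nu| < 4^-1 -> 0 < r ->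
  calK_generic nu n%:Z (r%:C * cis th) = (-1) ^+ n * (2 / pi)%:C * Gint n nu th r.
Proof.
move=> nu0 hnu r0; rewrite /calK_generic calJN// calJ_diff//.
have sn := csin_neq0 nu0 hnu.
have G (a k b : R[i]) : a != 0 -> a^-1 * (k * a * b) = k * b by move=> a0; field.
exact: G.
Qed.

Lemma calK_genericN nu n th r : 0 < r ->
  calK_generic nu (- n%:Z) (r%:C * cis th) = calK_generic nu n%:Z (r%:C * cis (- th)).
Proof.
move=> r0; have E1 := calJN nu n th r0; have E2 := calJN (- nu) n (- th) r0.
by rewrite /calK_generic E1 E2 (opprK n%:Z) (opprK th).
Qed.

Lemma expR_norm_le x y : 0 <= y -> expR (y * `|x|) <= expR (y * x) + expR (- (y * x)).
Proof.
move=> y0; have [x0|x0] := leP 0 x; first by rewrite ger0_norm// lerDl expR_ge0.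
by rewrite ltr0_norm// mulrN lerDr expR_ge0.
Qed.

(** With t = |ln y|, the factor t is at most 8 e^(t/8) and the exponential is at most e^(t/16) since
    |nu| <= 1/32; the exponents add up to 3/16 = 2 (3/32). The orders 3/32 and -3/32 lie in the
    strip, so the bound is integrable against the kernel. *)
Lemma cpow_sub_bound nu y : 0 < y -> cabs nu <= 32^-1 ->
  cabs (cpow y (2 * nu - 1) - cpow y (2 * 0 - 1)) <=
  32 * cabs nu * (y `^ (2 * (3 / 32) - 1) + y `^ (2 * - (3 / 32) - 1)).
Proof.
move=> y0 hnu; pose t := `|ln y|; have t0 : 0 <= t by exact: normr_ge0.
have nn := cabs_ge0 nu.
have -> : cpow y (2 * nu - 1) - cpow y (2 * 0 - 1) = cpow y (-1) * (cexp (2 * nu * (ln y)%:C) - 1).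
  by rewrite mulr0 add0r cpowD// -(cpowE (2 * nu) y0); ring.
rewrite cabsM cabs_cpow//.
have -> : complex.Re (-1 : R[i]) = -1 by [].
have cE : cabs (2 * nu * (ln y)%:C) = 2 * cabs nu * t by rewrite !cabsM cabs_nat cabs_real.
have B := cabs_cexp_sub1 (2 * nu * (ln y)%:C); rewrite cE in B.
have tE : t <= 8 * expR (t / 8).
  have := expR_ge1Dx (t / 8); lra.
have e1 : expR (2 * cabs nu * t) <= expR (t / 16) by rewrite ler_expR; nra.
have e2 : expR (t / 8) * expR (t / 16) = expR (3 / 16 * t) by rewrite -expRD; congr expR; field.
have yE (a : R) : y `^ a = expR (a * ln y) by rewrite /powR gt_eqF.
have e3 : expR (3 / 16 * t) <= y `^ (3 / 16) + y `^ (- (3 / 16)).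
  rewrite !yE mulNr; exact: expR_norm_le.
have -> : y `^ (2 * (3 / 32) - 1) = y `^ (-1) * y `^ (3 / 16).
  by rewrite -powRD ?(gt_eqF y0) ?implybT//; congr powR; field.
have -> : y `^ (2 * - (3 / 32) - 1) = y `^ (-1) * y `^ (- (3 / 16)).
  by rewrite -powRD ?(gt_eqF y0) ?implybT//; congr powR; field.
rewrite -mulrDr [leRHS]mulrCA ler_wpM2l ?powR_ge0//; apply: le_trans B _.
have p1 : t * expR (2 * cabs nu * t) <= 8 * (y `^ (3 / 16) + y `^ (- (3 / 16))).
  apply: (@le_trans _ _ (8 * expR (t / 8) * expR (t / 16))).
    by apply: ler_pM => //; exact: expR_ge0.
  by rewrite -mulrA e2 ler_wpM2l.
have -> : 2 * (2 * cabs nu * t * expR (2 * cabs nu * t)) = 4 * cabs nu * (t * expR (2 * cabs nu * t)) by ring.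
have -> : 32 * cabs nu * (y `^ (3 / 16) + y `^ (- (3 / 16))) = 4 * cabs nu * (8 * (y `^ (3 / 16) + y `^ (- (3 / 16)))) by ring.
by rewrite ler_wpM2l// mulr_ge0.
Qed.

Lemma Gint_lipschitz n th r : 0 < r -> exists L, 0 <= L /\ forall nu, cabs nu <= 32^-1 ->
  cabs (Gint n nu th r - Gint n 0 th r) <= cabs nu * L.
Proof.
move=> r0; have [C [C0 HC]] := kernel_decay n th.
have e1 : `|complex.Re ((3 / 32)%:C : R[i])| < 4^-1 by rewrite /= ger0_norm; lra.
have e2 : `|complex.Re ((- (3 / 32))%:C : R[i])| < 4^-1 by rewrite /= normrN ger0_norm; lra.
pose C1 := C * (1 + (Num.sqrt r)^-1).
have C10 : 0 <= C1 by rewrite mulr_ge0// addr_ge0// invr_ge0 sqrtr_ge0.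
pose g y := gdom ((3 / 32)%:C : R[i]) y + gdom ((- (3 / 32))%:C : R[i]) y.
have ig : mu.-integrable D (EFin \o g).
  have := integrableD half_line_measurable (gdom_integrable e1) (gdom_integrable e2).
  by apply: eq_integrable => //; exact: half_line_measurable.
have g0 y : 0 <= g y by rewrite addr_ge0// gdom_ge0.
exists (2 * (32 * C1 * \int[mu]_(y in D) g y)); split.
  by rewrite !mulr_ge0//; apply: Rintegral_ge0 => y _; exact: g0.
move=> nu hnu.
have h1 : `|complex.Re nu| < 4^-1 by apply: le_lt_trans (cabs_Re _) _; apply: le_lt_trans hnu _; lra.
have h2 : `|complex.Re (0 : R[i])| < 4^-1 by rewrite /= normr0; lra.
have I1 := Kr_integrable n th h1 r0; have I2 := Kr_integrable n th h2 r0.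
rewrite /Gint -(cintB half_line_measurable I1 I2).
have I3 := cintegrableD half_line_measurable I1 (cintegrableN half_line_measurable I2).
have Ig := RintegrableZ (cabs nu * (32 * C1)) ig.
apply: le_trans (cabs_cint_le half_line_measurable I3 Ig _) _.
  move=> y /half_lineP y0; rewrite /Kr.
  have G (a b w c : R[i]) : a * w * c - b * w * c = (a - b) * (w * c) by ring.
  rewrite G cabsM Jn_wf.
  apply: le_trans (ler_pM (cabs_ge0 _) (normr_ge0 _) (cpow_sub_bound y0 hnu) (HC r y r0 y0)) _.
  rewrite /g /gdom -/C1 [complex.Re _]/= [complex.Re (- _)%:C]/=.
  have G' (a b c d e f : R) : a * b * (c + d) * (e * f) = b * (a * e) * (c * f + d * f) by ring.
  by rewrite G'.
by rewrite (RintegralZl _ half_line_measurable ig) le_eqVlt; apply/orP; left; apply/eqP; ring.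
Qed.

End MainFormula.

(** * Order 0, negative p, and the conclusion *)

Section ConjugateOrder.
Context {R : realType}.
Notation mu := (@lebesgue_measure R).
Notation D := (`]0%R, +oo[%classic : set R).
Implicit Types (r s x th y : R) (nu u w : R[i]) (l n m k : nat).

Lemma cabs_dnbhs0 : cabs (z : R[i]) @[z --> (0 : R[i]^o)^'] --> (0 : R).
Proof.
have H : cabs (z : R[i]) @[z --> (0 : R[i]^o)] --> (0 : R).
  rewrite -(cabs0 (R := R)); exact: (@ccvg_cabs R R[i] (nbhs (0 : R[i]^o)) _ id 0 cvg_id).
by apply: cvg_trans H; apply: cvg_app; exact: cvg_within.
Qed.

Lemma calK_nat nu n th r : `|complex.Re nu| < 4^-1 -> 0 < r ->
  calK nu n%:Z (r%:C * cis th) = (-1) ^+ n * (2 / pi)%:C * Gint n nu th r.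
Proof.
move=> hnu r0; rewrite /calK; set c := (-1) ^+ n * _; case: asboolP => [[m Em]|nint]; last first.
  apply: calK_genericE => //; apply/eqP => nu0; apply: nint; exists 0.
  by rewrite nu0.
(* The strip contains no integer other than 0. *)
have {Em} -> : nu = 0.
  rewrite Em; suff -> : m = 0 by [].
  move: hnu; rewrite Em -(rmorph_int (real_complex R)) /= -intr_norm => h.
  have : (`|m|%:~R : R) < 1%:~R by apply: lt_trans h _; lra.
  by rewrite ltr_int; lia.
(* At order 0 the value is a punctured limit; at nearby nonzero orders the formula holds, and its
   right-hand side satisfies a Lipschitz estimate at 0. *)
apply: climE; apply/ccvgP.
have [L [L0 HL]] := Gint_lipschitz n th r0.
apply: (@squeeze_cvgr _ _ _ _ (fun=> 0) (fun z => cabs c * (cabs z * L))); last 2 first.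
- exact: cvg_cst.
- rewrite -(mulr0 (cabs c)) -[X in _ * X](mul0r L).
  by apply: cvgM; [exact: cvg_cst|apply: cvgM; [exact: cabs_dnbhs0|exact: cvg_cst]].
have h32 : 0 < 32^-1 :> R by rewrite invr_gt0.
have N1 : \forall z \near (0 : R[i]^o)^', cabs z <= 32^-1.
  have /cvgrPdist_le /(_ _ h32) := cabs_dnbhs0; apply: filterS => z.
  by rewrite sub0r normrN ger0_norm ?cabs_ge0.
near=> z; rewrite cabs_ge0 /=.
have z0 : z != 0.
  by near: z; have := @nbhs_dnbhs_neq (R[i]^o) 0; apply: filterS => z zn; exact: zn.
have zs : cabs z <= 32^-1 by near: z; exact: N1.
have hz : `|complex.Re z| < 4^-1.
  by apply: le_lt_trans (cabs_Re _) _; apply: le_lt_trans zs _; lra.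
rewrite calK_genericE// -/c -mulrBr cabsM ler_wpM2l ?cabs_ge0//.
exact: HL.
Unshelve. all: by end_near. Qed.

Lemma bstar_term_abssum (nu z : R[i]) : abssum (bstar_term nu z).
Proof.
have [C HC] := rGamma_bound (nu + 1).
have C0 : 0 <= C by apply: le_trans (HC 0); exact: cabs_ge0.
have H (k : nat) : cabs (rGamma (nu + k%:R + 1)) <= C * 1 ^+ k by rewrite expr1n mulr1 addrAC.
apply: (eq_abssum _ (@abssum_exp R _ C 1 (- (z / 2) ^+ 2) C0 ler01 H)) => k.
by rewrite /bstar_term /cexp_coeff [(- (z / 2) ^+ 2) ^+ k]exprNn -exprM.
Qed.

(** The first m terms vanish, since [rGamma] does at the nonpositive integers; the remaining ones
    form the series of order m. *)
Lemma besselJstar_neg m x : besselJstar (- m%:R) x%:C =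
  (-1) ^+ m * (x / 2)%:C ^+ (2 * m) * besselJstar m%:R x%:C.
Proof.
rewrite !besselJstarE_csum (csum_drop (i := m) (@bstar_term_abssum _ _)); last first.
  move=> k km; rewrite /bstar_term.
  have -> : - m%:R + k%:R + 1 = - (m - k.+1)%:R :> R[i] by rewrite natrB// -(natr1 k); ring.
  by rewrite rGamma_subnat mulr0.
rewrite -(csumZ _ (@bstar_term_abssum _ _)); apply: eq_csum => k; rewrite /bstar_term.
have -> : - m%:R + (m + k)%:R + 1 = k.+1%:R :> R[i] by rewrite natrD -(natr1 k); ring.
have -> : m%:R + k%:R + 1 = (m + k).+1%:R :> R[i] by rewrite -natrD natr1.
rewrite !rGamma_nat realCM realCV natC mulnDr !exprD.
by move: ((m + k)`!%:R^-1) (k`!%:R^-1) => a b; ring.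
Qed.

Lemma besselJ_neg_even n x : 0 <= x -> besselJ (- (2 * n)%:R) x = besselJ (2 * n)%:R x.
Proof.
(* At x = 0 the convention for [cpow 0] makes both sides 0 for n > 0, and they coincide for n =
   0. *)
move=> x0; rewrite /besselJ; have [->|xn] := eqVneq x 0.
  by rewrite mul0r /cpow eqxx oppr_eq0; case: eqP => [->|]; rewrite ?oppr0 ?mul0r.
have xp : 0 < x / 2 by rewrite divr_gt0// lt0r xn.
have sg : (-1) ^+ (2 * n) = 1 :> R[i] by rewrite exprM sqrrN !expr1n.
have a0 : (x / 2)%:C ^+ (2 * n) != 0 by rewrite expf_neq0// real_neq0.
rewrite besselJstar_neg cpowN// !cpow_nat// sg mul1r (mul2n (2 * n)) -addnn exprD mulrA.
by rewrite mulKf.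
Qed.

Lemma wfN th y : wf (- th) y = (wf th y)^*%C.
Proof. by apply: complex_ext; rewrite /wf /= ?cosN ?sinN ?mulrN. Qed.

(** Conjugation inverts a direction. For w = 0 the convention 0/0 = 0 leaves powers of 0, which
    agree because the exponents vanish together. *)
Lemma dir_conj w n : (w^*%C / `|w^*%C|) ^ (2 * n%:Z) = (w / `|w|) ^ (2 * - n%:Z).
Proof.
have -> : w^*%C / `|w^*%C| = w^*%C / (cabs w)%:C.
  by rewrite -(cabs_conj w); congr (_ / _); exact: normcE.
have -> : w / `|w| = w / (cabs w)%:C by congr (_ / _); exact: normcE.
rewrite mulrN -PoszM; have [->|w0] := eqVneq w 0.
  by rewrite conjc0 cabs0 !mul0r !exp0rz oppr_eq0.
have c0 : (cabs w)%:C != 0 :> R[i] by apply: real_neq0; rewrite cabs_gt0.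
have E : w * w^*%C = (cabs w)%:C ^+ 2.
  rewrite -realCX cabsE sqr_sqrtr ?addr_ge0 ?sqr_ge0//.
  by apply: complex_ext; case: w {w0 c0} => a b /=; ring.
rewrite -exprz_inv; congr (_ ^ _); apply: (mulfI (_ : w / (cabs w)%:C != 0)).
  by rewrite mulf_neq0 ?invr_eq0.
by rewrite mulfV ?mulf_neq0 ?invr_eq0// mulrACA E -invfM -expr2 divff// expf_neq0.
Qed.

Lemma integrandN nu n u th y : 0 < y ->
  integrand nu (- n%:Z) u th y = integrand nu n%:Z u (- th) y.
Proof.
move=> y0; rewrite /integrand (wfE th y0) (wfE (- th) y0).
have -> : cabs (wf (- th) y) = cabs (wf th y) by rewrite wfN cabs_conj.
have -> : (wf (- th) y / `|wf (- th) y|) ^ (2 * n%:Z) = (wf th y / `|wf th y|) ^ (2 * - n%:Z).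
  by rewrite wfN; exact: dir_conj.
have -> : (2 * - n%:Z)%:~R = - (2 * n)%:R :> R[i] by rewrite mulrN rmorphN -PoszM.
have -> : (2 * n%:Z)%:~R = (2 * n)%:R :> R[i] by rewrite -PoszM.
by rewrite besselJ_neg_even// mulr_ge0 ?cabs_ge0.
Qed.

Lemma calKN nu n th r : 0 < r ->
  calK nu (- n%:Z) (r%:C * cis th) = calK nu n%:Z (r%:C * cis (- th)).
Proof.
move=> r0; have E : (fun z => calK_generic z (- n%:Z) (r%:C * cis th)) =
    (fun z => calK_generic z n%:Z (r%:C * cis (- th))).
  by apply/funext => z; exact: (calK_genericN z n th r0).
rewrite /calK; case: asboolP => _; last exact: (calK_genericN nu n th r0).
exact: (congr1 (fun f : R[i] -> R[i] => lim ((f z : R[i]^o) @[z --> (nu : R[i]^o)^'])) E).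
Qed.

Lemma theorem_nat nu n u th : `|complex.Re nu| < 4^-1 -> u != 0 ->
  cintegrable mu D (integrand nu n%:Z u th) /\
  calK nu n%:Z ((cabs u)%:C * cis th) = (-1) ^+ n * (2 / pi)%:C * cintegral mu D (integrand nu n%:Z u th).
Proof.
move=> hnu u0; have r0 : 0 < cabs u by rewrite cabs_gt0.
have E y : D y -> Kr n nu th (cabs u) y = integrand nu n%:Z u th y.
  by move=> /half_lineP y0; rewrite integrandE.
have I := Kr_integrable n th hnu r0; split.
  by apply: (eq_cintegrable half_line_measurable _ I) => y /set_mem; exact: E.
rewrite calK_nat//; congr (_ * _); apply: eq_cint => y /set_mem; exact: E.
Qed.

End ConjugateOrder.

Theorem theorem12p1 (R : realType) (nu : R[i]) (hnu : `|complex.Re nu| < 4^-1)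
    (p : int) (u : R[i]) (hu : u != 0)
    (theta : R) (htheta : u = `|u| * cexp ('i%C * theta%:C)) :
  cintegrable (@lebesgue_measure R) `]0%R, +oo[ (integrand nu p u theta) /\
  calK nu p u =
    (-1) ^ p * (2 / pi)%:C *
    cintegral (@lebesgue_measure R) `]0%R, +oo[ (integrand nu p u theta).
Proof.
have uE : u = (cabs u)%:C * cis theta.
  by rewrite {1}htheta; congr (_ * _); exact: normcE.
case: p => n; first by rewrite {2}uE; exact: theorem_nat.
(* [integrand] depends on [u] only through its modulus, so for negative p passing to the conjugate
   of [u] amounts to changing the sign of the angle. *)
rewrite NegzE; have [I E] := @theorem_nat R nu n.+1 u (- theta) hnu hu.
have H y : (`]0%R, +oo[%classic : set R) y ->
    integrand nu n.+1%:Z u (- theta) y = integrand nu (- n.+1%:Z) u theta y.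
  by move=> /half_lineP y0; rewrite integrandN.
split; first by apply: (eq_cintegrable half_line_measurable _ I) => y /set_mem; exact: H.
have r0 : 0 < cabs u by rewrite cabs_gt0.
transitivity (calK nu n.+1%:Z ((cabs u)%:C * cis (- theta))).
  by rewrite [in LHS]uE; exact: calKN.
have S : (-1) ^ (- n.+1%:Z) = (-1) ^+ n.+1 :> R[i] by rewrite -exprz_inv invrN1.
have EI : cintegral (@lebesgue_measure R) `]0%R, +oo[ (integrand nu n.+1%:Z u (- theta)) =
    cintegral (@lebesgue_measure R) `]0%R, +oo[ (integrand nu (- n.+1%:Z) u theta).
  by apply: eq_cint => y /set_mem; exact: H.
by rewrite S -EI; exact: E.
Qed.
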